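(* Let $K\in L^2(0,2\pi)$ be fixed. Then there exist $N_0\in\mathbb{N}$ and $b_0>0$ such that for every $N\geq N_0$ and every $b\geq b_0$: (i) The rectangle $\mathcal{R}_{N,b}=\{z\in\mathbb{C}\mid-(N+1/2)\leq\mathrm{Re}(z)\leq N+1/2,\ -b\leq\mathrm{Im}(z)\leq b\}$ contains exactly $2N+1$ eigenvalues of $P_{1,K}$, counting algebraic multiplicity. (ii) For each $n\in\mathbb{Z}$ with $|n|>N$ and $\langle\psi_n,K\rangle\neq0$, there is exactly one eigenvalue of $P_{1,K}$ of algebraic multiplicity one in the disk with center point $n$ and radius $|\langle\psi_n,K\rangle|$. (iii) For each $n\in\mathbb{Z}$ with $|n|>N$ and $\langle\psi_n,K\rangle=0$, the number $n$ is an eigenvalue of $P_{1,K}$ of algebraic multiplicity one. Moreover, the eigenvalues described in (i), (ii) and (iii) are all the eigenvalues of $P_{1,K}$.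
   Context: $\langle f,g\rangle=\int_0^{2\pi}\overline{f(t)}g(t)\,dt$ is the inner product of $L^2(0,2\pi)$ (complex-valued functions), and $\psi_n(x)=\frac{1}{\sqrt{2\pi}}e^{-inx}$ for $n\in\mathbb{Z}$. For $K\in L^2(0,2\pi)$, the operator $P_{1,K}$ in $L^2(0,2\pi)$ is defined by $$\mathrm{dom}(P_{1,K})=\{f\in H^1(0,2\pi)\mid f(0)=f(2\pi)\},\qquad (P_{1,K}f)(x)=if'(x)+f(2\pi)K(x).$$ For an eigenvalue $\lambda$ of an operator $A$, the root space is $\mathcal{R}(\lambda,A)=\{f\mid\exists j\in\mathbb{N}\text{ such that }(A-\lambda)^jf=0\}$ and the algebraic multiplicity is $\dim\mathcal{R}(\lambda,A)$. *)

(* Defs.v *)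
From HB Require Import structures.
From mathcomp Require Import all_boot all_order all_algebra generic_quotient.
From mathcomp Require Import all_classical all_reals all_analysis.
From mathcomp Require Import measurable_realfun.
From mathcomp Require Import complex ring.

Set Implicit Arguments.
Unset Strict Implicit.
Unset Printing Implicit Defensive.
Import Order.TTheory GRing.Theory Num.Theory.
Import numFieldNormedType.Exports.

Local Open Scope classical_set_scope.
Local Open Scope ring_scope.
Local Open Scope complex_scope.
Local Open Scope quotient_scope.

Section L2_functions.
Context {R : realType}.
Implicit Types f g h : R -> R[i].

Local Notation mu := (@lebesgue_measure R).

Definition per_itv : set R := `]0, 2 * pi[%classic.

Definition cintegral (D : set R) f : R[i] :=
  (\int[mu]_(x in D) complex.Re (f x)) +i* (\int[mu]_(x in D) complex.Im (f x)).

Definition square_integrable f : Prop :=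
  [/\ measurable_fun per_itv (fun x => complex.Re (f x)),
      measurable_fun per_itv (fun x => complex.Im (f x)) &
      mu.-integrable per_itv
        (fun x => (complex.Re (f x) ^+ 2 + complex.Im (f x) ^+ 2)%:E)].

Definition ae_eq_per f g : Prop :=
  f = g %[ae mu in per_itv].

Definition inner f g : R[i] :=
  cintegral per_itv (fun t => (f t)^* * g t).

(* e^{-inx} = cos (nx) - i sin (nx) *)
Definition psi (n : int) : R -> R[i] := fun x =>
  ((Num.sqrt (2 * pi))^-1)%:C * (cos (n%:~R * x) -i* sin (n%:~R * x)).

Let measurable_per_itv : measurable per_itv.
Proof. exact: measurable_itv. Qed.

Lemma square_integrable0 : square_integrable (fun=> 0).
Proof.
split; [exact: measurable_cst | exact: measurable_cst|].
rewrite (_ : (fun _ => _) = cst 0%E); first exact: integrable0.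
by apply/funext => x /=; rewrite !expr0n addr0.
Qed.

Lemma square_integrableZ (a : R[i]) f :
  square_integrable f -> square_integrable (fun x => a * f x).
Proof.
case: a => a b [mr mi fi]; split.
- rewrite (_ : (fun _ => _) = (fun x => a * complex.Re (f x))
      \- (fun x => b * complex.Im (f x))); last first.
    by apply/funext => x /=; case: (f x).
  by apply: measurable_funB; apply: measurable_funM => //;
    exact: measurable_cst.
- rewrite (_ : (fun _ => _) = (fun x => a * complex.Im (f x))
      \+ (fun x => b * complex.Re (f x))); last first.
    by apply/funext => x /=; case: (f x).
  by apply: measurable_funD; apply: measurable_funM => //;
    exact: measurable_cst.
rewrite (_ : (fun _ => _) = (fun x => (a ^+ 2 + b ^+ 2)%:E *
    (complex.Re (f x) ^+ 2 + complex.Im (f x) ^+ 2)%:E)%E).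
  exact: integrableZl.
apply/funext => x; rewrite -EFinM; congr EFin; case: (f x) => c d /=; ring.
Qed.

Lemma square_integrableD f g : square_integrable f -> square_integrable g ->
  square_integrable (fun x => f x + g x).
Proof.
move=> [mfr mfi fi] [mgr mgi gi].
have ER x : complex.Re (f x + g x) = complex.Re (f x) + complex.Re (g x).
  by case: (f x) (g x) => ? ? [].
have EI x : complex.Im (f x + g x) = complex.Im (f x) + complex.Im (g x).
  by case: (f x) (g x) => ? ? [].
have mR : measurable_fun per_itv (fun x => complex.Re (f x + g x)).
  by under eq_fun do rewrite ER; exact: measurable_funD.
have mI : measurable_fun per_itv (fun x => complex.Im (f x + g x)).
  by under eq_fun do rewrite EI; exact: measurable_funD.
split => //.
pose F x := (complex.Re (f x) ^+ 2 + complex.Im (f x) ^+ 2).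
pose G x := (complex.Re (g x) ^+ 2 + complex.Im (g x) ^+ 2).
have iFG : mu.-integrable per_itv (fun x => (2%:E * ((F x)%:E + (G x)%:E))%E).
  by apply: integrableZl => //; exact: integrableD.
apply: le_integrable iFG => //.
  apply/measurable_EFinP; apply: measurable_funD; exact: measurable_funX.
move=> x _; rewrite ER EI -EFinD -EFinM !abse_EFin lee_fin.
have sq_ge0 (p q : R) : 0 <= p ^+ 2 + q ^+ 2 by rewrite addr_ge0 ?sqr_ge0.
rewrite (ger0_norm (sq_ge0 _ _)) ger0_norm; last first.
  by rewrite mulr_ge0// addr_ge0// /F /G sq_ge0.
rewrite /F /G.
rewrite -subr_ge0; set a := complex.Re (f x); set b := complex.Im (f x).
set c := complex.Re (g x); set d := complex.Im (g x).
rewrite (_ : _ - _ = (a - c) ^+ 2 + (b - d) ^+ 2) ?sq_ge0//; ring.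
Qed.

Lemma ae_eq_per_refl f : ae_eq_per f f.
Proof. exact: ae_eq_refl. Qed.

Lemma ae_eq_per_sym f g : ae_eq_per f g -> ae_eq_per g f.
Proof. exact: ae_eq_sym. Qed.

Lemma ae_eq_per_trans f g h :
  ae_eq_per f g -> ae_eq_per g h -> ae_eq_per f h.
Proof. exact: ae_eq_trans. Qed.

Lemma ae_eq_perD f f' g g' : ae_eq_per f f' -> ae_eq_per g g' ->
  ae_eq_per (fun x => f x + g x) (fun x => f' x + g' x).
Proof.
have F := @ae_filter_ringOfSetsType _ _ _ mu.
by apply: filterS2 => x ff gg xI; rewrite ff// gg.
Qed.

Lemma ae_eq_perZ (a : R[i]) f f' : ae_eq_per f f' ->
  ae_eq_per (fun x => a * f x) (fun x => a * f' x).
Proof.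
have F := @ae_filter_ringOfSetsType _ _ _ mu.
by apply: filterS => x ff xI; rewrite ff.
Qed.

End L2_functions.

Record L2fun (R : realType) := MkL2fun {
  L2fun_val :> R -> R[i];
  L2fun_valP : square_integrable L2fun_val }.

HB.instance Definition _ (R : realType) := gen_eqMixin (L2fun R).
HB.instance Definition _ (R : realType) := gen_choiceMixin (L2fun R).

Section L2_quotient.
Context (R : realType).
Implicit Types f g h : L2fun R.

Definition L2_equiv f g : bool := `[< ae_eq_per f g >].

Let L2_equiv_refl : reflexive L2_equiv.
Proof. by move=> f; apply/asboolP; exact: ae_eq_per_refl. Qed.

Let L2_equiv_sym : symmetric L2_equiv.
Proof. by move=> f g; apply/asboolP/asboolP => /ae_eq_per_sym. Qed.

Let L2_equiv_trans : transitive L2_equiv.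
Proof.
by move=> g f h /asboolP fg /asboolP gh; apply/asboolP/(ae_eq_per_trans fg gh).
Qed.

Canonical L2_equiv_canonical :=
  EquivRel L2_equiv L2_equiv_refl L2_equiv_sym L2_equiv_trans.

Definition L2 : Type := {eq_quot L2_equiv}.
HB.instance Definition _ := Choice.on L2.
HB.instance Definition _ := EqQuotient.on L2.

Definition L2_to_fun (f : L2) : R -> R[i] := repr f.

Lemma L2_piP f g : \pi_L2 f = \pi_L2 g <-> ae_eq_per f g.
Proof.
by split=> [/eqquotP/asboolP //|fg]; apply/eqquotP/asboolP.
Qed.

Lemma L2_piK f : ae_eq_per (L2_to_fun (\pi_L2 f)) f.
Proof. by apply/L2_piP; rewrite reprK. Qed.

Definition L2fun0 : L2fun R := MkL2fun square_integrable0.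
Definition L2funD f g : L2fun R :=
  MkL2fun (square_integrableD (L2fun_valP f) (L2fun_valP g)).
Definition L2funZ (a : R[i]) f : L2fun R :=
  MkL2fun (square_integrableZ a (L2fun_valP f)).

Definition L2_zero : L2 := \pi_L2 L2fun0.
Definition L2_add (f g : L2) : L2 := \pi_L2 (L2funD (repr f) (repr g)).
Definition L2_scale (a : R[i]) (f : L2) : L2 := \pi_L2 (L2funZ a (repr f)).
Definition L2_opp (f : L2) : L2 := L2_scale (- 1) f.

Lemma L2_addE f g : L2_add (\pi_L2 f) (\pi_L2 g) = \pi_L2 (L2funD f g).
Proof. by apply/L2_piP; apply: ae_eq_perD; exact: L2_piK. Qed.

Lemma L2_scaleE a f : L2_scale a (\pi_L2 f) = \pi_L2 (L2funZ a f).
Proof. by apply/L2_piP; apply: ae_eq_perZ; exact: L2_piK. Qed.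

Let L2fun_eq f g : (forall x, f x = g x) -> \pi_L2 f = \pi_L2 g.
Proof.
move=> fg; apply/L2_piP; rewrite (funext fg : f = g :> (_ -> _)).
exact: ae_eq_per_refl.
Qed.

Let L2_addA : associative L2_add.
Proof.
move=> f g h; rewrite -[f]reprK -[g]reprK -[h]reprK.
move: (repr f) (repr g) (repr h) => {}f {}g {}h.
rewrite (L2_addE g h) (L2_addE f g) (L2_addE f) (L2_addE (L2funD f g)).
by apply: L2fun_eq => x /=; rewrite addrA.
Qed.

Let L2_addC : commutative L2_add.
Proof. by move=> f g; apply: L2fun_eq => x /=; rewrite addrC. Qed.

Let L2_add0 : left_id L2_zero L2_add.
Proof.
by move=> f; rewrite -[f]reprK L2_addE; apply: L2fun_eq => x /=; rewrite add0r.
Qed.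

Let L2_addN : left_inverse L2_zero L2_opp L2_add.
Proof.
move=> f; rewrite -[f]reprK; move: (repr f) => {}f.
rewrite /L2_opp (L2_scaleE _ f) (L2_addE _ f).
by apply: L2fun_eq => x /=; rewrite mulN1r addNr.
Qed.

HB.instance Definition _ :=
  GRing.isZmodule.Build L2 L2_addA L2_addC L2_add0 L2_addN.

Let L2_scaleA a b (f : L2) : L2_scale a (L2_scale b f) = L2_scale (a * b) f.
Proof.
rewrite -[f]reprK; move: (repr f) => {}f.
rewrite (L2_scaleE b f) (L2_scaleE a) (L2_scaleE _ f).
by apply: L2fun_eq => x /=; rewrite mulrA.
Qed.

Let L2_scale1 : left_id 1 L2_scale.
Proof.
move=> f; rewrite -[f]reprK L2_scaleE.
by apply: L2fun_eq => x /=; rewrite mul1r.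
Qed.

Let L2_scaleDr : right_distributive L2_scale +%R.
Proof.
move=> a f g.
change (L2_scale a (L2_add f g) = L2_add (L2_scale a f) (L2_scale a g)).
rewrite -[f]reprK -[g]reprK; move: (repr f) (repr g) => {}f {}g.
rewrite (L2_addE f g) (L2_scaleE _ f) (L2_scaleE _ g) (L2_scaleE a).
rewrite (L2_addE (L2funZ a f)).
by apply: L2fun_eq => x /=; rewrite mulrDr.
Qed.

Let L2_scaleDl (f : L2) : {morph L2_scale^~ f : a b / a + b}.
Proof.
move=> a b; change (L2_scale (a + b) f = L2_add (L2_scale a f) (L2_scale b f)).
rewrite -[f]reprK; move: (repr f) => {}f.
rewrite !(L2_scaleE _ f) (L2_addE (L2funZ a f)).
by apply: L2fun_eq => x /=; rewrite mulrDl.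
Qed.

HB.instance Definition _ := GRing.Zmodule_isLmodule.Build R[i] L2
  L2_scaleA L2_scale1 L2_scaleDr L2_scaleDl.

End L2_quotient.

Coercion L2_to_fun : L2 >-> Funclass.

Section Spectrum.
Context {C : fieldType} {V : lmodType C}.

(* An operator in V is given by its graph: [A f g] means that f is in the
   domain of A and A f = g. *)
Implicit Types (A : V -> V -> Prop) (l : C).

Definition is_eigenvalue A l : Prop := exists2 f, f != 0 & A f (l *: f).

(* [shift_pow_zero A l j f] means that f is in the domain of (A - l)^j and
   (A - l)^j f = 0. *)
Fixpoint shift_pow_zero A l (j : nat) (f : V) : Prop :=
  if j is j'.+1 then exists2 g, A f g & shift_pow_zero A l j' (g - l *: f)
  else f = 0.

Definition root_space A l : set V := [set f | exists j, shift_pow_zero A l j f].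

Definition has_dim (S : set V) (k : nat) : Prop :=
  exists e : 'I_k -> V,
    [/\ forall i, S (e i),
        forall c : 'I_k -> C, \sum_i c i *: e i = 0 -> forall i, c i = 0 &
        forall v, S v -> exists c : 'I_k -> C, v = \sum_i c i *: e i].

Definition alg_mult A l (m : nat) : Prop := has_dim (root_space A l) m.

Definition eigenvalue_count A (D : set C) (k : nat) : Prop :=
  exists (s : seq C) (m : C -> nat),
    [/\ uniq s,
        forall l, l \in s <-> is_eigenvalue A l /\ D l,
        forall l, l \in s -> alg_mult A l (m l) &
        (\sum_(l <- s) m l = k)%N].

End Spectrum.

Section Operator.
Context {R : realType}.

(* The Sobolev space H^1(0, 2pi) consists of the absolutely continuous
   functions on [0, 2pi], that is the indefinite integrals, whose derivative is
   square integrable. [H1 u u'] says that u is such a function, taken as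
   its continuous representative, and that u' is its derivative. *)
Definition H1 (u u' : R -> R[i]) : Prop :=
  square_integrable u' /\
  forall x, 0 <= x <= 2 * pi -> u x = u 0 + cintegral `[0, x]%classic u'.

(* Graph of P_{1,K}; u is the continuous representative of f. *)
Definition P1 (K : L2 R) (f g : L2 R) : Prop :=
  exists u u' : R -> R[i],
    [/\ H1 u u', u 0 = u (2 * pi), ae_eq_per f u &
        ae_eq_per g (fun x => 'i%C * u' x + u (2 * pi) * K x)].

Definition rectangle (N : nat) (b : R) : set R[i] :=
  [set z | - (N%:R + 2^-1) <= complex.Re z <= N%:R + 2^-1 /\
           - b <= complex.Im z <= b].

Definition disk (c : R[i]) (r : R[i]) : set R[i] := [set z | `|z - c| < r].

End Operator.

(* Main.v *)
Require Import Defs.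
From mathcomp Require Import all_boot all_order all_algebra.
From mathcomp Require Import all_classical all_reals all_analysis.
From mathcomp Require Import measurable_realfun complex ring lra zify.

(* With [D l := 1 - e^{2 pi i l} + i \int_0^{2 pi} e^{i l t} K t dt], the Fourier
   type transform [hat f l := \int_0^{2 pi} e^{i l t} f t dt] turns
   [(P - l0) f = g] into [(l - l0) * hat f l = hat g l + i * f (2 pi) * D l].
   Hence the eigenvalues are the zeros of [D] and a Jordan chain at [l0] has
   transforms [i * D l / (l - l0) ^ j], so that the algebraic multiplicity is the
   order of the zero.  Expanding [e^{i l t}] in its Fourier series gives
   [D l = (1 - e^{2 pi i l}) * F l] with [F l := 1 - \sum_n k_n / (l - n)] and [k]
   square summable.

   The zeros are counted without contour integrals.  For a finite set [S] of
   integers on which the interaction with the other integers is small, a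
   contraction produces coefficients with [F = (1 - r) * (1 + u)], where
   [r l = \sum_(n in S) a_n / (l - n)] and [u l = \sum_(m notin S) u_m / (l - m)]:
   comparing residues, these are the equations [a_n * (1 + u n) = k_n] and
   [u_m * (1 - r m) = - k_m].  Near [S] the function [1 + u] does not vanish, so
   there the zeros of [D] are those of the numerator of [1 - r], a monic
   polynomial of degree [#|S|].  The sets [S = {|n| <= N}] and [S = {n}] give
   the three parts of the theorem. *)

Set Implicit Arguments.
Unset Strict Implicit.
Unset Printing Implicit Defensive.
Import Order.TTheory GRing.Theory Num.Theory.
Import numFieldNormedType.Exports.
Import ComplexField.Normc.
Local Open Scope ring_scope.

(** No holomorphy is used. The order of a zero at [l] is read off two-sided bounds of the modulus by
    a power of [s] on the ray [l + s] with small [s > 0] ([has_order]). Such orders add under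
    products and can be cancelled, and the identities behind them are needed only off [l] itself.
    This removes the obstacle that $F$ is singular at the integers, where eigenvalues may lie;
    Lipschitz bounds along the ray recover the values at [l].

    The constants fit together as follows. The interaction is required to be at most 1/8. While the
    unknowns $u(n)$ stay in the ball of radius 1/4, division by $1 + u(n)$ costs at most $4/3 = 1/(1
    - 1/4)$, and $4/3 \cdot 1/8 = 1/6 < 1/4$ keeps them there. For $S = \{n\}$ the root is thus
    within $4/3 |k_n|$ of $n$, and $4/3 < \sqrt{2\pi}$ puts it into the open disk, whose radius is
    $\sqrt{2\pi} |k_n|$.

    Smallness has two sources, both uniform in $z$ as long as $z$ keeps distance 1/4 from the
    frequencies summed over: the tail of $k$ is small in the mean square, and finitely many
    frequencies have little effect on a distant $z$. *)

Section complex_modulus.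
Context {R : realType}.
Local Open Scope complex_scope.
Implicit Types (x y z : R[i]) (a : R).

Lemma normc_ge0 z : 0 <= normc z.
Proof. by case: z => a b; exact: sqrtr_ge0. Qed.

Lemma sqr_normcE z : normc z ^+ 2 = complex.Re z ^+ 2 + complex.Im z ^+ 2.
Proof. by case: z => a b /=; rewrite sqr_sqrtr// addr_ge0 ?sqr_ge0. Qed.

Lemma normc_eq0 z : (normc z == 0) = (z == 0).
Proof. by apply/eqP/eqP => [/eq0_normc//|->]; rewrite normc0. Qed.

Lemma normc_gt0 z : (0 < normc z) = (z != 0).
Proof. by rewrite lt_neqAle normc_ge0 andbT eq_sym normc_eq0. Qed.

Lemma normr_normc z : `|z| = (normc z)%:C.
Proof. by case: z. Qed.

Lemma normcR a : normc a%:C = `|a|.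
Proof. by rewrite /= expr0n/= addr0 sqrtr_sqr. Qed.

Lemma normcX z n : normc (z ^+ n) = normc z ^+ n.
Proof.
by elim: n => [|n IH]; rewrite ?expr0 ?normc1// !exprS normcM IH.
Qed.

Lemma normc_i : normc ('i%C : R[i]) = 1.
Proof. by rewrite /= expr0n/= add0r expr1n sqrtr1. Qed.

Lemma ler_normcD x y : normc (x + y) <= normc x + normc y.
Proof. exact: le_normcD. Qed.

Lemma ler_normcB x y : normc (x - y) <= normc x + normc y.
Proof. by rewrite -(normcN y) le_normcD. Qed.

Lemma normc_distC x y : normc (x - y) = normc (y - x).
Proof. by rewrite -opprB normcN. Qed.

Lemma lerB_normc x y : normc x - normc y <= normc (x + y).
Proof.
by rewrite lerBlDr -{1}(addrK y x) (le_trans (ler_normcB _ _)).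
Qed.

Lemma ler_normc_sum (I : Type) (s : seq I) (P : pred I) (F : I -> R[i]) :
  normc (\sum_(i <- s | P i) F i) <= \sum_(i <- s | P i) normc (F i).
Proof.
elim/big_ind2: _ => //; first by rewrite normc0.
by move=> a b c d ab cd; rewrite (le_trans (ler_normcD _ _))// lerD.
Qed.

Lemma normr_Re_le z : `|complex.Re z| <= normc z.
Proof.
rewrite -ler_sqr ?nnegrE ?normc_ge0// real_normK ?num_real//.
by rewrite sqr_normcE lerDl sqr_ge0.
Qed.

Lemma normr_Im_le z : `|complex.Im z| <= normc z.
Proof.
rewrite -ler_sqr ?nnegrE ?normc_ge0// real_normK ?num_real//.
by rewrite sqr_normcE lerDr sqr_ge0.
Qed.

Lemma normc_le_ReIm z : normc z <= `|complex.Re z| + `|complex.Im z|.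
Proof.
rewrite -ler_sqr ?nnegrE ?normc_ge0 ?addr_ge0// sqr_normcE.
rewrite sqrrD !real_normK ?num_real// -addrA lerD2l lerDr.
by rewrite mulrn_wge0// mulr_ge0.
Qed.

Lemma cReD x y : complex.Re (x + y) = complex.Re x + complex.Re y.
Proof. by case: x y => ? ? []. Qed.
Lemma cImD x y : complex.Im (x + y) = complex.Im x + complex.Im y.
Proof. by case: x y => ? ? []. Qed.
Lemma cReN x : complex.Re (- x) = - complex.Re x. Proof. by case: x. Qed.
Lemma cImN x : complex.Im (- x) = - complex.Im x. Proof. by case: x. Qed.
Lemma cReM x y : complex.Re (x * y) =
  complex.Re x * complex.Re y - complex.Im x * complex.Im y.
Proof. by case: x y => ? ? []. Qed.
Lemma cImM x y : complex.Im (x * y) =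
  complex.Re x * complex.Im y + complex.Im x * complex.Re y.
Proof. by case: x y => ? ? []. Qed.

Lemma cRe_sum (I : Type) (s : seq I) (P : pred I) (F : I -> R[i]) :
  complex.Re (\sum_(i <- s | P i) F i) = \sum_(i <- s | P i) complex.Re (F i).
Proof. exact: (big_morph _ cReD). Qed.
Lemma cIm_sum (I : Type) (s : seq I) (P : pred I) (F : I -> R[i]) :
  complex.Im (\sum_(i <- s | P i) F i) = \sum_(i <- s | P i) complex.Im (F i).
Proof. exact: (big_morph _ cImD). Qed.

Lemma intr_complex (m : int) : (m%:~R : R[i]) = (m%:~R : R)%:C.
Proof. by rewrite rmorph_int. Qed.
Lemma cRe_int (m : int) : complex.Re (m%:~R : R[i]) = m%:~R.
Proof. by rewrite intr_complex. Qed.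
Lemma cIm_int (m : int) : complex.Im (m%:~R : R[i]) = 0.
Proof. by rewrite intr_complex. Qed.
Lemma normc_int (m : int) : normc (m%:~R : R[i]) = `|m%:~R|.
Proof. by rewrite intr_complex normcR. Qed.

End complex_modulus.

(** * The exponential $e^{izt}$ as a function of $z$ and $t$ *)

Section complex_exponential.
Context {R : realType}.
Local Open Scope complex_scope.
Implicit Types (w z : R[i]) (s t : R).

(* [ce z t] is e^{izt} *)
Definition ce z t : R[i] := (expR (- complex.Im z * t))%:C *
  (cos (complex.Re z * t) +i* sin (complex.Re z * t)).

Lemma ce_Re z t :
  complex.Re (ce z t) = expR (- complex.Im z * t) * cos (complex.Re z * t).
Proof. by rewrite /ce /= mul0r subr0. Qed.

Lemma ce_Im z t :
  complex.Im (ce z t) = expR (- complex.Im z * t) * sin (complex.Re z * t).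
Proof. by rewrite /ce /= mul0r addr0. Qed.

Lemma ce0 z : ce z 0 = 1.
Proof. by rewrite /ce !mulr0 expR0 cos0 sin0 mul1r. Qed.

Lemma ce0l t : ce 0 t = 1.
Proof. by rewrite /ce /= oppr0 !mul0r expR0 cos0 sin0 mul1r. Qed.

Lemma ceD z s t : ce z (s + t) = ce z s * ce z t.
Proof.
rewrite /ce !mulrDr expRD cosD sinD rmorphM /= mulrACA; congr (_ * _).
by apply/eqP; rewrite eq_complex /= eqxx/= addrC [_ * sin _]mulrC [X in _ + X]mulrC.
Qed.

Lemma ceDl w z t : ce (w + z) t = ce w t * ce z t.
Proof.
rewrite /ce cReD cImD opprD !mulrDl expRD cosD sinD rmorphM /= mulrACA.
congr (_ * _).
by apply/eqP; rewrite eq_complex /= eqxx/= addrC [_ * sin _]mulrC [X in _ + X]mulrC.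
Qed.

Lemma normc_ce z t : normc (ce z t) = expR (- complex.Im z * t).
Proof.
rewrite /ce normcM normcR (ger0_norm (expR_ge0 _)).
by rewrite /normc cos2Dsin2 sqrtr1 mulr1.
Qed.

Lemma ce_neq0 z t : ce z t != 0.
Proof. by rewrite -normc_eq0 normc_ce gt_eqF// expR_gt0. Qed.

Lemma ceN z t : ce (- z) t = (ce z t)^-1.
Proof.
by apply: (mulfI (ce_neq0 z t)); rewrite -ceDl subrr ce0l divff// ce_neq0.
Qed.

Lemma ce_real s t : ce s%:C t = cos (s * t) +i* sin (s * t).
Proof. by rewrite /ce /= oppr0 mul0r expR0 mul1r. Qed.

Lemma ce_conj s t : (ce s%:C t)^* = ce (- s%:C) t.
Proof.
by rewrite -(rmorphN (real_complex R)) !ce_real mulNr cosN sinN.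
Qed.

Lemma ce_int_2pi (m : int) : ce m%:~R (2 * pi) = 1.
Proof.
have H (n : nat) : ce (n%:~R : R[i]) (2 * pi) = 1.
  elim: n => [|n IH]; first by rewrite ce0l.
  rewrite -addn1 PoszD intrD ceDl IH mul1r.
  by rewrite intr_complex ce_real mul1r mulr_natl cos2pi sin2pi.
case: m => n; first exact: H.
by rewrite NegzE intrN ceN H invr1.
Qed.

Lemma ce_shift_2pi z (m : int) : ce (z + m%:~R) (2 * pi) = ce z (2 * pi).
Proof. by rewrite ceDl ce_int_2pi mulr1. Qed.

End complex_exponential.

(** * Integration by parts against a function that is only integrable *)

Section real_integration_by_parts.
Context {R : realType}.
Local Open Scope classical_set_scope.
Local Notation mu := (@lebesgue_measure R).

Lemma measurable_indic_le :
  measurable_fun setT (fun z : R * R => ((z.2 <= z.1)%R%:R : R)).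
Proof.
have mA : measurable [set z : R * R | z.2 <= z.1].
  have := @measurable_fun_ler _ _ _ setT (fun z : R * R => z.2) (fun z : R * R => z.1) measurable_snd measurable_fst.
  move=> /(_ measurableT [set true]).
  rewrite setTI => H; have := H I.
  by congr (measurable _); apply/seteqP; split => z /=.
have -> : (fun z : R * R => ((z.2 <= z.1)%R%:R : R)) = \1_[set z : R * R | z.2 <= z.1].
  apply/funext => z; rewrite indicE; congr (_%:R : R); congr (nat_of_bool _).
  apply/idP/idP => H; [exact: mem_set|by move/set_mem : H].
exact: measurable_indic.
Qed.

Lemma integrableM_bounded (D : set R) (h k : R -> R) (M : R) : measurable D ->
  measurable_fun D h -> (forall x, D x -> `|h x| <= M) ->
  mu.-integrable D (EFin \o k) -> mu.-integrable D (fun x => (h x * k x)%:E).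
Proof.
move=> mD mh hM ik; apply: (@integrableMr _ _ _ mu D mD h (EFin \o k)) => //.
exists M; split; first exact: num_real.
by move=> y My x Dx; apply: le_trans (hM x Dx) (ltW My).
Qed.

Lemma continuous_segment_bound (h : R -> R) (a b : R) : continuous h ->
  exists2 M, 0 <= M & forall t, a <= t <= b -> `|h t| <= M.
Proof.
move=> ch; have [ab|ba] := leP a b; last first.
  by exists 0 => // t /andP[/le_trans H /H]; rewrite leNgt ba.
have [|c _ cP] := @EVT_max R (fun t => `|h t|) a b ab.
  by apply: continuous_subspaceT => t; apply: continuous_comp;
    [exact: ch|exact: norm_continuous].
by exists (`|h c|) => // t tab; apply: cP; rewrite in_itv.
Qed.

Lemma FTC_smooth (e de : R -> R) (a b : R) : a <= b ->
  continuous de -> (forall t, is_derive t (1 : R) e (de t)) ->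
  \int[mu]_(t in `[a, b]) de t = e b - e a.
Proof.
move=> ab cde ede; have ce0 : continuous e.
  move=> t; apply/differentiable_continuous/derivable1_diffP.
  by have [] := ede t.
move: ab; rewrite le_eqVlt => /predU1P[->|ab].
  by rewrite set_itv1 Rintegral_set1 subrr.
rewrite /Rintegral (@continuous_FTC2 R de e)//.
- exact: continuous_subspaceT.
- split; last 2 first.
  + exact/cvg_at_right_filter/ce0.
  + exact/cvg_at_left_filter/ce0.
  + by move=> t _; have [] := ede t.
- by move=> t _; rewrite derive1E; apply: derive_val.
Qed.

(** The indefinite integral of an integrable [k] need not be differentiable everywhere, so the
    product rule is avoided: Fubini's theorem is applied to [de t * k s] on the triangle [s <= t] of
    the square $[0, x]^2$. It also yields the integrability claim. *)
Lemma Rintegral_by_parts_indefinite (e de k : R -> R) (x : R) : 0 <= x ->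
  continuous de -> (forall t, is_derive t (1 : R) e (de t)) ->
  mu.-integrable `[0, x] (EFin \o k) ->
  mu.-integrable `[0, x] (fun t => (de t * \int[mu]_(s in `[0, t]) k s)%:E) /\
  \int[mu]_(t in `[0, x]) (e t * k t) = e x * \int[mu]_(t in `[0, x]) k t
    - \int[mu]_(t in `[0, x]) (de t * \int[mu]_(s in `[0, t]) k s).
Proof.
move=> x0 cde ede ik.
pose h := k \_ `[0, x].
have ih : mu.-integrable setT (EFin \o h).
  by rewrite -restrict_EFin; apply/integrable_restrict => //; rewrite setTI.
pose d := de \_ `[0, x].
have mde : measurable_fun setT de by exact: continuous_measurable_fun.
have md : measurable_fun setT d.
  by rewrite -measurable_restrictT; [exact: measurable_funTS|exact: measurable_itv].
have mh : measurable_fun setT h by move/integrableP : ih => [/measurable_EFinP].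
pose f (z : R * R) : \bar R := (d z.1 * h z.2 * (z.2 <= z.1)%R%:R)%:E.
have mf : measurable_fun setT f.
  apply/measurable_EFinP; apply: measurable_funM; last exact: measurable_indic_le.
  by apply: measurable_funM; apply: measurableT_comp.
have [M M0 dM] : exists2 M, 0 <= M & forall t, `|d t| <= M.
  have [M M0 MP] := continuous_segment_bound 0 x cde.
  exists M => // t; rewrite /d patchE; case: ifPn => [tx|_]; last by rewrite normr0.
  by apply: MP; move/set_mem : tx; rewrite /= in_itv.
(* Dropping the indicator leaves a product of two integrable functions of one variable each. *)
have iF : (mu \x mu)%E.-integrable setT f.
  apply/integrable12ltyP => //.
  have id : mu.-integrable setT (EFin \o d).
    rewrite -restrict_EFin; apply/integrable_restrict => //; rewrite setTI.
    by apply: continuous_compact_integrable; [exact: segment_compact|exact: continuous_subspaceT].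
  apply: (@le_lt_trans _ _ (\int[mu]_t \int[mu]_s (`|d t|%:E * `|h s|%:E))%E).
    apply: ge0_le_integral => //.
    - by move=> t _; apply: integral_ge0.
    - have mf' : measurable_fun setT (abse \o f) by exact: measurableT_comp.
      exact: (@measurable_fun_fubini_tonelli_F _ _ _ _ R mu (abse \o f) mf' (fun z => abse_ge0 (f z))).
    - pose g (z : R * R) := (`|d z.1|%:E * `|h z.2|%:E)%E.
      have g0 z : (0 <= g z)%E by rewrite mule_ge0.
      have mg : measurable_fun setT g.
        by apply: emeasurable_funM; apply/measurable_EFinP; do 2 apply: measurableT_comp => //.
      exact: (@measurable_fun_fubini_tonelli_F _ _ _ _ R mu g mg g0).
    - move=> t _; apply: ge0_le_integral => //.
      + apply: measurableT_comp => //; apply: measurableT_comp => //.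
      + apply: emeasurable_funM => //; apply/measurable_EFinP; apply: measurableT_comp => //.
      + move=> s _; rewrite /f/= lee_fin !normrM ler_piMr ?mulr_ge0//.
        by rewrite normr_nat; case: (s <= t).
  have ian := integrable_norm ih; have idn := integrable_norm id.
  under eq_integral => t _.
    rewrite integralZl//; over.
  have hf : (\int[mu]_s `|h s|%:E)%E \is a fin_num by exact: integrable_fin_num.
  rewrite -(fineK hf) integralZr//.
  by rewrite lte_mul_pinfty ?ltry ?integral_ge0//; exact: integrable_fin_num idn.
have FE t : (\int[mu]_s f (t, s) = (d t * \int[mu]_(s in `[0, t]) k s)%:E)%E.
  have [/set_mem tx|tx] := boolP (t \in `[0, x]); last first.
    rewrite /f/= {2}/d patchE (negbTE tx) mul0r; apply: integral0_eq => s _.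
    by rewrite /d patchE (negbTE tx) !mul0r.
  move: (tx); rewrite /= in_itv/= => /andP[t0 tlex].
  have ikt : mu.-integrable `[0, t] (EFin \o k).
    by apply: integrableS ik => //; apply: subset_itvl; rewrite bnd_simp.
  rewrite -RintegralZl// /Rintegral fineK; last first.
    by apply: integrable_fin_num => //; apply: (integrableZl _ (d t) ikt).
  rewrite [RHS]integral_mkcond; apply: eq_integral => s _.
  rewrite /f/= patchE; case: ifPn => [/set_mem|].
    rewrite /= in_itv/= => /andP[s0 st]; rewrite st mulr1 /h patchE mem_set//=.
    by rewrite in_itv/= s0 (le_trans st).
  rewrite notin_setE /= in_itv/= => /negP; rewrite negb_and => /orP[|/negbTE ->]; last by rewrite mulr0.
  move=> s0; rewrite /h patchE memNset ?mulr0 ?mul0r// => /=.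
  by rewrite in_itv/= (negbTE s0).
(* In the other order the inner integral is that of [de] over [[s, x]], which the fundamental
   theorem evaluates. *)
have GE s : (\int[mu]_t f (t, s) = (h s * (e x - e s))%:E)%E.
  have [/set_mem sx|sx] := boolP (s \in `[0, x]); last first.
    rewrite {1}/h patchE (negbTE sx) mul0r; apply: integral0_eq => t _.
    by rewrite /f /h patchE (negbTE sx) mulr0 mul0r.
  move: (sx); rewrite /= in_itv/= => /andP[s0 slex].
  have ide : mu.-integrable `[s, x] (EFin \o de).
    by apply: continuous_compact_integrable; [exact: segment_compact|exact: continuous_subspaceT].
  rewrite -(FTC_smooth slex cde ede) -RintegralZl// /Rintegral fineK; last first.
    by apply: integrable_fin_num => //; apply: (integrableZl _ (h s) ide).
  rewrite [RHS]integral_mkcond; apply: eq_integral => t _.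
  rewrite /f/= patchE; case: ifPn => [/set_mem|].
    rewrite /= in_itv/= => /andP[st tx]; rewrite st mulr1 /d patchE mem_set/=; last first.
      by rewrite in_itv/= tx (le_trans s0).
    by rewrite (mulrC (h s)).
  rewrite notin_setE /= in_itv/= => /negP; rewrite negb_and => /orP[/negbTE ->|]; first by rewrite mulr0.
  move=> tx; rewrite /d patchE memNset ?mul0r// => /=.
  by rewrite in_itv/= (negbTE tx) andbF.
split.
  have := integrable_fubini_F iF; rewrite /fubini_F.
  under eq_fun do rewrite FE.
  move=> iFE; apply: (@eq_integrable _ _ _ mu `[0, x] _ (fun t => (d t * \int[mu]_(s in `[0, t]) k s)%:E)) => //.
    by move=> t tx; rewrite /d patchE tx.
  exact: integrableS iFE.
have := Fubini iF.
under eq_integral do rewrite FE.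
under [in RHS]eq_integral do rewrite GE.
move=> /(congr1 fine); rewrite -!/(Rintegral _ _ _).
have -> : \int[mu]_t (d t * \int[mu]_(s in `[0, t]) k s) =
   \int[mu]_(t in `[0, x]) (de t * \int[mu]_(s in `[0, t]) k s).
  rewrite [RHS]Rintegral_mkcond; apply: eq_Rintegral => t _.
  by rewrite /d !patchE; case: ifP => //; rewrite mul0r.
have -> : \int[mu]_s (h s * (e x - e s)) = \int[mu]_(s in `[0, x]) (e x * k s - e s * k s).
  rewrite [RHS]Rintegral_mkcond; apply: eq_Rintegral => t _.
  rewrite /h !patchE; case: ifP; rewrite ?mul0r//.
  by rewrite mulrC mulrBl.
have ce0 : continuous e.
  move=> t; apply/differentiable_continuous/derivable1_diffP.
  by have [] := ede t.
rewrite RintegralB//; last 2 first.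
- exact: (integrableZl _ (e x) ik).
- have [M' _ MP] := continuous_segment_bound 0 x ce0.
  apply: (@integrableM_bounded _ _ _ M') => //.
  exact: measurable_funTS (continuous_measurable_fun ce0).
rewrite RintegralZl// => ->; ring.
Qed.

End real_integration_by_parts.

(** * Integrals of complex-valued functions, by components *)

Section complex_integral.
Context {R : realType}.
Local Open Scope classical_set_scope.
Local Open Scope complex_scope.
Local Notation mu := (@lebesgue_measure R).
Implicit Types (D : set R) (f g h : R -> R[i]) (a z : R[i]).

Definition cmeasurable D f :=
  measurable_fun D (fun x => complex.Re (f x)) /\
  measurable_fun D (fun x => complex.Im (f x)).

Definition cintegrable D f :=
  mu.-integrable D (fun x => (complex.Re (f x))%:E) /\
  mu.-integrable D (fun x => (complex.Im (f x))%:E).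

Lemma cintegrable_measurable D f : cintegrable D f -> cmeasurable D f.
Proof. by move=> [/integrableP[/measurable_EFinP ? _] /integrableP[/measurable_EFinP ? _]]. Qed.

Lemma cmeasurableD D f g : cmeasurable D f -> cmeasurable D g ->
  cmeasurable D (fun x => f x + g x).
Proof.
move=> [fr fi] [gr gi]; split.
- by under eq_fun do rewrite cReD; exact: measurable_funD.
- by under eq_fun do rewrite cImD; exact: measurable_funD.
Qed.

Lemma cmeasurableM D f g : cmeasurable D f -> cmeasurable D g ->
  cmeasurable D (fun x => f x * g x).
Proof.
move=> [fr fi] [gr gi]; split.
- by under eq_fun do rewrite cReM; apply: measurable_funB; exact: measurable_funM.
- by under eq_fun do rewrite cImM; apply: measurable_funD; exact: measurable_funM.
Qed.

Lemma cmeasurable_cst D a : cmeasurable D (cst a).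
Proof. by split; exact: measurable_cst. Qed.

Lemma cmeasurableS D E f : measurable D -> E `<=` D ->
  cmeasurable D f -> cmeasurable E f.
Proof. by move=> mD DE [fr fi]; split; apply: measurable_funS fr || apply: measurable_funS fi. Qed.

Lemma cintegrableS D E f : measurable D -> measurable E -> E `<=` D ->
  cintegrable D f -> cintegrable E f.
Proof.
by move=> mD mE ED [fr fi]; split; [exact: integrableS fr|exact: integrableS fi].
Qed.

Lemma eq_cintegral D f g : {in D, f =1 g} -> cintegral D f = cintegral D g.
Proof.
by move=> fg; congr (_ +i* _); apply: eq_Rintegral => x xD; rewrite fg.
Qed.

Lemma cintegrableD D f g : measurable D -> cintegrable D f -> cintegrable D g ->
  cintegrable D (fun x => f x + g x).
Proof.
move=> mD [fr fi] [gr gi]; split.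
- by under eq_fun do rewrite cReD EFinD; exact: integrableD.
- by under eq_fun do rewrite cImD EFinD; exact: integrableD.
Qed.

Lemma cintegralD D f g : measurable D -> cintegrable D f -> cintegrable D g ->
  cintegral D (fun x => f x + g x) = cintegral D f + cintegral D g.
Proof.
move=> mD [fr fi] [gr gi]; apply/eqP; rewrite eq_complex; apply/andP; split; apply/eqP.
- rewrite [LHS]/=; under eq_Rintegral do rewrite cReD.
  by rewrite RintegralD.
- rewrite [LHS]/=; under eq_Rintegral do rewrite cImD.
  by rewrite RintegralD.
Qed.

Lemma cintegrableM_bounded D h f M : measurable D -> cmeasurable D h ->
  (forall x, D x -> normc (h x) <= M) -> cintegrable D f ->
  cintegrable D (fun x => h x * f x).
Proof.
move=> mD [hr hi] hM [fr fi].
have rM x : D x -> `|complex.Re (h x)| <= M by move=> /hM; apply/le_trans/normr_Re_le.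
have iM x : D x -> `|complex.Im (h x)| <= M by move=> /hM; apply/le_trans/normr_Im_le.
split.
- under eq_fun do rewrite cReM EFinB.
  by apply: integrableB => //; [exact: integrableM_bounded rM fr
                              | exact: integrableM_bounded iM fi].
- under eq_fun do rewrite cImM EFinD.
  by apply: integrableD => //; [exact: integrableM_bounded rM fi
                              | exact: integrableM_bounded iM fr].
Qed.

Lemma cintegrableZ D a f : measurable D -> cintegrable D f ->
  cintegrable D (fun x => a * f x).
Proof.
move=> mD fi; apply: (@cintegrableM_bounded D (cst a) f (normc a)) => //; exact: cmeasurable_cst.
Qed.

Lemma cintegralZ D a f : measurable D -> cintegrable D f ->
  cintegral D (fun x => a * f x) = a * cintegral D f.
Proof.
move=> mD [fr fi].
have ir (r : R) (k : R -> R) : mu.-integrable D (EFin \o k) ->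
    mu.-integrable D (EFin \o (fun x => r * k x)).
  by move=> ik; apply: (integrableZl _ r ik).
apply/eqP; rewrite eq_complex; apply/andP; split; apply/eqP.
- rewrite cReM [LHS]/=; under eq_Rintegral do rewrite cReM.
  by rewrite RintegralB ?RintegralZl//; exact: ir.
- rewrite cImM [LHS]/=; under eq_Rintegral do rewrite cImM.
  by rewrite RintegralD ?RintegralZl//; exact: ir.
Qed.

Lemma cintegralB D f g : measurable D -> cintegrable D f -> cintegrable D g ->
  cintegral D (fun x => f x - g x) = cintegral D f - cintegral D g.
Proof.
move=> mD fi gi; under eq_fun do rewrite -mulN1r.
by rewrite cintegralD ?cintegralZ ?mulN1r//; exact: cintegrableZ.
Qed.

Lemma cintegrable0 D : cintegrable D (fun=> 0).
Proof. by split; exact: integrable0. Qed.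

Lemma cintegral0 D : cintegral D (fun=> 0) = 0.
Proof. by rewrite /cintegral /= /Rintegral integral0. Qed.

Lemma cintegrable_sum (I : Type) (s : seq I) D (F : I -> R -> R[i]) :
  measurable D -> (forall i, cintegrable D (F i)) ->
  cintegrable D (fun x => \sum_(i <- s) F i x).
Proof.
move=> mD iF; elim: s => [|i s IH].
  by under eq_fun do rewrite big_nil; exact: cintegrable0.
by under eq_fun do rewrite big_cons; exact: cintegrableD.
Qed.

Lemma cintegral_sum (I : Type) (s : seq I) D (F : I -> R -> R[i]) :
  measurable D -> (forall i, cintegrable D (F i)) ->
  cintegral D (fun x => \sum_(i <- s) F i x) = \sum_(i <- s) cintegral D (F i).
Proof.
move=> mD iF; elim: s => [|i s IH].
  by under eq_fun do rewrite big_nil; rewrite big_nil cintegral0.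
under eq_fun do rewrite big_cons.
by rewrite big_cons cintegralD// ?IH//; exact: cintegrable_sum.
Qed.

Lemma ae_eq_cintegral f g : cmeasurable per_itv f -> cmeasurable per_itv g ->
  ae_eq_per f g -> cintegral per_itv f = cintegral per_itv g.
Proof.
have F := @ae_filter_ringOfSetsType _ _ _ mu.
move=> [fr fi] [gr gi] fg; rewrite /cintegral /Rintegral; congr (fine _ +i* fine _).
- apply: ae_eq_integral; [exact: measurable_itv|exact/measurable_EFinP|exact/measurable_EFinP|].
  by apply: filterS fg => x H /H ->.
- apply: ae_eq_integral; [exact: measurable_itv|exact/measurable_EFinP|exact/measurable_EFinP|].
  by apply: filterS fg => x H /H ->.
Qed.

(** Square integrability refers to the open interval while [H1] integrates over closed ones; the
    endpoints form a null set. *)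
Lemma integrable_itvoo (x y : R) (k : R -> \bar R) : mu.-integrable `]x, y[ k ->
  mu.-integrable `[x, y] k.
Proof.
move=> /integrableP[mk ik]; apply/integrableP; split.
  exact: emeasurable_fun_itv_cc mk.
by rewrite integral_itv_bndoo//; exact: measurableT_comp.
Qed.

Lemma integrable_itv0 (x y : R) (k : R -> \bar R) : x <= y ->
  mu.-integrable `]0, y[ k -> mu.-integrable `[0, x] k.
Proof.
move=> xy /integrable_itvoo ik; apply: integrableS ik => //.
by apply: subset_itvl; rewrite bnd_simp.
Qed.

Lemma cintegrable_cc (x : R) f : x <= 2 * pi -> cintegrable per_itv f ->
  cintegrable `[0, x] f.
Proof. by move=> x2 [fr fi]; split; apply: integrable_itv0 x2 _. Qed.

Lemma cintegral_itvoo (x y : R) f : cintegrable `]x, y[ f ->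
  cintegral `[x, y] f = cintegral `]x, y[ f.
Proof.
move=> [/integrableP[fr _] /integrableP[fi _]].
by congr (fine _ +i* fine _); [exact: (integral_itv_bndoo true false fr)
                              |exact: (integral_itv_bndoo true false fi)].
Qed.

End complex_integral.

(** * Square integrable functions on $(0, 2\pi)$ *)

Section square_integrable_functions.
Context {R : realType}.
Local Open Scope classical_set_scope.
Local Open Scope complex_scope.
Local Notation mu := (@lebesgue_measure R).
Implicit Types (f g h : R -> R[i]) (a z : R[i]).

Definition sqnorm f : R := \int[mu]_(x in per_itv) (normc (f x) ^+ 2).

Lemma measurable_per_itv : measurable (@per_itv R).
Proof. exact: measurable_itv. Qed.

Lemma twopi_gt0 : 0 < 2 * pi :> R.
Proof. by rewrite mulr_gt0// pi_gt0. Qed.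

Lemma lebesgue_per_itv : mu per_itv = (2 * pi)%:E.
Proof.
have := @lebesgue_measure_itv R `]0, 2 * pi[%R.
by rewrite /= lte_fin twopi_gt0 -EFinD subr0.
Qed.

Lemma integrable_sqnormc f : square_integrable f ->
  mu.-integrable per_itv (fun x => (normc (f x) ^+ 2)%:E).
Proof. by move=> [_ _]; under eq_fun do rewrite -sqr_normcE. Qed.

Lemma square_integrable_cmeasurable f :
  square_integrable f -> cmeasurable per_itv f.
Proof. by case. Qed.

Lemma sqnorm_ge0 f : 0 <= sqnorm f.
Proof. by apply: Rintegral_ge0 => x _; exact: sqr_ge0. Qed.

Lemma integrable_per_itv_cst (M : R) : mu.-integrable per_itv (fun=> M%:E).
Proof.
apply: (@measurable_bounded_integrable _ _ _ mu (cst M)).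
- exact: measurable_per_itv.
- by move: (ltry (2 * pi : R)); rewrite -lebesgue_per_itv.
- exact: measurable_cst.
- exists `|M|; split; first exact: num_real.
  by move=> y My x _; apply: ltW My.
Qed.

Lemma square_integrableM_bounded h f M : cmeasurable per_itv h ->
  (forall x, per_itv x -> normc (h x) <= M) ->
  square_integrable f -> square_integrable (fun x => h x * f x).
Proof.
move=> mh hM sf; have [fr fi if2] := sf.
have [hr hi] := cmeasurableM mh (square_integrable_cmeasurable sf).
split => //; under eq_fun do rewrite -sqr_normcE normcM exprMn.
have mh2 : measurable_fun per_itv (fun x => normc (h x) ^+ 2).
  under eq_fun do rewrite sqr_normcE.
  by apply: measurable_funD; apply: measurable_funX; case: mh.
apply: (@integrableM_bounded _ _ _ _ (M ^+ 2)) => //.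
- exact: measurable_per_itv.
- move=> x xI; rewrite ger0_norm ?sqr_ge0// ler_sqr ?nnegrE ?normc_ge0 ?hM//.
  by rewrite (le_trans _ (hM _ xI))// normc_ge0.
- exact: integrable_sqnormc.
Qed.

Lemma bounded_square_integrable h M : cmeasurable per_itv h ->
  (forall x, per_itv x -> normc (h x) <= M) -> square_integrable h.
Proof.
move=> mh hM; have -> : h = (fun x => h x * 1).
  by apply/funext => x; rewrite mulr1.
apply: square_integrableM_bounded mh hM _; split; [exact: measurable_cst..|].
exact: integrable_per_itv_cst.
Qed.

Lemma square_integrable_cst a : square_integrable (fun=> a : R[i]).
Proof.
by apply: (@bounded_square_integrable _ (normc a)) => //; exact: cmeasurable_cst.
Qed.

Lemma square_integrableB f g : square_integrable f -> square_integrable g ->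
  square_integrable (fun x => f x - g x).
Proof.
move=> sf sg; under eq_fun do rewrite -mulN1r.
by apply: square_integrableD => //; exact: square_integrableZ.
Qed.

Lemma square_integrable_sum (I : Type) (s : seq I) (F : I -> R -> R[i]) :
  (forall i, square_integrable (F i)) ->
  square_integrable (fun x => \sum_(i <- s) F i x).
Proof.
move=> iF; elim: s => [|i s IH].
  by under eq_fun do rewrite big_nil; exact: square_integrable0.
by under eq_fun do rewrite big_cons; exact: square_integrableD.
Qed.

(** Weighted inequality of arithmetic and geometric means. The weight [eta] is free, and each use
    tunes it to balance the two terms. *)
Lemma mul_le_half_sqr (p q eta : R) : 0 < eta ->
  p * q <= (eta * p ^+ 2 + eta^-1 * q ^+ 2) / 2.
Proof.
move=> eta0; rewrite -subr_ge0.
have -> : (eta * p ^+ 2 + eta^-1 * q ^+ 2) / 2 - p * q =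
    (eta * p - q) ^+ 2 / (2 * eta) by field; rewrite gt_eqF.
by rewrite divr_ge0 ?sqr_ge0// mulr_ge0// ltW.
Qed.

Lemma square_integrableM_cintegrable f g : square_integrable f ->
  square_integrable g -> cintegrable per_itv (fun x => f x * g x).
Proof.
move=> sf sg.
have [mr mi] := cmeasurableM (square_integrable_cmeasurable sf)
  (square_integrable_cmeasurable sg).
have iFG : mu.-integrable per_itv (fun x => ((normc (f x) ^+ 2)%:E + (normc (g x) ^+ 2)%:E)%E).
  by apply: integrableD; [exact: measurable_per_itv|exact: integrable_sqnormc..].
have bnd x : normc (f x * g x) <= `|normc (f x) ^+ 2 + normc (g x) ^+ 2|.
  rewrite ger0_norm ?addr_ge0 ?sqr_ge0// normcM.
  have := mul_le_half_sqr (normc (f x)) (normc (g x)) ltr01.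
  rewrite invr1 !mul1r => /le_trans; apply.
  by rewrite ler_pdivrMr// mulr_natr mulr2n lerDl addr_ge0 ?sqr_ge0.
split; apply: (@le_integrable _ _ _ mu per_itv _ _ _ _ _ iFG).
- exact: measurable_per_itv.
- exact/measurable_EFinP.
- by move=> x _; rewrite -EFinD lee_fin (le_trans (normr_Re_le _)).
- exact: measurable_per_itv.
- exact/measurable_EFinP.
- by move=> x _; rewrite -EFinD lee_fin (le_trans (normr_Im_le _)).
Qed.

Lemma square_integrable_cintegrable f : square_integrable f -> cintegrable per_itv f.
Proof.
move=> sf; have -> : f = (fun x => f x * 1).
  by apply/funext => x; rewrite mulr1.
by apply: square_integrableM_cintegrable => //; exact: square_integrable_cst.
Qed.

(* Cauchy-Schwarz in the form without square roots. *)
Lemma normc_cintegralM_le f g (eta : R) : 0 < eta -> square_integrable f ->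
  square_integrable g ->
  normc (cintegral per_itv (fun x => f x * g x))
    <= eta * sqnorm f + eta^-1 * sqnorm g.
Proof.
move=> eta0 sf sg.
have [ir ii] := square_integrableM_cintegrable sf sg.
have iZ (c : R) k : square_integrable k ->
    mu.-integrable per_itv (fun x => (c * normc (k x) ^+ 2)%:E).
  by move=> /integrable_sqnormc sk; apply: (integrableZl _ c sk); exact: measurable_per_itv.
have iFG : mu.-integrable per_itv
    (fun x => (eta / 2 * normc (f x) ^+ 2 + eta^-1 / 2 * normc (g x) ^+ 2)%:E).
  under eq_fun do rewrite EFinD.
  by apply: integrableD; [exact: measurable_per_itv|exact: iZ..].
have bnd x : normc (f x * g x) <= eta / 2 * normc (f x) ^+ 2 + eta^-1 / 2 * normc (g x) ^+ 2.
  rewrite normcM; apply: le_trans (mul_le_half_sqr _ _ eta0) _.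
  by rewrite mulrDl mulrAC [X in _ + X <= _]mulrAC.
have E : \int[mu]_(x in per_itv) (eta / 2 * normc (f x) ^+ 2 + eta^-1 / 2 * normc (g x) ^+ 2)
    = (eta * sqnorm f + eta^-1 * sqnorm g) / 2.
  rewrite RintegralD; [|exact: measurable_per_itv|exact: iZ..].
  rewrite !RintegralZl; [|exact: measurable_per_itv|exact: integrable_sqnormc
                         |exact: measurable_per_itv|exact: integrable_sqnormc].
  by rewrite -!/(sqnorm _) mulrDl mulrAC [X in _ + X = _]mulrAC.
rewrite (splitr (_ + _)) -E.
apply: le_trans (normc_le_ReIm _) _; apply: lerD => /=.
- apply: le_trans (le_normr_Rintegral _ _) _ => //; first exact: measurable_per_itv.
  apply: le_Rintegral => //; first exact: measurable_per_itv.
    exact: (integrable_norm ir).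
  by move=> x _; rewrite (le_trans (normr_Re_le _)).
- apply: le_trans (le_normr_Rintegral _ _) _ => //; first exact: measurable_per_itv.
  apply: le_Rintegral => //; first exact: measurable_per_itv.
    exact: (integrable_norm ii).
  by move=> x _; rewrite (le_trans (normr_Im_le _)).
Qed.

Lemma sqnorm_le_bound f (M : R) : square_integrable f ->
  (forall x, per_itv x -> normc (f x) <= M) -> sqnorm f <= 2 * pi * M ^+ 2.
Proof.
move=> sf fM.
have -> : 2 * pi * M ^+ 2 = \int[mu]_(x in per_itv) (M ^+ 2).
  rewrite Rintegral_cst; last exact: measurable_per_itv.
  rewrite [RHS]mulrC; congr (_ * _).
  by have -> : 2 * pi = fine (2 * pi : R)%:E by []; rewrite -lebesgue_per_itv.
apply: le_Rintegral.
- exact: measurable_per_itv.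
- exact: integrable_sqnormc.
- exact: integrable_per_itv_cst.
- move=> x xI; rewrite ler_sqr ?nnegrE ?normc_ge0 ?fM//.
  by rewrite (le_trans _ (fM _ xI))// normc_ge0.
Qed.

End square_integrable_functions.

(** * Derivatives and primitives of the exponentials *)

Section exponential_calculus.
Context {R : realType}.
Local Open Scope classical_set_scope.
Local Open Scope complex_scope.
Local Notation mu := (@lebesgue_measure R).
Implicit Types (f g h : R -> R[i]) (a z : R[i]).

Lemma is_derive_Re_ce z (t : R) : is_derive t (1 : R)
  (fun s => complex.Re (ce z s)) (complex.Re ('i%C * z * ce z t)).
Proof.
under eq_fun do rewrite ce_Re.
apply: is_derive_eq; rewrite /GRing.scale /= !mulr1.
rewrite cReM cReM (cImM _ z) ce_Re ce_Im /=; ring.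
Qed.

Lemma is_derive_Im_ce z (t : R) : is_derive t (1 : R)
  (fun s => complex.Im (ce z s)) (complex.Im ('i%C * z * ce z t)).
Proof.
under eq_fun do rewrite ce_Im.
apply: is_derive_eq; rewrite /GRing.scale /= !mulr1.
rewrite cImM cReM (cImM _ z) ce_Re ce_Im /=; ring.
Qed.

Lemma continuous_Re_ce z : continuous (fun s => complex.Re (ce z s)).
Proof.
move=> t; apply/differentiable_continuous/derivable1_diffP.
by have [] := is_derive_Re_ce z t.
Qed.

Lemma continuous_Im_ce z : continuous (fun s => complex.Im (ce z s)).
Proof.
move=> t; apply/differentiable_continuous/derivable1_diffP.
by have [] := is_derive_Im_ce z t.
Qed.

Lemma continuous_Re_Mce a z : continuous (fun s => complex.Re (a * ce z s)).
Proof.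
under eq_fun do rewrite cReM.
move=> t; apply: cvgB; apply: cvgM; try exact: cvg_cst.
- exact: continuous_Re_ce.
- exact: continuous_Im_ce.
Qed.

Lemma continuous_Im_Mce a z : continuous (fun s => complex.Im (a * ce z s)).
Proof.
under eq_fun do rewrite cImM.
move=> t; apply: cvgD; apply: cvgM; try exact: cvg_cst.
- exact: continuous_Im_ce.
- exact: continuous_Re_ce.
Qed.

Lemma cmeasurable_ce (D : set R) z : cmeasurable D (ce z).
Proof.
split; apply: measurable_funTS; apply: continuous_measurable_fun.
- exact: continuous_Re_ce.
- exact: continuous_Im_ce.
Qed.

Definition ce_bound z : R := expR (`|complex.Im z| * (2 * pi)).

Lemma normc_ce_le z t : 0 <= t <= 2 * pi -> normc (ce z t) <= ce_bound z.
Proof.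
move=> /andP[t0 t2]; rewrite normc_ce /ce_bound ler_expR.
apply: (@le_trans _ _ (`|complex.Im z| * t)).
  by rewrite ler_wpM2r// -normrN ler_norm.
by rewrite ler_wpM2l.
Qed.

Lemma per_itvP (x : R) : per_itv x -> 0 <= x <= 2 * pi.
Proof. by rewrite /per_itv /= in_itv /= => /andP[/ltW -> /ltW ->]. Qed.

Lemma square_integrableM_ce z f : square_integrable f ->
  square_integrable (fun t => ce z t * f t).
Proof.
apply: (@square_integrableM_bounded _ _ _ (ce_bound z)).
  exact: cmeasurable_ce.
by move=> t /per_itvP; exact: normc_ce_le.
Qed.

Lemma square_integrable_ce z : square_integrable (ce z).
Proof.
apply: (@bounded_square_integrable _ _ (ce_bound z)); first exact: cmeasurable_ce.
by move=> t /per_itvP; exact: normc_ce_le.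
Qed.

(** Four instances of the real formula, one for each pairing of a component of [ce z] with a
    component of [k]. *)
Lemma cintegral_by_parts_ce z (k : R -> R[i]) (x : R) : 0 <= x ->
  cintegrable `[0, x] k ->
  cintegrable `[0, x] (fun t => 'i%C * z * ce z t * cintegral `[0, t] k) /\
  cintegral `[0, x] (fun t => ce z t * k t) = ce z x * cintegral `[0, x] k
    - cintegral `[0, x] (fun t => 'i%C * z * ce z t * cintegral `[0, t] k).
Proof.
move=> x0 [kr ki].
have cR := @continuous_Re_Mce ('i%C * z) z; have cI := @continuous_Im_Mce ('i%C * z) z.
have [i1 e1] := Rintegral_by_parts_indefinite x0 cR (is_derive_Re_ce z) kr.
have [i2 e2] := Rintegral_by_parts_indefinite x0 cI (is_derive_Im_ce z) ki.
have [i3 e3] := Rintegral_by_parts_indefinite x0 cR (is_derive_Re_ce z) ki.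
have [i4 e4] := Rintegral_by_parts_indefinite x0 cI (is_derive_Im_ce z) kr.
have mI : measurable (`[0, x] : set R) by exact: measurable_itv.
have iR : forall (c : R -> R) q, continuous c -> mu.-integrable `[0, x] (EFin \o q) ->
    mu.-integrable `[0, x] (EFin \o (fun t => c t * q t)).
  move=> c q cc iq; have [M _ MP] := continuous_segment_bound 0 x cc.
  apply: (@integrableM_bounded _ _ _ _ M) => //.
  exact: measurable_funTS (continuous_measurable_fun cc).
split.
  split.
  - by under [X in integrable _ _ X]eq_fun do rewrite cReM EFinB; exact: integrableB.
  - by under [X in integrable _ _ X]eq_fun do rewrite cImM EFinD; exact: integrableD.
apply/eqP; rewrite eq_complex; apply/andP; split; apply/eqP.
- rewrite cReD cReN cReM [LHS]/=.
  under eq_Rintegral do rewrite cReM.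
  rewrite RintegralB//; [|exact: iR (@continuous_Re_ce z) kr|exact: iR (@continuous_Im_ce z) ki].
  rewrite e1 e2.
  have -> : complex.Re (cintegral `[0, x] (fun t => 'i%C * z * ce z t * cintegral `[0, t] k)) =
    \int[mu]_(t in `[0, x]) (complex.Re ('i%C * z * ce z t) * \int[mu]_(s in `[0, t]) complex.Re (k s))
    - \int[mu]_(t in `[0, x]) (complex.Im ('i%C * z * ce z t) * \int[mu]_(s in `[0, t]) complex.Im (k s)).
    by rewrite -RintegralB//; apply: eq_Rintegral => t _; exact: cReM.
  rewrite [complex.Re (cintegral _ k)]/= [complex.Im (cintegral _ k)]/=; ring.
- rewrite cImD cImN cImM [LHS]/=.
  under eq_Rintegral do rewrite cImM.
  rewrite RintegralD//; [|exact: iR (@continuous_Re_ce z) ki|exact: iR (@continuous_Im_ce z) kr].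
  rewrite e3 e4.
  have -> : complex.Im (cintegral `[0, x] (fun t => 'i%C * z * ce z t * cintegral `[0, t] k)) =
    \int[mu]_(t in `[0, x]) (complex.Re ('i%C * z * ce z t) * \int[mu]_(s in `[0, t]) complex.Im (k s))
    + \int[mu]_(t in `[0, x]) (complex.Im ('i%C * z * ce z t) * \int[mu]_(s in `[0, t]) complex.Re (k s)).
    by rewrite -RintegralD//; apply: eq_Rintegral => t _; exact: cImM.
  rewrite [complex.Re (cintegral _ k)]/= [complex.Im (cintegral _ k)]/=; ring.
Qed.

Lemma cintegral_deriv_ce z (x : R) : 0 <= x ->
  cintegral `[0, x] (fun t => 'i%C * z * ce z t) = ce z x - 1.
Proof.
move=> x0; apply/eqP; rewrite eq_complex; apply/andP; split; apply/eqP.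
- rewrite [LHS]/= (FTC_smooth x0 (@continuous_Re_Mce ('i%C * z) z) (is_derive_Re_ce z)).
  by rewrite ce0 cReD cReN.
- rewrite [LHS]/= (FTC_smooth x0 (@continuous_Im_Mce ('i%C * z) z) (is_derive_Im_ce z)).
  by rewrite ce0 cImD cImN.
Qed.

End exponential_calculus.

(** * Representatives of classes in $L^2$ *)

Section L2_elements.
Context {R : realType}.
Local Open Scope classical_set_scope.
Local Open Scope complex_scope.
Local Open Scope quotient_scope.
Local Notation mu := (@lebesgue_measure R).
Implicit Types (f g : L2 R) (a z : R[i]).

Lemma L2_square_integrable f : square_integrable f.
Proof. exact: L2fun_valP. Qed.

Lemma L2_addP f g : ae_eq_per (f + g : L2 R) (fun x => f x + g x).
Proof. exact: L2_piK. Qed.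

Lemma L2_scaleP a f : ae_eq_per (a *: f : L2 R) (fun x => a * f x).
Proof. exact: L2_piK. Qed.

Lemma L2_zeroP : ae_eq_per (0 : L2 R) (fun=> 0).
Proof. exact: L2_piK. Qed.

Lemma L2_eqP f g : ae_eq_per f g -> f = g.
Proof. by move=> fg; rewrite -[f]reprK -[g]reprK; apply/L2_piP. Qed.

Lemma L2_of_fun (h : R -> R[i]) : square_integrable h ->
  exists f : L2 R, ae_eq_per f h.
Proof. by move=> sh; exists (\pi_(L2 R) (MkL2fun sh)); exact: L2_piK. Qed.

Lemma ae_eq_cintegral_sub (D : set R) (h k : R -> R[i]) : measurable D ->
  D `<=` per_itv -> cmeasurable per_itv h -> cmeasurable per_itv k ->
  ae_eq_per h k -> cintegral D h = cintegral D k.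
Proof.
have F := @ae_filter_ringOfSetsType _ _ _ mu.
move=> mD DI /(cmeasurableS (@measurable_per_itv R) DI) [hr hi].
move=> /(cmeasurableS (@measurable_per_itv R) DI) [kr ki] hk.
rewrite /cintegral /Rintegral; congr (fine _ +i* fine _).
- apply: ae_eq_integral; [exact: mD|exact/measurable_EFinP|exact/measurable_EFinP|].
  by apply: filterS hk => x H /DI/H ->.
- apply: ae_eq_integral; [exact: mD|exact/measurable_EFinP|exact/measurable_EFinP|].
  by apply: filterS hk => x H /DI/H ->.
Qed.

End L2_elements.

(** * The equation $(P - l) f = g$ and its transform *)

Section transform.
Context {R : realType}.
Local Open Scope classical_set_scope.
Local Open Scope complex_scope.
Local Notation mu := (@lebesgue_measure R).
Implicit Types (f g K : L2 R) (h k u : R -> R[i]) (a z l phi : R[i]).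

Definition hat h z : R[i] := cintegral per_itv (fun t => ce z t * h t).

Definition Delta K z : R[i] := 1 - ce z (2 * pi) + 'i%C * hat K z.

Lemma cintegrableM_ce z h : square_integrable h ->
  cintegrable per_itv (fun t => ce z t * h t).
Proof. by move=> sh; apply: square_integrable_cintegrable; exact: square_integrableM_ce. Qed.

Lemma hatD h k z : square_integrable h -> square_integrable k ->
  hat (fun x => h x + k x) z = hat h z + hat k z.
Proof.
move=> sh sk; rewrite /hat -cintegralD.
- by apply: eq_cintegral => x _; rewrite mulrDr.
- exact: measurable_per_itv.
- exact: cintegrableM_ce.
- exact: cintegrableM_ce.
Qed.

Lemma hatZ a h z : square_integrable h ->
  hat (fun x => a * h x) z = a * hat h z.
Proof.
move=> sh; rewrite /hat -cintegralZ.
- by apply: eq_cintegral => x _; rewrite mulrCA.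
- exact: measurable_per_itv.
- exact: cintegrableM_ce.
Qed.

Lemma ae_eq_perM (c h k : R -> R[i]) : ae_eq_per h k ->
  ae_eq_per (fun x => c x * h x) (fun x => c x * k x).
Proof.
have F := @ae_filter_ringOfSetsType _ _ _ mu.
by apply: filterS => x hk xI; rewrite hk.
Qed.

Lemma ae_eq_hat h k z : square_integrable h -> square_integrable k ->
  ae_eq_per h k -> hat h z = hat k z.
Proof.
move=> sh sk hk; apply: ae_eq_cintegral; last exact: ae_eq_perM.
- exact/square_integrable_cmeasurable/square_integrableM_ce.
- exact/square_integrable_cmeasurable/square_integrableM_ce.
Qed.

Lemma hat_L2D f g z : hat (f + g : L2 R) z = hat f z + hat g z.
Proof.
have sf := L2_square_integrable f; have sg := L2_square_integrable g.
rewrite -hatD//; apply: ae_eq_hat (L2_addP f g); first exact: L2_square_integrable.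
exact: square_integrableD.
Qed.

Lemma hat_L2Z a f z : hat (a *: f : L2 R) z = a * hat f z.
Proof.
have sf := L2_square_integrable f.
rewrite -hatZ//; apply: ae_eq_hat (L2_scaleP a f); first exact: L2_square_integrable.
exact: square_integrableZ.
Qed.

Lemma hat_L20 z : hat (0 : L2 R) z = 0.
Proof. by rewrite -(scale0r (0 : L2 R)) hat_L2Z mul0r. Qed.

Lemma hat_L2_sum (I : Type) (s : seq I) (c : I -> R[i]) (v : I -> L2 R) z :
  hat (\sum_(i <- s) c i *: v i : L2 R) z = \sum_(i <- s) c i * hat (v i) z.
Proof.
elim: s => [|i s IH]; first by rewrite !big_nil hat_L20.
by rewrite !big_cons hat_L2D hat_L2Z IH.
Qed.

Lemma normr_Rintegral_itv0 (k : R -> R) (t y : R) : t <= y ->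
  mu.-integrable `[0, y] (EFin \o k) ->
  `|\int[mu]_(s in `[0, t]) k s| <= \int[mu]_(s in `[0, y]) `|k s|.
Proof.
move=> ty ik; have it : mu.-integrable `[0, t] (EFin \o k).
  by apply: integrableS ik => //; apply: subset_itvl; rewrite bnd_simp.
apply: le_trans (le_normr_Rintegral _ it) _ => //.
apply: fine_le.
- by apply: integrable_fin_num => //; exact: (integrable_norm it).
- by apply: integrable_fin_num => //; exact: (integrable_norm ik).
apply: ge0_subset_integral => //.
- by move/integrableP : ik => [/measurable_EFinP mk _]; apply/measurable_EFinP/measurableT_comp.
- by apply: subset_itvl; rewrite bnd_simp.
Qed.

(** The primitive is bounded by the integrals of the absolute values of the components of [k], so
    only its measurability needs an argument. *)
Lemma primitive_square_integrable k a : cintegrable per_itv k ->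
  square_integrable (fun x => a + cintegral `[0, x] k).
Proof.
move=> ik; apply: square_integrableD; first exact: square_integrable_cst.
have ik2 : cintegrable `[0, 2 * pi] k by exact: cintegrable_cc.
have [[ir ii] _] := cintegral_by_parts_ce 1 (ltW twopi_gt0) ik2.
have mI : cmeasurable per_itv (fun x => cintegral `[0, x] k).
  (* Integration by parts at frequency 1 makes $i e^{ix}$ times the primitive integrable, hence
     measurable; the factor $-i e^{-ix}$ undoes the multiplication. *)
  have -> : (fun x => cintegral `[0, x] k) =
     (fun x => - 'i%C * (ce (- 1) x * ('i%C * 1 * ce 1 x * cintegral `[0, x] k))).
    apply/funext => x; rewrite ceN.
    transitivity (- ('i%C * 'i%C) * ((ce 1 x)^-1 * ce 1 x) * cintegral `[0, x] k); last by ring.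
    by rewrite mulVf ?ce_neq0// -expr2 sqr_i opprK !mul1r.
  apply: cmeasurableM; first exact: cmeasurable_cst.
  apply: cmeasurableM; first exact: cmeasurable_ce.
  have [jr ji] : cmeasurable `[0, 2 * pi] (fun x => 'i%C * 1 * ce 1 x * cintegral `[0, x] k).
    by apply: cintegrable_measurable; split.
  by split; [apply: measurable_funS jr|apply: measurable_funS ji] => //;
    exact: subset_itv_oo_cc.
have [kr ki] := ik2.
apply: (@bounded_square_integrable _ _
  (\int[mu]_(s in `[0, 2 * pi]) `|complex.Re (k s)| + \int[mu]_(s in `[0, 2 * pi]) `|complex.Im (k s)|)) => //.
move=> x /per_itvP /andP[_ x2].
apply: le_trans (normc_le_ReIm _) _; apply: lerD.
- exact: normr_Rintegral_itv0 kr.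
- exact: normr_Rintegral_itv0 ki.
Qed.

Lemma H1_square_integrable u u' : H1 u u' -> square_integrable u.
Proof.
move=> [su uE]; have sw := primitive_square_integrable (u 0) (square_integrable_cintegrable su).
have E x : per_itv x -> u 0 + cintegral `[0, x] u' = u x by move=> /per_itvP/uE.
case: sw => wr wi w2; split.
- by apply: eq_measurable_fun wr => x /set_mem/E ->.
- by apply: eq_measurable_fun wi => x /set_mem/E ->.
- apply: (@eq_integrable _ _ _ mu _ _ _ _ _ w2); first exact: measurable_per_itv.
  by move=> x /set_mem/E ->.
Qed.

(** The integrand is formally the derivative of $e^{izt} u(t)$. Inserting the integral
    representation of [u] leaves the integral of $(e^{izt})'$ and the integration by parts for
    [u']. *)
Lemma H1_by_parts u u' z x : H1 u u' -> 0 <= x <= 2 * pi ->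
  cintegral `[0, x] (fun t => ce z t * (u' t + 'i%C * z * u t)) = ce z x * u x - u 0.
Proof.
move=> [su uE] x02; have /andP[x0 x2] := x02.
have mI : measurable (`[0, x] : set R) by exact: measurable_itv.
have iu : cintegrable `[0, x] u' by apply: cintegrable_cc => //; exact: square_integrable_cintegrable.
have [i1 e1] := cintegral_by_parts_ce z x0 iu.
have i2 : cintegrable `[0, x] (fun t => ce z t * u' t).
  by apply: cintegrable_cc => //; exact: cintegrableM_ce.
have i3 : cintegrable `[0, x] (ce z).
  by apply: cintegrable_cc => //; exact/square_integrable_cintegrable/square_integrable_ce.
have i4 : cintegrable `[0, x] (fun t => 'i%C * z * ce z t) by exact: cintegrableZ.
have e4 := cintegral_deriv_ce z x0.
transitivity (cintegral `[0, x] (fun t => ce z t * u' t +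
   (u 0 * ('i%C * z * ce z t) + 'i%C * z * ce z t * cintegral `[0, t] u'))).
  apply: eq_cintegral => t /set_mem; rewrite /= in_itv /= => /andP[t0 tx].
  by rewrite (uE t) ?t0 ?(le_trans tx)//; ring.
rewrite cintegralD//; last by apply: cintegrableD => //; exact: cintegrableZ.
rewrite cintegralD//; last exact: cintegrableZ.
rewrite cintegralZ// e1 e4 (uE x)//; ring.
Qed.

(** [f] is only a class modulo null sets, so the boundary value $f(2\pi)$ on which the operator
    depends is exposed as the parameter [phi]. *)
Definition P1_at K f g phi := exists u u' : R -> R[i],
  [/\ H1 u u', u 0 = u (2 * pi), u (2 * pi) = phi, ae_eq_per f u &
      ae_eq_per g (fun x => 'i%C * u' x + u (2 * pi) * K x)].

Lemma P1_atE K f g : P1 K f g <-> exists phi, P1_at K f g phi.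
Proof.
split=> [[u [u' [? ? ? ?]]]|[phi [u [u' [? ? ? ? ?]]]]].
  by exists (u (2 * pi)), u, u'.
by exists u, u'.
Qed.

(** By parts over the whole period: periodicity makes the boundary term [(ce z (2 * pi) - 1) * phi],
    and the transform of [phi * K] completes it to a multiple of [Delta K z]. *)
Lemma hat_P1 K f g phi z : P1_at K f g phi ->
  hat g z = z * hat f z - 'i%C * phi * Delta K z.
Proof.
move=> [u [u' [Hu u02 up fu gu]]].
have su := H1_square_integrable Hu; have [su' _] := Hu.
have sK := L2_square_integrable K.
have := @H1_by_parts u u' z (2 * pi) Hu; rewrite (ltW twopi_gt0) lexx => /(_ isT).
rewrite cintegral_itvoo; last first.
  apply: cintegrableM_ce; apply: square_integrableD => //.
  exact: square_integrableZ.
rewrite -[X in X = _]/(hat (fun t => u' t + 'i%C * z * u t) z).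
rewrite hatD//; last exact: square_integrableZ.
rewrite hatZ// u02 up => E.
rewrite (ae_eq_hat z (L2_square_integrable g) _ gu); last first.
  by apply: square_integrableD; exact: square_integrableZ.
rewrite hatD; [|exact: square_integrableZ..].
rewrite !hatZ// up (ae_eq_hat z (L2_square_integrable f) su fu) /Delta.
have -> : hat u' z = ce z (2 * pi) * phi - phi - 'i%C * z * hat u z by rewrite -E addrK.
have i2 : 'i%C * 'i%C = -1 :> R[i] by rewrite -expr2 sqr_i.
transitivity ('i%C * phi * (ce z (2 * pi) - 1) - ('i%C * 'i%C) * z * hat u z + phi * hat K z); first by ring.
transitivity (z * hat u z - 'i%C * phi * (1 - ce z (2 * pi)) - ('i%C * 'i%C) * phi * hat K z); last by ring.
by rewrite i2; ring.
Qed.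

(** Variation of constants for $iu' + \varphi K = lu + g$ with $u(0) = \varphi$. The hypothesis says
    exactly that this solution returns to $\varphi$ at $2\pi$. *)
Lemma P1_at_solve K g l phi : phi * Delta K l = 'i%C * hat g l ->
  exists f, P1_at K f (l *: f + g) phi.
Proof.
move=> E; have sK := L2_square_integrable K; have sg := L2_square_integrable g.
pose w x := phi * K x - g x.
have sw : square_integrable w by apply: square_integrableB => //; exact: square_integrableZ.
pose k x := 'i%C * (ce l x * w x).
have sk : square_integrable k by apply: square_integrableZ; exact: square_integrableM_ce.
(* [p] is $e^{ilx} u(x)$; in these terms the equation says that the derivative of [p] is [k]. *)
pose p x := phi + cintegral `[0, x] k.
have sp : square_integrable p by apply: primitive_square_integrable; exact: square_integrable_cintegrable.
pose u x := ce (- l) x * p x.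
have su : square_integrable u by exact: square_integrableM_ce.
pose u' x := 'i%C * w x - 'i%C * l * u x.
have su' : square_integrable u' by apply: square_integrableB; exact: square_integrableZ.
have u0 : u 0 = phi.
  rewrite /u ce0 mul1r /p.
  by rewrite set_itv1 /cintegral !Rintegral_set1 addr0.
have Hu : H1 u u'.
  split=> // x x02; have /andP[x0 x2] := x02.
  have mI : measurable (`[0, x] : set R) by exact: measurable_itv.
  have ik : cintegrable `[0, x] k by apply: cintegrable_cc => //; exact: square_integrable_cintegrable.
  have [i1 e1] := cintegral_by_parts_ce (- l) x0 ik.
  have iw : cintegrable `[0, x] (fun t => 'i%C * w t).
    by apply: cintegrable_cc => //; apply/square_integrable_cintegrable/square_integrableZ.
  have i3 : cintegrable `[0, x] (ce (- l)).
    by apply: cintegrable_cc => //; exact/square_integrable_cintegrable/square_integrable_ce.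
  have e4 := cintegral_deriv_ce (- l) x0.
  have e2 : cintegral `[0, x] (fun t => ce (- l) t * k t) = cintegral `[0, x] (fun t => 'i%C * w t).
    apply: eq_cintegral => t _; rewrite /k ceN mulrCA; congr (_ * _).
    by rewrite mulrA mulVf ?ce_neq0// mul1r.
  have -> : cintegral `[0, x] u' = cintegral `[0, x] (fun t => 'i%C * w t +
     (phi * ('i%C * - l * ce (- l) t) + 'i%C * - l * ce (- l) t * cintegral `[0, t] k)).
    by apply: eq_cintegral => t _; rewrite /u' /u /p; ring.
  have i4 : cintegrable `[0, x] (fun t => 'i%C * - l * ce (- l) t) by exact: cintegrableZ.
  rewrite cintegralD//; last by apply: cintegrableD => //; exact: cintegrableZ.
  rewrite cintegralD//; last exact: cintegrableZ.
  rewrite (cintegralZ phi _ i4)// e4 -e2 e1 u0 /u /p; ring.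
have u2 : u (2 * pi) = phi.
  rewrite /u /p cintegral_itvoo; last exact: square_integrable_cintegrable.
  rewrite -[cintegral _ k]/(cintegral per_itv (fun x => 'i%C * (ce l x * w x))).
  rewrite cintegralZ; [|exact: measurable_per_itv|exact: cintegrableM_ce].
  rewrite -[cintegral _ _]/(hat w l).
  have -> : hat w l = phi * hat K l - hat g l.
    have -> : w = (fun x => phi * K x + -1 * g x) by apply/funext => x; rewrite mulN1r.
    by rewrite hatD ?hatZ ?mulN1r//; exact: square_integrableZ.
  rewrite mulrBr -E /Delta ceN.
  have -> : phi + ('i%C * (phi * hat K l) - phi * (1 - ce l (2 * pi) + 'i%C * hat K l)) =
    ce l (2 * pi) * phi by ring.
  by rewrite mulrA mulVf ?ce_neq0// mul1r.
have [f fu] := L2_of_fun su.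
exists f, u, u'; split => //; first by rewrite u2.
apply: ae_eq_per_trans (L2_addP _ _) _.
apply: ae_eq_per_trans (ae_eq_perD (ae_eq_per_trans (L2_scaleP l f) (ae_eq_perZ l fu)) (ae_eq_per_refl g)) _.
have i2 : 'i%C * 'i%C = -1 :> R[i] by rewrite -expr2 sqr_i.
have -> : (fun x => 'i%C * u' x + u (2 * pi) * K x) = (fun x => l * u x + g x).
  apply/funext => x; rewrite u2 /u'.
  transitivity (('i%C * 'i%C) * (w x - l * u x) + phi * K x); first by ring.
  by rewrite i2 /w; ring.
exact: ae_eq_per_refl.
Qed.

(** The integrating factor $e^{ilx}$ solves the eigenvalue equation explicitly, with a solution
    proportional to [phi]. Hence eigenspaces have dimension at most one, and [phi = 0] forces
    [f = 0]. *)
Lemma P1_at_kernel K f l phi : P1_at K f (l *: f) phi ->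
  ae_eq_per f (fun x => phi * (ce (- l) x * (1 + 'i%C * cintegral `[0, x] (fun t => ce l t * K t)))).
Proof.
have F := @ae_filter_ringOfSetsType _ _ _ mu.
move=> [u [u' [Hu u02 up fu gu]]].
have su := H1_square_integrable Hu; have [su' _] := Hu.
have sK := L2_square_integrable K.
apply: (ae_eq_per_trans fu); apply: aeW => x /per_itvP x02.
have /andP[x0 x2] := x02.
have := H1_by_parts l Hu x02.
have S : `]0, x[ `<=` (per_itv : set R) by apply: subset_itvl; rewrite bnd_simp.
have sv : square_integrable (fun t => u' t + 'i%C * l * u t).
  by apply: square_integrableD => //; exact: square_integrableZ.
have mI : measurable (`]0, x[ : set R) by exact: measurable_itv.
have cS h : cintegrable per_itv h -> cintegrable `]0, x[ h.
  by apply: cintegrableS => //; exact: measurable_per_itv.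
rewrite cintegral_itvoo; last by apply: cS; exact: cintegrableM_ce.
rewrite (@ae_eq_cintegral_sub _ _ _ (fun t => 'i%C * phi * (ce l t * K t)))//; first last.
- have i2 : 'i%C * 'i%C = -1 :> R[i] by rewrite -expr2 sqr_i.
  move: (L2_scaleP l f) fu gu; apply: filterS3 => t lf ft gt tI.
  have := gt tI; rewrite lf// ft// up => H.
  have -> : ce l t * (u' t + 'i%C * l * u t) = ce l t * (u' t + 'i%C * (l * u t)) by ring.
  rewrite H.
  transitivity (ce l t * ((1 + 'i%C * 'i%C) * u' t) + 'i%C * phi * (ce l t * K t)); first by ring.
  by rewrite i2 subrr mul0r mulr0 add0r.
- by apply/square_integrable_cmeasurable/square_integrableZ/square_integrableM_ce.
- exact/square_integrable_cmeasurable/square_integrableM_ce.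
rewrite cintegralZ//; last by apply: cS; exact: cintegrableM_ce.
rewrite -cintegral_itvoo; last by apply: cS; exact: cintegrableM_ce.
rewrite u02 up => H.
have -> : u x = ce (- l) x * (ce l x * u x) by rewrite ceN mulrA mulVf ?ce_neq0// mul1r.
have -> : ce l x * u x = ce l x * u x - phi + phi by rewrite subrK.
rewrite -H; ring.
Qed.

Lemma P1_at_kernel_scale K f v l phi : P1_at K f (l *: f) phi ->
  P1_at K v (l *: v) 1 -> f = phi *: v.
Proof.
move=> /P1_at_kernel Hf /P1_at_kernel Hv; apply: L2_eqP.
apply: ae_eq_per_trans Hf _; apply: ae_eq_per_sym.
apply: ae_eq_per_trans (L2_scaleP _ _) _; apply: ae_eq_per_trans (ae_eq_perZ phi Hv) _.
under eq_fun do rewrite mul1r; exact: ae_eq_per_refl.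
Qed.

End transform.

(** * Chords and arcs of the unit circle *)

Section unit_circle.
Context {R : realType}.
Local Open Scope complex_scope.
Implicit Types (s t x y : R) (z : R[i]).

Lemma normr_sin_le x : `|sin x| <= `|x|.
Proof.
wlog x0 : x / 0 <= x.
  move=> H; have [/H//|/ltW x0] := leP 0 x.
  by rewrite -normrN -sinN -(normrN x) H// oppr_ge0.
have [|c c01 /eqP] := @MVT_segment R sin cos 0 x x0.
  exact/continuous_subspaceT/continuous_sin.
rewrite sin0 !subr0 => /eqP ->.
by rewrite normrM ler_piMl// cos_max.
Qed.

(** The mean value theorem gives $\sin y = y \cos c$ with $0 \le c \le y$, and the cosine decreases
    on $[0, \pi]$. *)
Lemma sin_ge_cos y : 0 <= y <= pi -> y * cos y <= sin y.
Proof.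
move=> /andP[y0 ypi].
have [|c + /eqP] := @MVT_segment R sin cos 0 y y0.
  exact/continuous_subspaceT/continuous_sin.
rewrite in_itv/= => /andP[c0 cy].
rewrite sin0 !subr0 => /eqP ->; rewrite mulrC ler_wpM2r//.
move: cy; rewrite le_eqVlt => /predU1P[->//|cy].
by rewrite ltW// ltr_cos ?in_itv/= ?c0 ?y0 ?ypi//= (le_trans (ltW cy)).
Qed.

(* From [sin y = 2 sin (y/2) cos (y/2)] and [sin u >= u cos u]. *)
Lemma sin_ge_linear Y y : Y < pi -> 0 <= y <= Y -> cos (Y / 2) ^+ 2 * y <= sin y.
Proof.
move=> Ypi /andP[y0 yY].
have h2 (u : R) : u / 2 + u / 2 = u by lra.
have u0 : 0 <= y / 2 by rewrite divr_ge0.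
have uU : y / 2 <= Y / 2 by rewrite ler_pM2r ?invr_gt0.
have p2 : Y / 2 < pi / 2 by rewrite ltr_pM2r ?invr_gt0.
have ppi : pi / 2 <= pi :> R by rewrite ler_pdivrMr// ler_peMr ?pi_ge0// ler1n.
have cY : 0 < cos (Y / 2).
  by apply: cos_gt0_pihalf; rewrite p2 (lt_le_trans _ (le_trans u0 uU))// oppr_lt0 divr_gt0 ?pi_gt0.
have cyY : cos (Y / 2) <= cos (y / 2).
  move: uU; rewrite le_eqVlt => /predU1P[->//|uU].
  rewrite ltW// ltr_cos ?in_itv/= ?u0//=.
  - by rewrite (le_trans (ltW uU))// (le_trans (ltW p2)).
  - by rewrite (le_trans u0 (ltW uU)) (le_trans (ltW p2)).
have cy0 := lt_le_trans cY cyY.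
have H : y / 2 * cos (y / 2) <= sin (y / 2).
  by apply: sin_ge_cos; rewrite u0 (le_trans uU)// (le_trans (ltW p2)).
rewrite -[y in sin y]h2 sinD [X in _ <= _ + X]mulrC -mulr2n.
apply: (@le_trans _ _ ((y / 2 * cos (y / 2) * cos (y / 2)) *+ 2)); last first.
  by rewrite lerMn2r/= ler_pM2r.
have -> : (y / 2 * cos (y / 2) * cos (y / 2)) *+ 2 = cos (y / 2) ^+ 2 * y by field.
have c1 := ltW cY; have c2 := ltW cy0.
by rewrite ler_wpM2r// ler_sqr ?nnegrE.
Qed.

Lemma normc_cis_sub1 s t : normc (ce s%:C t - 1) = 2 * `|sin (s * t / 2)|.
Proof.
apply: (@pexpIrn R 2) => //; rewrite ?nnegrE ?normc_ge0 ?mulr_ge0//.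
rewrite sqr_normcE ce_real cReD cImD cReN cImN /= subr0 exprMn real_normK ?num_real//.
have -> : cos (s * t) = 1 - 2 * sin (s * t / 2) ^+ 2.
  have E : s * t = s * t / 2 + s * t / 2 by lra.
  by rewrite {1}E cosD -!expr2 cos2sin2; ring.
have -> : sin (s * t) ^+ 2 = 1 - (1 - 2 * sin (s * t / 2) ^+ 2) ^+ 2.
  have E : s * t = s * t / 2 + s * t / 2 by lra.
  have H := cos2sin2 (s * t / 2).
  rewrite {1}E sinD; ring: H.
ring.
Qed.

Lemma normc_cis_sub1_le s t : normc (ce s%:C t - 1) <= `|s * t|.
Proof.
rewrite normc_cis_sub1 (le_trans (ler_wpM2l _ (normr_sin_le _)))//.
by rewrite normrM [X in _ * (_ * X)]ger0_norm ?invr_ge0// mulrC divfK.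
Qed.

(** A chord is comparable to its arc as long as the arc stays below $2Y < 2\pi$; the constant
    degenerates when $Y$ tends to $\pi$. *)
Lemma normc_cis_sub1_ge (Y : R) s t : Y < pi -> `|s * t| <= 2 * Y ->
  cos (Y / 2) ^+ 2 * `|s * t| <= normc (ce s%:C t - 1).
Proof.
move=> Ypi stY; rewrite normc_cis_sub1.
set r := s * t in stY *; clearbody r.
have -> : `|sin (r / 2)| = sin (`|r| / 2).
  have r2 : 0 <= `|r| / 2 <= pi.
    by rewrite divr_ge0//= ler_pdivrMr// [_ * 2]mulrC (le_trans stY)// ler_pM2l// ltW.
  have [r0|r0] := ler0P r.
    rewrite (ler0_norm r0) in r2 *.
    by rewrite -normrN -sinN -mulNr ger0_norm//; exact: sin_ge0_pi.
  by rewrite (gtr0_norm r0) in r2 *; rewrite ger0_norm//; exact: sin_ge0_pi.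
have H : cos (Y / 2) ^+ 2 * (`|r| / 2) <= sin (`|r| / 2).
  by apply: sin_ge_linear => //; rewrite divr_ge0//= ler_pdivrMr// [_ * 2]mulrC.
by rewrite -(@ler_pM2l _ 2)// in H; rewrite mulrCA [2 * (_ / 2)]mulrC divfK in H.
Qed.

End unit_circle.

(** * Jordan chains of an operator given by its graph *)

Section jordan_chain.
Context {C : fieldType} {V : lmodType C}.
Variable A : V -> V -> Prop.
Hypothesis A_linear : forall c f g f' g', A f g -> A f' g' ->
  A (c *: f + f') (c *: g + g').
Hypothesis A0 : A 0 0.

Lemma graph_sum (n : nat) (c : 'I_n -> C) (x y : 'I_n -> V) :
  (forall i, A (x i) (y i)) -> A (\sum_i c i *: x i) (\sum_i c i *: y i).
Proof.
move=> Axy; elim/big_rec2: _ => // i f g _; exact: A_linear.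
Qed.

(** A chain that cannot be prolonged spans the root space if the kernel is spanned by [v 0%N]. By
    induction on the power, [(A - l) f] is a combination of the [v i]; shifting the indices of its
    first [m] terms gives a [w] such that [(A - l) (f - w)] is a multiple of [v m]. As [v m] is not
    in the range of [A - l], the multiple is 0 and [f - w] lies in the kernel. *)
Lemma alg_mult_chain (l : C) (m : nat) (v : nat -> V) :
  A (v 0%N) (l *: v 0%N) ->
  (forall j, (j < m)%N -> A (v j.+1) (l *: v j.+1 + v j)) ->
  (forall f, A f (l *: f) -> exists c, f = c *: v 0%N) ->
  ~ (exists f, A f (l *: f + v m)) ->
  (forall c : 'I_m.+1 -> C, \sum_i c i *: v i = 0 -> forall i, c i = 0) ->
  alg_mult A l m.+1.
Proof.
move=> Av0 AvS ker0 nran free; exists (fun i => v i); split => //.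
  move=> [ i im0 ] /=; have im : (i <= m)%N by []; clear im0; exists i.+1.
  elim: i im => [|i IH] im.
    by exists (l *: v 0%N) => //=; rewrite subrr.
  exists (l *: v i.+1 + v i); first exact: AvS.
  by rewrite addrAC subrr add0r; apply: IH; exact: ltnW.
move=> f [j]; elim: j f => [|j IH] f /=.
  by move->; exists (fun=> 0); rewrite big1// => i _; rewrite scale0r.
move=> [g Afg /IH[c gE]].
pose w := \sum_(i < m) c (widen_ord (leqnSn m) i) *: v i.+1.
pose r := \sum_(i < m) c (widen_ord (leqnSn m) i) *: v i.
have Aw : A w (l *: w + r).
  rewrite /w /r scaler_sumr -big_split /=.
  under [X in A _ X]eq_bigr do rewrite scalerA mulrC -scalerA -scalerDr.
  by apply: graph_sum => i; exact: AvS.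
have Afw : A (f - w) (l *: (f - w) + c ord_max *: v m).
  have -> : f - w = - 1 *: w + f by rewrite scaleN1r addrC.
  have -> : l *: (- 1 *: w + f) + c ord_max *: v m = - 1 *: (l *: w + r) + g.
    have -> : g = l *: f + (r + c ord_max *: v m).
      by rewrite -[LHS](subrK (l *: f)) gE big_ord_recr [LHS]addrC.
    rewrite !scaleN1r scalerDr scalerN opprD -!addrA; congr (_ + _).
    by rewrite [RHS]addrCA addKr.
  exact: A_linear.
have [c0|c0] := eqVneq (c ord_max) 0.
  move: Afw; rewrite c0 scale0r addr0 => /ker0[a fwE].
  (* The kernel coefficient [a] takes index 0 and the coefficients [c] move up by one; the last of
     them is 0 and drops out. *)
  exists (fun i => if unlift ord0 i is Some k then c (widen_ord (leqnSn m) k) else a).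
  rewrite big_ord_recl unlift_none -fwE.
  under eq_bigr do rewrite liftK lift0.
  by rewrite subrK.
case: nran; exists ((c ord_max)^-1 *: (f - w)).
have -> : l *: ((c ord_max)^-1 *: (f - w)) + v m =
    (c ord_max)^-1 *: (l *: (f - w) + c ord_max *: v m).
  by rewrite [RHS]scalerDr !scalerA mulVf// scale1r mulrC.
by have := A_linear (c ord_max)^-1 Afw A0; rewrite !addr0.
Qed.

End jordan_chain.

(** * Algebraic multiplicity as the order of a zero *)

Section multiplicity.
Context {R : realType}.
Local Open Scope classical_set_scope.
Local Open Scope complex_scope.
Local Notation mu := (@lebesgue_measure R).
Implicit Types (f g K : L2 R) (h k u : R -> R[i]) (a z l phi : R[i]).

Lemma H1_linear a u u' h h' : H1 u u' -> H1 h h' ->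
  H1 (fun x => a * u x + h x) (fun x => a * u' x + h' x).
Proof.
move=> [su uE] [sh hE]; split.
  by apply: square_integrableD => //; exact: square_integrableZ.
move=> x x02; have /andP[x0 x2] := x02.
have iu : cintegrable `[0, x] u'.
  by apply: cintegrable_cc => //; exact: square_integrable_cintegrable.
have ih : cintegrable `[0, x] h'.
  by apply: cintegrable_cc => //; exact: square_integrable_cintegrable.
rewrite uE// hE// cintegralD//; last exact: cintegrableZ.
by rewrite cintegralZ//; ring.
Qed.

Lemma P1_linear K c f g f' g' : P1 K f g -> P1 K f' g' ->
  P1 K (c *: f + f') (c *: g + g').
Proof.
move=> [u [u' [Hu u02 fu gu]]] [h [h' [Hh h02 fh gh]]].
exists (fun x => c * u x + h x), (fun x => c * u' x + h' x); split.
- exact: H1_linear.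
- by rewrite u02 h02.
- apply: ae_eq_per_trans (L2_addP _ _) _; apply: ae_eq_perD => //.
  by apply: ae_eq_per_trans (L2_scaleP _ _) _; exact: ae_eq_perZ.
- apply: ae_eq_per_trans (L2_addP _ _) _.
  have -> : (fun x => 'i%C * (c * u' x + h' x) + (c * u (2 * pi) + h (2 * pi)) * K x) =
    (fun x => c * ('i%C * u' x + u (2 * pi) * K x) + ('i%C * h' x + h (2 * pi) * K x)).
    by apply/funext => x; ring.
  apply: ae_eq_perD => //.
  by apply: ae_eq_per_trans (L2_scaleP _ _) _; exact: ae_eq_perZ.
Qed.

Lemma P1_zero K : P1 K 0 0.
Proof.
(* The solver with zero data returns some [f] in the graph over 0; subtracting the pair from itself
   makes it unnecessary to identify [f]. *)
have [|f [u [u' [? ? ? ? ?]]]] := @P1_at_solve R K 0 0 0.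
  by rewrite mul0r hat_L20 mulr0.
have H : P1 K f (0 *: f + 0) by exists u, u'.
have := P1_linear (- 1) H H.
by rewrite scale0r addr0 !scaleN1r addNr oppr0 addr0.
Qed.

Lemma ce_shift_le l (s t : R) : 0 <= t <= 2 * pi ->
  normc (ce (l + s%:C) t - ce l t) <= ce_bound l * (`|s| * (2 * pi)).
Proof.
move=> t02; have /andP[t0 t2] := t02.
rewrite ceDl -[X in _ - X]mulr1 -mulrBr normcM.
apply: ler_pM; rewrite ?normc_ge0 ?normc_ce_le//.
by rewrite (le_trans (normc_cis_sub1_le _ _))// normrM ler_wpM2l// ger0_norm.
Qed.

Lemma hat_lipschitz l h : square_integrable h ->
  exists2 L, 0 <= L & forall s : R, 0 < s ->
    normc (hat h (l + s%:C) - hat h l) <= L * s.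
Proof.
move=> sh; exists (2 * pi * (ce_bound l * (2 * pi)) ^+ 2 + sqnorm h).
  by rewrite addr_ge0 ?sqnorm_ge0// mulr_ge0 ?sqr_ge0// ltW// twopi_gt0.
move=> s s0; pose d t := ce (l + s%:C) t - ce l t.
have sd : square_integrable d by apply: square_integrableB; exact: square_integrable_ce.
have -> : hat h (l + s%:C) - hat h l = cintegral per_itv (fun t => d t * h t).
  rewrite /hat -cintegralB.
  - by apply: eq_cintegral => t _; rewrite /d mulrBl.
  - exact: measurable_per_itv.
  - exact: cintegrableM_ce.
  - exact: cintegrableM_ce.
(* The weight [s^-1] balances the estimate: [d] is of size [s], so both terms become multiples of
   [s]. *)
have s1 : 0 < s^-1 by rewrite invr_gt0.
apply: le_trans (normc_cintegralM_le s1 sd sh) _.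
rewrite invrK mulrDl [sqnorm h * s]mulrC lerD2r.
have dM t : per_itv t -> normc (d t) <= ce_bound l * (2 * pi) * s.
  by move=> /per_itvP/(ce_shift_le l s); rewrite (gtr0_norm s0) mulrCA mulrC mulrA.
rewrite mulrC ler_pdivrMr// (le_trans (sqnorm_le_bound sd dM))//.
by rewrite exprMn -mulrA expr2 !mulrA.
Qed.

Lemma Delta_lipschitz K l :
  exists2 L, 0 <= L & forall s : R, 0 < s ->
    normc (Delta K (l + s%:C) - Delta K l) <= L * s.
Proof.
have [L L0 LP] := hat_lipschitz l (L2_square_integrable K).
exists (ce_bound l * (2 * pi) + L).
  by rewrite addr_ge0// mulr_ge0 ?expR_ge0// ltW// twopi_gt0.
move=> s s0.
have -> : Delta K (l + s%:C) - Delta K l =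
  - (ce (l + s%:C) (2 * pi) - ce l (2 * pi)) + 'i%C * (hat K (l + s%:C) - hat K l).
  by rewrite /Delta; ring.
rewrite [_ * s]mulrDl (le_trans (ler_normcD _ _))// lerD//.
  rewrite normcN (le_trans (ce_shift_le _ _ _))//; first by rewrite lexx ltW// twopi_gt0.
  by rewrite (gtr0_norm s0) le_eqVlt; apply/orP; left; apply/eqP; ring.
by rewrite normcM normc_i mul1r LP.
Qed.

(** A Lipschitz bound on the ray stands in for continuity of [F] at [l]. *)
Lemma right_limit_eq0 (F : R[i] -> R[i]) l (L M d : R) :
  0 < d -> 0 <= L -> (forall s : R, 0 < s -> normc (F (l + s%:C) - F l) <= L * s) ->
  (forall s : R, 0 < s -> s < d -> normc (F (l + s%:C)) <= M * s) -> F l = 0.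
Proof.
move=> d0 L0 FL FM; apply/eqP; rewrite -normc_eq0; apply/eqP/le_anti.
rewrite normc_ge0 andbT; apply/ler_addgt0Pr => e e0; rewrite add0r.
have M0 : 0 <= `|M| by [].
pose s := Num.min (d / 2) (e / (L + `|M| + 1)).
have D0 : 0 < L + `|M| + 1 by rewrite ltr_wpDl// addr_ge0.
have s0 : 0 < s by rewrite lt_min !divr_gt0.
have sd : s < d by rewrite gt_min; apply/orP; left; rewrite ltr_pdivrMr// mulr_natr mulr2n ltrDl.
have se : s * (L + `|M| + 1) <= e by rewrite -ler_pdivlMr// ge_min lexx orbT.
have -> : F l = F (l + s%:C) - (F (l + s%:C) - F l) by rewrite opprB addrC subrK.
apply: le_trans (ler_normcB _ _) _.
apply: le_trans (lerD (FM s s0 sd) (FL s s0)) _; apply: le_trans _ se.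
have : M * s <= `|M| * s by rewrite ler_wpM2r ?ler_norm// ltW.
move: s0; lra.
Qed.

Lemma right_limit_neq0 (F : R[i] -> R[i]) l (L c d : R) :
  0 < d -> 0 < c -> 0 <= L -> (forall s : R, 0 < s -> normc (F (l + s%:C) - F l) <= L * s) ->
  (forall s : R, 0 < s -> s < d -> c <= normc (F (l + s%:C))) -> F l != 0.
Proof.
move=> d0 c0 L0 FL Fc; apply/eqP => Fl0.
pose s := Num.min (d / 2) (c / (L + 1) / 2).
have D0 : 0 < L + 1 by rewrite ltr_wpDl.
have s0 : 0 < s by rewrite lt_min !divr_gt0.
have sd : s < d by rewrite gt_min; apply/orP; left; rewrite ltr_pdivrMr// mulr_natr mulr2n ltrDl.
have se : s * 2 * (L + 1) <= c by rewrite -!ler_pdivlMr// ge_min lexx orbT.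
have := Fc s s0 sd; have := FL s s0; rewrite Fl0 subr0 => H1 H2.
have := le_trans H2 H1; move: se s0 L0; nra.
Qed.

Lemma hat_P1_shift K f g l phi z : P1_at K f (l *: f + g) phi ->
  (z - l) * hat f z = hat g z + 'i%C * phi * Delta K z.
Proof.
move=> /(@hat_P1 R _ _ _ _ z); rewrite hat_L2D hat_L2Z => H.
have -> : hat g z = l * hat f z + hat g z - l * hat f z by ring.
by rewrite H; ring.
Qed.

Lemma Delta_neq0_not_eigenvalue K l : Delta K l != 0 -> ~ is_eigenvalue (P1 K) l.
Proof.
move=> D0 [f f0 /P1_atE[phi H]].
have := H; rewrite -[l *: f]addr0 => /(hat_P1_shift l).
rewrite subrr mul0r hat_L20 add0r => /esym/eqP.
rewrite !mulf_eq0 (negbTE D0) orbF => /orP[|/eqP phi0].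
  by rewrite -normc_eq0 normc_i oner_eq0.
move/negP: f0; apply; apply/eqP/L2_eqP.
apply: ae_eq_per_trans (P1_at_kernel H) _; rewrite phi0.
under eq_fun do rewrite mul0r; apply: ae_eq_per_sym; exact: L2_zeroP.
Qed.

(** Order of vanishing seen along the horizontal ray to the right of [l] only. The bounds determine
    [m], presuppose no holomorphy, and do not involve the value [F l], which may be meaningless for
    a quotient. *)
Definition has_order (F : R[i] -> R[i]) l (m : nat) := exists c M d : R,
  [/\ 0 < c, 0 < d & forall s : R, 0 < s -> s < d ->
    c * s ^+ m <= normc (F (l + s%:C)) <= M * s ^+ m].

Lemma order0_not_eigenvalue K l : has_order (Delta K) l 0 ->
  ~ is_eigenvalue (P1 K) l.
Proof.
move=> [c [M [d [c0 d0 H]]]]; apply: Delta_neq0_not_eigenvalue.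
have [L L0 LP] := Delta_lipschitz K l.
apply: (right_limit_neq0 d0 c0 L0 LP) => s s0 sd.
by have /andP[+ _] := H s s0 sd; rewrite expr0 mulr1.
Qed.

(** Solving $(P - l) v_{n+1} = v_n$ with boundary value 0 requires the transform of [v n] to vanish
    at [l]. That transform is ['i%C * Delta K z] over [(z - l) ^+ n.+1], so it does vanish as long
    as [n.+1 < m]. Boundary value 0 makes the next transform a plain quotient by [z - l], which
    continues the pattern. *)
Lemma exists_chain K l m n (c M d : R) : 0 < c -> 0 < d ->
  (forall s : R, 0 < s -> s < d ->
    c * s ^+ m <= normc (Delta K (l + s%:C)) <= M * s ^+ m) ->
  (n < m)%N -> exists v : nat -> L2 R,
  [/\ P1_at K (v 0%N) (l *: v 0%N) 1,
      forall j, (j < n)%N -> P1_at K (v j.+1) (l *: v j.+1 + v j) 0 &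
      forall j, (j <= n)%N -> forall z,
        (z - l) ^+ j.+1 * hat (v j) z = 'i%C * Delta K z].
Proof.
move=> c0 d0 H; elim: n => [m0|n IH nm].
  have D0 : Delta K l = 0.
    have [L L0 LP] := Delta_lipschitz K l.
    apply: (@right_limit_eq0 _ _ _ (`|M| + c) (Num.min d 1) _ L0 LP); first by rewrite lt_min d0/=.
    move=> s s0; rewrite lt_min => /andP[sd s1].
    have /andP[A1 A2] := H s s0 sd.
    apply: (le_trans A2); rewrite -(prednK m0) exprS mulrA.
    have sp : s ^+ m.-1 <= 1 by rewrite exprn_ile1// ltW.
    have sp0 : 0 <= s ^+ m.-1 by rewrite exprn_ge0// ltW.
    apply: (@le_trans _ _ (`|M| * s)).
      have : M * s * s ^+ m.-1 <= `|M| * s * s ^+ m.-1.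
        by rewrite ler_wpM2r// ler_wpM2r ?ler_norm// ltW.
      move=> /le_trans; apply.
      by rewrite ler_piMr// mulr_ge0// ltW.
    by rewrite ler_wpM2r ?ltW// ltrDl.
  have [|f] := @P1_at_solve R K 0 l 1.
    by rewrite D0 hat_L20 !mulr0.
  rewrite addr0 => Hf; exists (fun=> f); split => // j; rewrite leqn0 => /eqP-> z.
  move: Hf; rewrite -[l *: f]addr0 => /hat_P1_shift ->.
  by rewrite hat_L20 add0r mulr1.
have [v [v0 vS vH]] := IH (ltnW nm).
have hl0 : hat (v n) l = 0.
  have [L L0 LP] := hat_lipschitz l (L2_square_integrable (v n)).
  apply: (@right_limit_eq0 _ _ _ `|M| (Num.min d 1) _ L0 LP); first by rewrite lt_min d0/=.
  move=> s s0; rewrite lt_min => /andP[sd s1].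
  have /andP[A1 A2] := H s s0 sd.
  have zl : l + s%:C - l = s%:C by rewrite addrC addKr.
  have := vH n (leqnn n) (l + s%:C); rewrite zl => /(congr1 (@normc R)).
  rewrite !normcM normcX normcR (gtr0_norm s0) normc_i mul1r => E.
  have sn : 0 < s ^+ n.+1 by rewrite exprn_gt0.
  rewrite -(ler_pM2l sn) E (le_trans A2)// mulrCA -exprSr.
  apply: (@le_trans _ _ (`|M| * s ^+ m)).
    by rewrite ler_wpM2r ?ler_norm// exprn_ge0// ltW.
  by rewrite ler_wpM2l// ler_wiXn2l// ltW.
have [|f Hf] := @P1_at_solve R K (v n) l 0.
  by rewrite mul0r hl0 mulr0.
exists (fun j => if (j <= n)%N then v j else f); split.
- by [].
- move=> j jn1; have /predU1P[->|jn] : (j == n) || (j < n)%N by rewrite -leq_eqVlt.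
    by rewrite ltnn leqnn.
  by rewrite jn ltnW//; exact: vS.
- move=> j jn1 z; have /predU1P[->|jn] : (j == n.+1) || (j < n.+1)%N by rewrite -leq_eqVlt.
    rewrite ltnn exprSr -mulrA (hat_P1_shift z Hf) mulr0 mul0r addr0.
    exact: vH.
  by rewrite -ltnS jn; exact: vH.
Qed.

(** At [l + s], multiplication by $s^{m+1}$ turns a linear relation between the transforms into a
    polynomial in [s] times ['i%C * Delta K]. The second factor is nonzero for small [s], so the
    polynomial has too many roots. *)
Lemma chain_free K l m (v : nat -> L2 R) (d : R) : 0 < d ->
  (forall s : R, 0 < s -> s < d -> Delta K (l + s%:C) != 0) ->
  (forall j, (j <= m)%N -> forall z,
        (z - l) ^+ j.+1 * hat (v j) z = 'i%C * Delta K z) ->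
  forall c : 'I_m.+1 -> R[i], \sum_i c i *: v i = 0 -> forall i, c i = 0.
Proof.
move=> d0 D0 vH c cv0.
pose p : {poly R[i]} := \sum_(i < m.+1) c i *: 'X^(m - i).
have pE (i : 'I_m.+1) : p`_(m - i) = c i.
  rewrite coef_sum (bigD1 i)//= coefZ coefXn eqxx mulr1 big1 ?addr0// => j ji.
  rewrite coefZ coefXn; case: eqP => [E|]; last by rewrite mulr0.
  case/eqP: ji; apply: val_inj => /=.
  by rewrite -(subKn (leq_ord j)) -E subKn// leq_ord.
suff p0 : p = 0 by move=> i; rewrite -pE p0 coef0.
have root_p (s : R) : 0 < s -> s < d -> root p s%:C.
  move=> s0 sd; rewrite rootE; apply/eqP.
  have zl : l + s%:C - l = s%:C by rewrite addrC addKr.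
  have sC0 : s%:C != 0 :> R[i] by rewrite -normc_eq0 normcR normr_eq0 gt_eqF.
  have iD0 : 'i%C * Delta K (l + s%:C) != 0.
    by rewrite mulf_neq0 ?D0// -normc_eq0 normc_i oner_eq0.
  apply: (mulfI iD0); rewrite mulr0.
  have := hat_L2_sum (index_enum 'I_m.+1) c (fun i => v i) (l + s%:C).
  rewrite cv0 hat_L20 => /(congr1 (fun y => s%:C ^+ m.+1 * y)); rewrite mulr0 => ->.
  rewrite /p horner_sum !mulr_sumr; apply: eq_bigr => i _.
  rewrite hornerZ hornerXn -(vH i _ (l + s%:C)) ?leq_ord// zl.
  have -> : s%:C ^+ m.+1 = s%:C ^+ i.+1 * s%:C ^+ (m - i) :> R[i].
    by rewrite -exprD addSn subnKC// leq_ord.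
  by ring.
apply/eqP; apply: contraT => pn0.
(* The points $d/(j+2)$ with $0 \le j \le m$ lie in $(0, d)$: [m.+1] distinct roots against a
   polynomial of degree at most [m]. *)
pose rs : seq R[i] := [seq (d / (j.+2)%:R)%:C | j <- iota 0 m.+1].
have := @max_poly_roots _ p rs pn0.
have -> : all (root p) rs.
  apply/allP => _ /mapP[k _ ->]; apply: root_p; first by rewrite divr_gt0// ltr0n.
  by rewrite ltr_pdivrMr ?ltr0n// ltr_pMr// ltr1n.
have -> : uniq rs.
  rewrite map_inj_uniq ?iota_uniq// => a b /complexI /mulfI.
  by move=> /(_ (lt0r_neq0 d0)) /invr_inj /eqP; rewrite eqr_nat => /eqP[].
rewrite size_map size_iota => /(_ isT isT).
rewrite ltnNge => /negP[].
apply: (leq_trans (size_sum _ _ _)); apply/bigmax_leqP => i _.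
by rewrite (leq_trans (size_scale_leq _ _))// size_polyXn ltnS leq_subr.
Qed.

(** The chain has length exactly [m]: a further vector would make the transform of the last one
    vanish at [l], where the order hypothesis bounds it away from 0. *)
Theorem P1_order_multiplicity K l m : (0 < m)%N -> has_order (Delta K) l m ->
  is_eigenvalue (P1 K) l /\ alg_mult (P1 K) l m.
Proof.
case: m => // m _ [c [M [d [c0 d0 H]]]].
have [v [v0 vS vH]] := exists_chain c0 d0 H (ltnSn m).
have D0 (s : R) : 0 < s -> s < d -> Delta K (l + s%:C) != 0.
  move=> s0 sd; have /andP[+ _] := H s s0 sd.
  by rewrite -normc_gt0; apply: lt_le_trans; rewrite mulr_gt0// exprn_gt0.
have v0' : P1 K (v 0%N) (l *: v 0%N) by apply/P1_atE; exists 1.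
split.
  exists (v 0%N) => //; apply/eqP => v00.
  have d2 : d / 2 < d by rewrite ltr_pdivrMr// ltr_pMr// ltr1n.
  have /eqP[] := D0 _ (divr_gt0 d0 (ltr0Sn _ _)) d2.
  have := vH 0%N (leq0n _) (l + (d / 2)%:C); rewrite v00 hat_L20 mulr0.
  by move=> /esym/eqP; rewrite mulf_eq0 -normc_eq0 normc_i oner_eq0/= => /eqP.
apply: (@alg_mult_chain _ _ _ _ _ l m v) => //.
- by move=> a f g f' g'; exact: P1_linear.
- exact: P1_zero.
- by move=> j jm; apply/P1_atE; exists 0; exact: vS.
- by move=> f /P1_atE[phi Hf]; exists phi; apply: P1_at_kernel_scale v0.
- move=> [f /P1_atE[phi /(hat_P1_shift l)]].
  rewrite subrr mul0r.
  have Dl0 : Delta K l = 0.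
    have := vH 0%N (leq0n _) l; rewrite subrr expr1 mul0r => /esym/eqP.
    by rewrite mulf_eq0 -normc_eq0 normc_i oner_eq0/= => /eqP.
  rewrite Dl0 mulr0 addr0 => /esym/eqP; apply/negP.
  have [L L0 LP] := hat_lipschitz l (L2_square_integrable (v m)).
  apply: (right_limit_neq0 d0 c0 L0 LP) => s s0 sd.
  have /andP[+ _] := H s s0 sd.
  have zl : l + s%:C - l = s%:C by rewrite addrC addKr.
  have := vH m (leqnn m) (l + s%:C); rewrite zl => /(congr1 (@normc R)).
  rewrite !normcM normcX normcR (gtr0_norm s0) normc_i mul1r => <-.
  by rewrite [c * _]mulrC ler_pM2l// exprn_gt0.
- exact: chain_free d0 D0 vH.
Qed.

End multiplicity.

(** * Windows of integers and unordered sums *)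

Section integer_windows.
Context {R : realType}.
Implicit Types (x y : int -> R) (s : seq int).

(* [win M] enumerates the integers [n] with [- M <= n < M]. *)
Definition win (M : nat) : seq int :=
  [seq Posz k | k <- iota 0 M] ++ [seq Negz k | k <- iota 0 M].

Lemma mem_win M (n : int) : (n \in win M) = (- M%:Z <= n < M%:Z).
Proof.
rewrite mem_cat; case: n => k.
  rewrite mem_map ?mem_iota ?add0n; last by move=> ? ? [].
  have -> : (Posz k \in [seq Negz j | j <- iota 0 M]) = false.
    by apply/negbTE/mapP => -[].
  rewrite orbF; apply/idP/idP; lia.
have -> : (Negz k \in [seq Posz j | j <- iota 0 M]) = false.
  by apply/negbTE/mapP => -[].
rewrite mem_map ?mem_iota ?add0n; last by move=> ? ? [].
apply/idP/idP; lia.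
Qed.

Lemma uniq_win M : uniq (win M).
Proof.
rewrite cat_uniq !map_inj_uniq ?iota_uniq ?andbT; try by move=> ? ? [].
by apply/hasPn => _ /mapP[k _ ->]; apply/mapP => -[].
Qed.

Lemma win_sub M M' : (M <= M')%N -> {subset win M <= win M'}.
Proof. by move=> MM' n; rewrite !mem_win; lia. Qed.

Lemma seq_sub_win s : exists M, {subset s <= win M}.
Proof.
elim: s => [|n s [M IH]]; first by exists 0%N.
exists (maxn M (`|n|%N).+1) => k; rewrite inE => /orP[/eqP->|/IH].
  by rewrite mem_win; lia.
by apply: win_sub; exact: leq_maxl.
Qed.

Lemma big_split_sub (V : nmodType) (F : int -> V) (s1 s2 : seq int) :
  uniq s1 -> uniq s2 -> {subset s1 <= s2} ->
  \sum_(n <- s2) F n = \sum_(n <- s1) F n + \sum_(n <- s2 | n \notin s1) F n.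
Proof.
move=> u1 u2 sub; rewrite (bigID (mem s1))/=; congr (_ + _).
rewrite -big_filter; apply: perm_big; apply: uniq_perm; rewrite ?filter_uniq//.
by move=> n; rewrite mem_filter; case: (boolP (n \in s1)) => // /sub ->.
Qed.

(** The window is half open, so that shifting it by one exchanges a single term at each end. *)
Lemma sum_win_telescope (V : zmodType) (w : int -> V) M :
  \sum_(n <- win M) (w n - w (n + 1)) = w (- M%:Z) - w M%:Z.
Proof.
elim: M => [|M IH]; first by rewrite big_nil /= oppr0 subrr.
have -> : \sum_(n <- win M.+1) (w n - w (n + 1)) =
  \sum_(n <- win M) (w n - w (n + 1)) +
  ((w M%:Z - w (M%:Z + 1)) + (w (Negz M) - w (Negz M + 1))).
  rewrite /win -addn1 iotaD !map_cat !big_cat /= !big_seq1 add0n.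
  by rewrite addrACA.
rewrite IH; have -> : Negz M = - M.+1%:Z by lia.
have -> : - M.+1%:Z + 1 = - M%:Z by lia.
have -> : M%:Z + 1 = M.+1%:Z by lia.
by rewrite addrA subrKA addrC subrKA.
Qed.

(** Meant for nonnegative families: summability through finite subsets, independent of any
    enumeration of the integers. *)
Definition sums_le x B := forall s, uniq s -> \sum_(n <- s) x n <= B.

Lemma sums_le_tail x B : (forall n, 0 <= x n) -> sums_le x B ->
  forall e, 0 < e -> exists M : nat, forall s, uniq s ->
    (forall n, n \in s -> n \notin win M) -> \sum_(n <- s) x n <= e.
Proof.
move=> x0 xB e e0.
pose E : set R := [set r | exists2 s, uniq s & r = \sum_(n <- s) x n]%classic.
have hE : has_sup E.
  split; first by exists 0, [::]; rewrite ?big_nil.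
  by exists B => _ [s us ->]; exact: xB.
have [_ [s0 us0 ->] hs0] := sup_adherent e0 hE.
have [M s0M] := seq_sub_win s0; exists M => s us sM.
have us' : uniq (s0 ++ s).
  rewrite cat_uniq us0 us andbT /=; apply/hasPn => n /sM; apply: contra.
  exact: s0M.
have : \sum_(n <- s0 ++ s) x n <= sup E.
  by apply: ub_le_sup; [exact: hE.2|exists (s0 ++ s)].
rewrite big_cat /=; lra.
Qed.

End integer_windows.

(** * Fourier coefficients and Bessel's equality *)

Section fourier.
Context {R : realType}.
Local Open Scope classical_set_scope.
Local Open Scope complex_scope.
Local Notation mu := (@lebesgue_measure R).
Implicit Types (f g h : R -> R[i]) (z : R[i]) (s : seq int) (n m : int).
Local Notation ZC n := (n%:~R : R[i]).

Definition fcoef f n : R[i] := (2 * pi)^-1%:C * hat f (- ZC n).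

Definition fsum f s (t : R) : R[i] := \sum_(n <- s) fcoef f n * ce (ZC n) t.

Lemma twopi_neq0 : 2 * pi != 0 :> R.
Proof. by rewrite gt_eqF// twopi_gt0. Qed.

Lemma hat_ce z w : z + w != 0 -> hat (ce z) w = (ce (z + w) (2 * pi) - 1) / ('i%C * (z + w)).
Proof.
move=> zw0.
have i0 : 'i%C != 0 :> R[i] by rewrite -normc_eq0 normc_i oner_eq0.
have a0 : 'i%C * (z + w) != 0 by rewrite mulf_neq0.
apply: (canRL (mulfK a0)); rewrite -cintegral_deriv_ce; last exact: ltW twopi_gt0.
rewrite cintegral_itvoo; last first.
  apply: cintegrableZ; first exact: measurable_per_itv.
  exact/square_integrable_cintegrable/square_integrable_ce.
rewrite -[X in _ = X]/(cintegral per_itv _) cintegralZ; last 2 first.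
- exact: measurable_per_itv.
- exact/square_integrable_cintegrable/square_integrable_ce.
rewrite mulrC; congr (_ * _); apply: eq_cintegral => t _.
by rewrite -ceDl addrC.
Qed.

Lemma hat_ce_int n m : hat (ce (ZC n)) (- ZC m) = if n == m then (2 * pi)%:C else 0.
Proof.
case: eqVneq => [->|nm].
  rewrite /hat (@eq_cintegral _ _ _ (fun=> 1)) => [|t _]; last first.
    by rewrite -ceDl addNr ce0l.
  rewrite /cintegral /=; congr (_ +i* _).
    rewrite Rintegral_cst ?mul1r; last exact: measurable_per_itv.
    by have -> : 2 * pi = fine (2 * pi : R)%:E by []; rewrite -lebesgue_per_itv.
  by rewrite Rintegral_cst ?mul0r//; exact: measurable_per_itv.
have nm0 : ZC n - ZC m != 0 by rewrite -intrB intr_eq0 subr_eq0.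
by rewrite hat_ce// -intrB ce_int_2pi subrr mul0r.
Qed.

Lemma square_integrable_fsum f s : square_integrable (fsum f s).
Proof.
apply: square_integrable_sum => n; apply: square_integrableZ.
exact: square_integrable_ce.
Qed.

Lemma hat_sum (I : Type) (s : seq I) (F : I -> R -> R[i]) z :
  (forall i, square_integrable (F i)) ->
  hat (fun t => \sum_(i <- s) F i t) z = \sum_(i <- s) hat (F i) z.
Proof.
move=> sF; elim: s => [|i s IH].
  rewrite big_nil /hat (@eq_cintegral _ _ _ (fun=> 0)) ?cintegral0// => t _.
  by rewrite big_nil mulr0.
rewrite big_cons -IH -hatD//; last exact: square_integrable_sum.
by apply: eq_cintegral => t _; rewrite big_cons.
Qed.

Lemma hat_fsum_notin f s n : n \notin s -> hat (fsum f s) (- ZC n) = 0.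
Proof.
move=> ns; rewrite hat_sum => [|m]; last exact/square_integrableZ/square_integrable_ce.
rewrite big_seq big1// => m ms; rewrite hatZ ?hat_ce_int; last exact: square_integrable_ce.
by case: eqP => [mn|_]; rewrite ?mulr0//; rewrite mn in ms; rewrite ms in ns.
Qed.

Lemma hat_fsum_in f s n : uniq s -> n \in s -> hat (fsum f s) (- ZC n) = hat f (- ZC n).
Proof.
move=> us ns; rewrite hat_sum => [|m]; last exact/square_integrableZ/square_integrable_ce.
rewrite (bigD1_seq n)//= hatZ ?hat_ce_int ?eqxx; last exact: square_integrable_ce.
rewrite big1 ?addr0; last first.
  move=> m mn; rewrite hatZ ?hat_ce_int; last exact: square_integrable_ce.
  by rewrite (negbTE mn) mulr0.
rewrite /fcoef mulrAC -rmorphM mulVf ?twopi_neq0// mul1r//.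
Qed.

(* One step of Gram-Schmidt. *)
Lemma sqnorm_sub_coef g n : square_integrable g ->
  sqnorm (fun t => g t - fcoef g n * ce (ZC n) t) =
  sqnorm g - (2 * pi)^-1 * normc (hat g (- ZC n)) ^+ 2.
Proof.
move=> sg; set a := fcoef g n.
have E t : normc (g t - a * ce (ZC n) t) ^+ 2 =
    normc (g t) ^+ 2 + (normc a ^+ 2 - 2 * complex.Re (a^* * (ce (- ZC n) t * g t))).
  have -> : ce (- ZC n) t = (ce (ZC n) t)^* by rewrite intr_complex ce_conj.
  have : normc (ce (ZC n) t) ^+ 2 = 1.
    by rewrite normc_ce intr_complex /= oppr0 mul0r expR0 expr1n.
  rewrite !sqr_normcE.
  case: (g t) a (ce _ t) => g1 g2 [a1 a2] [e1 e2] /= H.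
  transitivity (g1 ^+ 2 + g2 ^+ 2 + ((a1 ^+ 2 + a2 ^+ 2) * (e1 ^+ 2 + e2 ^+ 2)
    - 2 * (a1 * (e1 * g1 - - e2 * g2) - - a2 * (e1 * g2 + - e2 * g1)))).
    by ring.
  by rewrite H mulr1.
rewrite /sqnorm; under eq_Rintegral do rewrite E.
have mI := @measurable_per_itv R.
have [ir _] : cintegrable per_itv (fun t => a^* * (ce (- ZC n) t * g t)).
  by apply: cintegrableZ => //; exact: cintegrableM_ce.
have i2 : mu.-integrable per_itv
   (EFin \o (fun t => 2 * complex.Re (a^* * (ce (- ZC n) t * g t)))).
  exact: (integrableZl _ 2 ir).
have i1 : mu.-integrable per_itv (EFin \o (fun t : R => normc a ^+ 2)).
  exact: integrable_per_itv_cst.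
rewrite RintegralD//; [|exact: integrable_sqnormc|]; last first.
  by rewrite (_ : _ \o _ = (fun t => (normc a ^+ 2)%:E - (2 * complex.Re (a^* * (ce (- ZC n) t * g t)))%:E)%E)//; exact: integrableB.
rewrite RintegralB// Rintegral_cst// RintegralZl//.
have -> : \int[mu]_(t in per_itv) complex.Re (a^* * (ce (- ZC n) t * g t)) =
   complex.Re (a^* * hat g (- ZC n)).
  rewrite -cintegralZ//; exact: cintegrableM_ce.
have -> : fine (mu per_itv) = 2 * pi.
  by have -> : 2 * pi = fine (2 * pi : R)%:E by []; rewrite -lebesgue_per_itv.
congr (_ + _).
have -> : hat g (- ZC n) = (2 * pi)%:C * a.
  by rewrite /a /fcoef mulrA -rmorphM mulfV ?twopi_neq0// mul1r.
clearbody a; rewrite [normc (_ * a)]normcM normcR (ger0_norm (ltW twopi_gt0)).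
have -> : normc a ^+ 2 * (2 * pi) - 2 * complex.Re (a^* * ((2 * pi)%:C * a)) =
    - (2 * pi) * normc a ^+ 2.
  rewrite sqr_normcE; clear E ir i2 i1; case: a => a1 a2 /=; ring.
by move: (2 * pi) (@twopi_neq0) => p p0; field.
Qed.

(** Frequencies are removed one at a time: by orthogonality the current remainder still has the
    coefficient of [f] at the next frequency. *)
Lemma bessel_eq f s : square_integrable f -> uniq s ->
  sqnorm (fun t => f t - fsum f s t) =
  sqnorm f - (2 * pi)^-1 * \sum_(n <- s) normc (hat f (- ZC n)) ^+ 2.
Proof.
move=> sf; elim: s => [|n s IH] /= us.
  rewrite big_nil mulr0 subr0; congr (Rintegral _ _ _); apply/funext => t.
  by rewrite /fsum big_nil subr0.
have /andP[ns {}us] := us.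
have sr : square_integrable (fun t => f t - fsum f s t).
  by apply: square_integrableB => //; exact: square_integrable_fsum.
have hr : hat (fun t => f t - fsum f s t) (- ZC n) = hat f (- ZC n).
  have -> : (fun t => f t - fsum f s t) = (fun t => f t + -1 * fsum f s t).
    by apply/funext => t; rewrite mulN1r.
  have ss := square_integrable_fsum f s.
  rewrite hatD//; last exact: square_integrableZ.
  by rewrite hatZ// hat_fsum_notin// mulr0 addr0.
have := sqnorm_sub_coef n sr; rewrite IH// hr => H.
rewrite big_cons mulrDr opprD addrA addrAC -H; congr (Rintegral _ _ _).
apply/funext => t; rewrite /fsum big_cons /fcoef hr; congr (normc _ ^+ 2); ring.
Qed.

Lemma bessel_le f : square_integrable f ->
  sums_le (fun n => normc (hat f (- ZC n)) ^+ 2) (2 * pi * sqnorm f).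
Proof.
move=> sf s us; have := sqnorm_ge0 (fun t => f t - fsum f s t).
rewrite bessel_eq// subr_ge0 -(ler_pM2l twopi_gt0).
by rewrite mulrA mulfV ?twopi_neq0// mul1r.
Qed.

(** Bessel's equality is applied to the trigonometric polynomial [fsum f s2] itself, with [s1] and
    with [s2]; in the second case the remainder is 0. *)
Lemma sqnorm_fsum_sub f s1 s2 : square_integrable f -> uniq s1 -> uniq s2 ->
  {subset s1 <= s2} -> sqnorm (fun t => fsum f s2 t - fsum f s1 t) =
  (2 * pi)^-1 * \sum_(n <- s2 | n \notin s1) normc (hat f (- ZC n)) ^+ 2.
Proof.
move=> sf u1 u2 s12; have ss := square_integrable_fsum f s2.
have C s : {subset s <= s2} -> fsum (fsum f s2) s = fsum f s.
  move=> ss2; apply/funext => t; rewrite /fsum big_seq [RHS]big_seq.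
  by apply: eq_bigr => n ns; rewrite /fcoef hat_fsum_in// ss2.
have S s : {subset s <= s2} -> \sum_(n <- s) normc (hat (fsum f s2) (- ZC n)) ^+ 2
    = \sum_(n <- s) normc (hat f (- ZC n)) ^+ 2.
  move=> ss2; rewrite big_seq [RHS]big_seq.
  by apply: eq_bigr => n ns; rewrite hat_fsum_in// ss2.
have := bessel_eq ss u1; rewrite C// S// => ->.
have := bessel_eq ss u2; rewrite C// S//.
have -> : sqnorm (fun t => fsum f s2 t - fsum f s2 t) = 0.
  rewrite /sqnorm (@eq_Rintegral _ _ _ _ _ (fun=> 0)); last first.
    by move=> t _; rewrite subrr normc0 expr0n.
  by rewrite Rintegral_cst ?mul0r//; exact: measurable_per_itv.
move=> /eqP; rewrite eq_sym subr_eq0 => /eqP ->.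
by rewrite -mulrBr (big_split_sub _ u1 u2 s12) addrC addKr.
Qed.

Lemma riemann_lebesgue f : square_integrable f -> forall e : R, 0 < e ->
  exists M : nat, forall n, n \notin win M -> normc (hat f (- ZC n)) <= e.
Proof.
move=> sf e e0.
have [|M MP] := sums_le_tail _ (bessel_le sf) (exprn_gt0 2 e0).
  by move=> n; exact: sqr_ge0.
have e1 := ltW e0; exists M => n nM; rewrite -ler_sqr ?nnegrE ?normc_ge0//.
have := MP [:: n] isT; rewrite big_seq1; apply => m; rewrite inE => /eqP ->//.
Qed.

End fourier.

(** * Convergence of the Fourier series of an exponential *)

Section pointwise_convergence.
Context {R : realType}.
Local Open Scope classical_set_scope.
Local Open Scope complex_scope.
Local Notation mu := (@lebesgue_measure R).
Implicit Types (f g h : R -> R[i]) (z : R[i]) (s : seq int) (n m : int).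
Local Notation ZC n := (n%:~R : R[i]).

Lemma ler_dist_normc (v w : R[i]) : `|normc v - normc w| <= normc (v - w).
Proof.
rewrite ler_norml lerNl opprB !lerBlDr; apply/andP; split.
  by rewrite normc_distC -{1}(subrK v w) ler_normcD.
by rewrite -{1}(subrK w v) ler_normcD.
Qed.

Lemma measurable_inv : measurable_fun setT (fun x : R => x^-1).
Proof.
have -> : [set: R] = [set 0] `|` [set x | x != 0].
  by apply/seteqP; split => x //= _; have [->|x0] := eqVneq x 0; [left|right].
have o0 : open [set x : R | x != 0].
  have -> : [set x : R | x != 0] = ~` [set 0].
    by apply/seteqP; split => x /= /eqP.
  by rewrite openC; exact: closed_eq.
apply/measurable_funU; [exact: measurable_set1|exact: open_measurable|split].
  exact: measurable_fun_set1.
apply: open_continuous_measurable_fun => // x; rewrite inE /= => x0.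
exact: inv_continuous.
Qed.

Lemma cmeasurableV (D : set R) f : measurable D -> cmeasurable D f ->
  cmeasurable D (fun x => (f x)^-1).
Proof.
move=> mD [fr fi].
have mN : measurable_fun D (fun x => (complex.Re (f x) ^+ 2 + complex.Im (f x) ^+ 2)^-1).
  apply: (measurableT_comp measurable_inv).
  by apply: measurable_funD; exact: measurable_funX.
split.
- have -> : (fun x => complex.Re (f x)^-1) = (fun x => complex.Re (f x) *
      (complex.Re (f x) ^+ 2 + complex.Im (f x) ^+ 2)^-1).
    by apply/funext => x; case: (f x).
  exact: measurable_funM.
- have -> : (fun x => complex.Im (f x)^-1) = (fun x => (-1 * complex.Im (f x)) *
      (complex.Re (f x) ^+ 2 + complex.Im (f x) ^+ 2)^-1).
    by apply/funext => x; case: (f x) => a b /=; rewrite mulN1r mulNr.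
  apply: measurable_funM => //; apply: measurable_funM => //; exact: measurable_cst.
Qed.

Lemma normr_expR_sub1_le (a : R) : `|expR a - 1| <= `|a| * expR `|a|.
Proof.
have [a0|a0] := leP 0 a.
  have e1 : 1 <= expR a by rewrite -expR0 ler_expR.
  rewrite !ger0_norm ?subr_ge0//.
  have := expR_ge1Dx (- a); rewrite expRN => H.
  have : (1 - a) * expR a <= 1 by rewrite -ler_pdivlMr ?expR_gt0// mul1r.
  lra.
have e1 : expR a <= 1 by rewrite -expR0 ler_expR ltW.
rewrite ler0_norm ?subr_le0// (ltr0_norm a0).
have := expR_ge1Dx a => H.
apply: (@le_trans _ _ (- a)); first lra.
by apply: ler_peMr; rewrite ?oppr_ge0 ?(ltW a0)// -expR0 ler_expR oppr_ge0 ltW.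
Qed.

Lemma normc_ce_sub1_le z : exists2 B : R, 0 <= B &
  forall t : R, `|t| <= 2 * pi -> normc (ce z t - 1) <= B * `|t|.
Proof.
set y := complex.Im z; set x := complex.Re z.
have E0 := expR_ge0 (`|y| * (2 * pi)).
exists (expR (`|y| * (2 * pi)) * (`|y| + `|x|)).
  by rewrite mulr_ge0// addr_ge0.
move=> t t2.
have -> : ce z t - 1 = (expR (- y * t))%:C * (ce x%:C t - 1) + (expR (- y * t) - 1)%:C.
  by rewrite ce_real rmorphB /= /ce; ring.
have e1 : expR (- y * t) <= expR (`|y| * (2 * pi)).
  rewrite ler_expR (le_trans (ler_norm _))// normrM normrN ler_wpM2l//.
have e2 : expR `|- y * t| <= expR (`|y| * (2 * pi)).
  by rewrite ler_expR normrM normrN ler_wpM2l.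
rewrite (le_trans (ler_normcD _ _))// normcM !normcR ger0_norm ?expR_ge0//.
move: (expR (`|y| * (2 * pi))) E0 e1 e2 => A A0 e1 e2.
have -> : A * (`|y| + `|x|) * `|t| = A * (`|x| * `|t|) + (`|y| * `|t|) * A by ring.
apply: lerD.
  apply: ler_pM; rewrite ?expR_ge0 ?normc_ge0//.
  by rewrite (le_trans (normc_cis_sub1_le _ _))// normrM.
apply: le_trans (normr_expR_sub1_le _) _.
by rewrite ler_pM ?expR_ge0// normrM normrN.
Qed.

(* Chernoff's argument: [(f - f x) / (e^{it} - e^{ix})] is bounded, hence the
   partial sums of [f - f x] at [x] telescope to differences of its Fourier
   coefficients, which tend to 0. *)
Lemma fsum_ce_cvg z (x : R) : per_itv x -> forall e : R, 0 < e ->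
  exists M0 : nat, forall M, (M0 <= M)%N -> normc (fsum (ce z) (win M) x - ce z x) <= e.
Proof.
move=> xI e e0; have mI := @measurable_per_itv R.
have /andP[x0 x2] : 0 < x < 2 * pi by move: xI; rewrite /per_itv /= in_itv.
(* [2 * Y] is the larger distance from [x] to an end of the interval. It is below $2\pi$ because [x]
   is interior, so $e^{it}$ returns to $e^{ix}$ only at [t = x]. *)
pose Y := Num.max x (2 * pi - x) / 2.
have Ypi : Y < pi.
  rewrite /Y ltr_pdivrMr// [pi * 2]mulrC gt_max x2 /=.
  by rewrite ltrBlDr ltrDl.
have Y2 : 2 * Y = Num.max x (2 * pi - x) by rewrite /Y mulrC divfK.
have tY t : per_itv t -> `|t - x| <= 2 * Y /\ `|t - x| <= 2 * pi.
  rewrite /per_itv /= in_itv /= => /andP[t0 t2].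
  have H : `|t - x| <= Num.max x (2 * pi - x).
    rewrite ler_norml; apply/andP; split.
      by rewrite lerNl opprB le_max; apply/orP; left; rewrite gerBl ltW.
    by rewrite le_max; apply/orP; right; rewrite lerD2r ltW.
  split; first by rewrite Y2.
  by rewrite (le_trans H)// -Y2 ler_pM2l// ltW.
pose c := cos (Y / 2) ^+ 2.
have c0 : 0 < c.
  rewrite /c exprn_gt0//; apply: cos_gt0_pihalf.
  have Y0 : 0 < Y by rewrite /Y divr_gt0// lt_max x0.
  rewrite ltr_pM2r ?invr_gt0// Ypi andbT.
  by rewrite (@lt_trans _ _ 0)// ?oppr_lt0 divr_gt0 ?pi_gt0.
have ceB t (w : R[i]) : ce w t - ce w x = ce w x * (ce w (t - x) - 1).
  by rewrite mulrBr mulr1 -ceD; congr (ce w _ - _); ring.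
have one : 1 = (1 : R)%:C :> R[i] by [].
have den t : per_itv t -> c * `|t - x| <= normc (ce 1 t - ce 1 x).
  move=> tI; have [tY2 _] := tY t tI.
  have E : normc (ce (1 : R[i]) x) = 1 by rewrite normc_ce one /= oppr0 mul0r expR0.
  rewrite ceB normcM E mul1r.
  by have := @normc_cis_sub1_ge R Y 1 (t - x) Ypi; rewrite mul1r => /(_ tY2).
have [B B0 BP] := normc_ce_sub1_le z.
pose g t := (ce z t - ce z x) / (ce 1 t - ce 1 x).
(* At [t = x] the quotient is a division by zero, with value 0, and both sides vanish. *)
have gE t : per_itv t -> ce z t - ce z x = (ce 1 t - ce 1 x) * g t.
  move=> tI; rewrite /g mulrC; have [->|tx] := eqVneq t x.
    by rewrite !subrr mul0r mulr0.
  rewrite divfK// -normc_gt0 (lt_le_trans _ (den t tI))// mulr_gt0//.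
  by rewrite normr_gt0 subr_eq0.
have gM t : per_itv t -> normc (g t) <= normc (ce z x) * B / c.
  move=> tI; have [_ t2] := tY t tI.
  have [->|tx] := eqVneq t x.
    by rewrite /g subrr mul0r normc0; apply: divr_ge0 (ltW c0); rewrite mulr_ge0 ?normc_ge0.
  have tx0 : 0 < `|t - x| by rewrite normr_gt0 subr_eq0.
  rewrite /g normcM normcV ceB normcM -mulrA -[_ * B / c]mulrA.
  rewrite ler_wpM2l ?normc_ge0//.
  have d0 : 0 < normc (ce 1 t - ce 1 x) by rewrite (lt_le_trans _ (den t tI))// mulr_gt0.
  rewrite ler_pdivrMr// (le_trans (BP _ t2))//.
  by rewrite -mulrA ler_wpM2l// [c^-1 * _]mulrC ler_pdivlMr// mulrC den.
have mg : cmeasurable per_itv g.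
  apply: cmeasurableM.
    by apply: cmeasurableD; [exact: cmeasurable_ce|exact: cmeasurable_cst].
  apply: cmeasurableV => //.
  by apply: cmeasurableD; [exact: cmeasurable_ce|exact: cmeasurable_cst].
have sg : square_integrable g by exact: bounded_square_integrable mg gM.
pose w n : R[i] := (2 * pi)^-1%:C * hat g (1 - ZC n) * ce (ZC n) x.
have sce := square_integrable_ce z.
(* Multiplying [g] by $e^{it}$ shifts the index of its coefficients by one, whence the difference of
   consecutive [w]; the subtracted constant [ce z x] contributes at [n = 0] only. *)
have coefE n : fcoef (ce z) n * ce (ZC n) x =
    (w n - w (n + 1)) + (if n == 0 then ce z x else 0).
  have H : hat (fun t => ce z t + - ce z x * ce 0 t) (- ZC n) =
     hat g (1 - ZC n) - ce 1 x * hat g (- ZC n).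
    have -> : hat g (1 - ZC n) = hat (fun t => ce 1 t * g t) (- ZC n).
      by apply: eq_cintegral => t _; rewrite mulrA -ceDl addrC.
    have s1 : square_integrable (fun t => ce 1 t * g t) by exact: square_integrableM_ce.
    have -> : hat (fun t => ce 1 t * g t) (- ZC n) - ce 1 x * hat g (- ZC n) =
        hat (fun t => ce 1 t * g t + - ce 1 x * g t) (- ZC n).
      by rewrite hatD ?hatZ ?mulNr//; exact: square_integrableZ.
    apply: eq_cintegral => t /set_mem tI; congr (_ * _).
    by rewrite ce0l mulr1 gE// mulrBl mulNr.
  move: H; rewrite hatD//; last exact/square_integrableZ/square_integrable_ce.
  rewrite hatZ; last exact: square_integrable_ce.
  have -> : (0 : R[i]) = ZC 0 by [].
  rewrite hat_ce_int => /(canRL (addrK _)) H.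
  rewrite /fcoef H /w intrD.
  have -> : 1 - (ZC n + ZC 1) = - ZC n by rewrite opprD addrC subrK.
  rewrite ceDl eq_sym; case: eqVneq => [->|n0].
    rewrite mulr0z ce0l; have : (2 * pi)^-1%:C * (2 * pi)%:C = 1 :> R[i].
      by rewrite -rmorphM mulVf ?twopi_neq0.
    move: (2 * pi)^-1%:C (2 * pi)%:C => p q pq.
    transitivity (p * (hat g (1 - 0) - ce 1 x * hat g (- 0)) + (p * q) * ce z x); first by ring.
    by rewrite pq mul1r; ring.
  by rewrite mulr0; ring.
have [M0 HM] := riemann_lebesgue sg (mulr_gt0 (divr_gt0 e0 (ltr0Sn _ 1)) twopi_gt0).
have wle n : 1 - ZC n = - ZC (n - 1) by rewrite intrB opprB.
have wM n : n - 1 \notin win M0 -> normc (w n) <= e / 2.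
  move=> /HM H; rewrite /w wle normcM normcM normcR normc_ce cIm_int oppr0 mul0r expR0 mulr1.
  rewrite ger0_norm ?invr_ge0 ?(ltW twopi_gt0)// ler_pdivrMl ?twopi_gt0//.
  by rewrite [2 * pi * _]mulrC.
exists M0.+1 => M HM0.
have -> : fsum (ce z) (win M) x - ce z x = w (- M%:Z) - w M%:Z.
  rewrite /fsum; under eq_bigr do rewrite coefE.
  rewrite big_split /= sum_win_telescope -big_mkcond /= -big_filter.
  have -> : [seq n <- win M | n == 0] = [:: 0].
    have u1 : uniq [seq n <- win M | n == 0] by rewrite filter_uniq// uniq_win.
    apply: perm_small_eq => //; apply: uniq_perm => // n.
    by rewrite mem_filter inE; case: eqP => // ->; rewrite mem_win; lia.
  by rewrite big_seq1 addrK.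
rewrite (splitr e) (le_trans (ler_normcB _ _))// lerD// wM// mem_win; lia.
Qed.

(* Pointwise convergence and Fatou's lemma give convergence in L^2. *)
Lemma fsum_ce_sqnorm z : forall e : R, 0 < e -> exists M : nat,
  forall M', (M <= M')%N -> sqnorm (fun t => ce z t - fsum (ce z) (win M') t) <= e.
Proof.
move=> e e0; have sce := square_integrable_ce z.
have e20 : 0 < 2 * pi * e by rewrite mulr_gt0// twopi_gt0.
have [|M MP] := sums_le_tail _ (bessel_le sce) e20.
  by move=> n; exact: sqr_ge0.
exists M => N MN; have mI := @measurable_per_itv R.
have sN := square_integrable_fsum (ce z) (win N).
(* By Bessel these differences have square norm at most [e] for every [k], and their pointwise limit
   in [k] is the error to be estimated. *)
pose F (k : nat) t := (normc (fsum (ce z) (win (N + k)) t - fsum (ce z) (win N) t) ^+ 2)%:E.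
have sF k : square_integrable (fun t => fsum (ce z) (win (N + k)) t - fsum (ce z) (win N) t).
  by apply: square_integrableB => //; exact: square_integrable_fsum.
have FM k : (\int[mu]_(t in per_itv) F k t <= e%:E)%E.
  have H := @integrable_fin_num _ _ _ mu per_itv mI _ (integrable_sqnormc (sF k)).
  rewrite -(fineK H) lee_fin -[fine _]/(sqnorm _).
  rewrite sqnorm_fsum_sub ?uniq_win//; last by apply: win_sub; exact: leq_addr.
  rewrite ler_pdivrMl ?twopi_gt0// -big_filter; apply: MP.
    by rewrite filter_uniq// uniq_win.
  by move=> n; rewrite mem_filter => /andP[+ _]; apply: contra; exact: win_sub.
have mF k : measurable_fun per_itv (F k).
  by have /integrableP[] := integrable_sqnormc (sF k).
have F0 k t : per_itv t -> (0 <= F k t)%E by move=> _; rewrite lee_fin sqr_ge0.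
have := fatou mu mI mF F0.
have -> : (\int[mu]_(t in per_itv) limn_einf (F^~ t) =
   \int[mu]_(t in per_itv) (normc (ce z t - fsum (ce z) (win N) t) ^+ 2)%:E)%E.
  apply: eq_integral => t /set_mem tI.
  apply: (cvg_limn_einf_sup _).1; apply: cvg_EFin; first by near=> k.
  have c1 : (fun k => normc (fsum (ce z) (win (N + k)) t - fsum (ce z) (win N) t))
      @ \oo --> normc (ce z t - fsum (ce z) (win N) t).
    apply/cvgrPdist_le => d d0; have [K0 HK] := fsum_ce_cvg z tI d0.
    exists K0 => //= k K0k; apply: le_trans (ler_dist_normc _ _) _.
    rewrite opprB addrA subrK normc_distC; apply: HK.
    by rewrite (leq_trans K0k)// leq_addl.
  exact: (cvgM c1 c1).
move=> H.
have fN := @integrable_fin_num _ _ _ mu per_itv mI _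
  (integrable_sqnormc (square_integrableB sce sN)).
rewrite -lee_fin /sqnorm /Rintegral (fineK fN).
apply: (le_trans H); rewrite limn_einf_lim; apply: lime_le; first exact: is_cvg_einfs.
apply: nearW => k; apply: le_trans (FM k).
by apply: ereal_inf_lbound; exists k => /=.
Unshelve. all: by end_near.
Qed.

End pointwise_convergence.

(** * Series over the integers *)

Section complex_series.
Context {R : realType}.
Local Open Scope classical_set_scope.
Local Open Scope complex_scope.
Implicit Types (x y : int -> R[i]) (l a : R[i]) (s : seq int).

Definition complex_cvg (u : nat -> R[i]) l := forall e : R, 0 < e ->
  exists M0 : nat, forall M, (M0 <= M)%N -> normc (u M - l) <= e.

Lemma abs_series_cvg (r : nat -> R) (b : R) :
  (forall M, \sum_(0 <= k < M) `|r k| <= b) ->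
  exists l : R, forall e : R, 0 < e -> exists M0 : nat, forall M, (M0 <= M)%N ->
    `|\sum_(0 <= k < M) r k - l| <= e.
Proof.
move=> rb; have cn : cvgn (series (fun k => `|r k|)).
  apply: nondecreasing_is_cvgn.
    by apply: nondecreasing_series => n _ _.
  by exists b => _ [M _ <-]; exact: rb.
have /cvg_ex[l /cvgrPdist_le H] := normed_cvg cn.
exists l => e /H[M0 _ HM]; exists M0 => M M0M.
by rewrite distrC; exact: HM.
Qed.

Lemma abs_complex_series_cvg (c : nat -> R[i]) (b : R) :
  (forall M, \sum_(0 <= k < M) normc (c k) <= b) ->
  exists l, complex_cvg (fun M => \sum_(0 <= k < M) c k) l.
Proof.
move=> cb.
have [|p pP] := @abs_series_cvg (fun k => complex.Re (c k)) b.
  by move=> M; apply: le_trans (cb M); apply: ler_sum => k _; exact: normr_Re_le.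
have [|q qP] := @abs_series_cvg (fun k => complex.Im (c k)) b.
  by move=> M; apply: le_trans (cb M); apply: ler_sum => k _; exact: normr_Im_le.
exists (p +i* q) => e e0.
have [M1 H1] := pP _ (divr_gt0 e0 (ltr0Sn _ 1)).
have [M2 H2] := qP _ (divr_gt0 e0 (ltr0Sn _ 1)).
exists (maxn M1 M2) => M; rewrite geq_max => /andP[/H1 {}H1 /H2 {}H2].
rewrite (le_trans (normc_le_ReIm _))// (splitr e).
by rewrite cReD cImD cReN cImN cRe_sum cIm_sum; apply: lerD.
Qed.

Lemma complex_cvg_unique (u : nat -> R[i]) l a :
  complex_cvg u l -> complex_cvg u a -> l = a.
Proof.
move=> ul ua; apply/eqP; rewrite -subr_eq0 -normc_eq0; apply/eqP/le_anti.
rewrite normc_ge0 andbT; apply/ler_addgt0Pr => e e0; rewrite add0r.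
have [M1 H1] := ul _ (divr_gt0 e0 (ltr0Sn _ 1)).
have [M2 H2] := ua _ (divr_gt0 e0 (ltr0Sn _ 1)).
have := H1 _ (leq_maxl M1 M2); have := H2 _ (leq_maxr M1 M2).
set w := u _ => Ha Hl; have -> : l - a = (w - a) - (w - l) by ring.
by rewrite (splitr e) (le_trans (ler_normcB _ _))// lerD.
Qed.

Lemma complex_cvg_linear a (u v : nat -> R[i]) l l' :
  complex_cvg u l -> complex_cvg v l' ->
  complex_cvg (fun M => a * u M + v M) (a * l + l').
Proof.
move=> ul vl e e0.
have a0 : 0 < normc a + 1 by rewrite ltr_wpDl// normc_ge0.
have [M1 H1] := ul _ (divr_gt0 (divr_gt0 e0 (ltr0Sn _ 1)) a0).
have [M2 H2] := vl _ (divr_gt0 e0 (ltr0Sn _ 1)).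
exists (maxn M1 M2) => M; rewrite geq_max => /andP[/H1 {}H1 /H2 {}H2].
have -> : a * u M + v M - (a * l + l') = a * (u M - l) + (v M - l') by ring.
rewrite (splitr e) (le_trans (ler_normcD _ _))// lerD// normcM.
rewrite ler_pdivlMr// in H1; apply: le_trans _ H1.
by rewrite mulrC ler_wpM2l ?normc_ge0// lerDl.
Qed.

Lemma complex_cvg_cst l : complex_cvg (fun=> l) l.
Proof. by move=> e e0; exists 0%N => M _; rewrite subrr normc0 ltW. Qed.

Lemma complex_cvg_normc_le (u : nat -> R[i]) l (b : R) :
  complex_cvg u l -> (forall M, normc (u M) <= b) -> normc l <= b.
Proof.
move=> ul ub; apply/ler_addgt0Pr => e e0; have [M H] := ul e e0.
have -> : l = u M - (u M - l) by ring.
by rewrite (le_trans (ler_normcB _ _))// lerD// H.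
Qed.

(** Only the limit along the windows [win M] is required, the form in which the Fourier expansion
    arrives. *)
Definition is_csum x l := complex_cvg (fun M => \sum_(n <- win M) x n) l.

(** The default 0 stands for window sums without a limit. *)
Definition csum x : R[i] := xget 0 (is_csum x).

Lemma csumE x l : is_csum x l -> csum x = l.
Proof.
move=> xl; apply: (complex_cvg_unique _ xl).
exact: (@xgetPex _ 0 (is_csum x) (ex_intro _ l xl)).
Qed.

Lemma is_csum_linear a x y l l' : is_csum x l -> is_csum y l' ->
  is_csum (fun n => a * x n + y n) (a * l + l').
Proof.
move=> xl yl; rewrite /is_csum.
under eq_fun do rewrite big_split -mulr_sumr /=.
exact: complex_cvg_linear.
Qed.

Lemma is_csum0 : is_csum (fun=> 0) 0.
Proof.
rewrite /is_csum; under eq_fun do rewrite big1_eq; exact: complex_cvg_cst.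
Qed.

Lemma is_csumZ a x l : is_csum x l -> is_csum (fun n => a * x n) (a * l).
Proof.
move=> xl; have := is_csum_linear a xl is_csum0; rewrite addr0.
by under eq_fun do rewrite addr0.
Qed.

Lemma is_csumD x y l l' : is_csum x l -> is_csum y l' ->
  is_csum (fun n => x n + y n) (l + l').
Proof.
move=> xl yl; have := is_csum_linear 1 xl yl; rewrite mul1r.
by under eq_fun do rewrite mul1r.
Qed.

Lemma is_csum_sum (I : Type) (t : seq I) (F : I -> int -> R[i]) (l : I -> R[i]) :
  (forall i, is_csum (F i) (l i)) ->
  is_csum (fun n => \sum_(i <- t) F i n) (\sum_(i <- t) l i).
Proof.
move=> Fl; elim: t => [|i t IH].
  by rewrite big_nil; under eq_fun do rewrite big_nil; exact: is_csum0.
by rewrite big_cons; under eq_fun do rewrite big_cons; exact: is_csumD.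
Qed.

Lemma is_csum_finite s x : uniq s ->
  is_csum (fun n => if n \in s then x n else 0) (\sum_(n <- s) x n).
Proof.
move=> us e e0; have [M0 sM0] := seq_sub_win s; exists M0 => M M0M.
rewrite -big_mkcond/= (_ : \sum_(n <- win M | n \in s) x n = \sum_(n <- s) x n).
  by rewrite subrr normc0 ltW.
rewrite -big_filter; apply: perm_big; apply: uniq_perm; rewrite ?filter_uniq ?uniq_win//.
move=> n; rewrite mem_filter; case: (boolP (n \in s)) => // /sM0.
by move=> /(win_sub M0M) ->.
Qed.

Lemma sums_le_is_csum x (b : R) : sums_le (fun n => normc (x n)) b ->
  exists2 l, is_csum x l & normc l <= b.
Proof.
move=> xb.
have E (F : int -> R[i]) M : \sum_(n <- win M) F n = \sum_(0 <= k < M) (F (Posz k) + F (Negz k)).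
  by rewrite big_cat /= !big_map -big_split /index_iota subn0.
have E' (F : int -> R) M : \sum_(n <- win M) F n = \sum_(0 <= k < M) (F (Posz k) + F (Negz k)).
  by rewrite big_cat /= !big_map -big_split /index_iota subn0.
have [|l lP] := @abs_complex_series_cvg (fun k => x (Posz k) + x (Negz k)) b.
  move=> M; apply: le_trans (xb _ (uniq_win M)); rewrite E'.
  by apply: ler_sum => k _; exact: ler_normcD.
have xl : is_csum x l by rewrite /is_csum; under eq_fun do rewrite E.
exists l => //; apply: complex_cvg_normc_le xl _ => M.
exact: le_trans (ler_normc_sum _ _ _) (xb _ (uniq_win M)).
Qed.

Lemma sums_le_csum x (b : R) : sums_le (fun n => normc (x n)) b ->
  is_csum x (csum x) /\ normc (csum x) <= b.
Proof. by move=> /sums_le_is_csum[l xl lb]; rewrite (csumE xl). Qed.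

(** For the iterates of a map with contraction factor 1/2; the bound at stage [k] is the tail of the
    geometric series. *)
Lemma geometric_cvg (u : nat -> R[i]) : (forall k, normc (u k.+1 - u k) <= 2^-1 ^+ k) ->
  exists l, forall k, normc (u k - l) <= 2 * 2^-1 ^+ k.
Proof.
move=> uP.
have h0 : (2^-1 : R) != 0 by rewrite invr_neq0.
have gs (j n : nat) : \sum_(j <= k < n) (2^-1 : R) ^+ k <= 2 * 2^-1 ^+ j.
  have [jn|nj] := leqP j n; last first.
    by rewrite big_geq ?mulr_ge0 ?exprn_ge0 ?invr_ge0// ltnW.
  suff -> : \sum_(j <= k < n) (2^-1 : R) ^+ k = 2 * 2^-1 ^+ j - 2 * 2^-1 ^+ n.
    by rewrite gerBl mulr_ge0 ?exprn_ge0 ?invr_ge0.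
  rewrite -(subnKC jn); elim: (n - j)%N => [|d IH]; first by rewrite addn0 big_geq// subrr.
  by rewrite addnS big_nat_recr ?leq_addr//= IH exprS; field.
have tele (j n : nat) : (j <= n)%N -> u n - u j = \sum_(j <= k < n) (u k.+1 - u k).
  by move=> jn; rewrite telescope_sumr.
have [|l lP] := @abs_complex_series_cvg (fun k => u k.+1 - u k) 2.
  move=> M; apply: le_trans (ler_sum _ (fun k _ => uP k)) _.
  by rewrite (le_trans (gs 0%N M))// expr0 mulr1.
exists (u 0%N + l) => k; apply/ler_addgt0Pr => e e0.
have [M0 HM] := lP e e0.
have := HM _ (leq_maxl M0 k); set n := maxn M0 k.
rewrite -(tele 0%N n (leq0n _)) => H.
have -> : u k - (u 0%N + l) = - (u n - u k) + (u n - u 0%N - l) by ring.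
rewrite (le_trans (ler_normcD _ _))// lerD// normcN tele ?leq_maxr//.
rewrite (le_trans (ler_normc_sum _ _ _))// (le_trans (ler_sum _ (fun i _ => uP i)))//.
Qed.

End complex_series.

(** * Partial fractions of the characteristic function *)

Section partial_fractions.
Context {R : realType}.
Local Open Scope classical_set_scope.
Local Open Scope complex_scope.
Local Notation mu := (@lebesgue_measure R).
Local Notation ZC n := (n%:~R : R[i]).
Implicit Types (K : L2 R) (z : R[i]) (n : int).

(** These are the residues $k_n$. In the usual indexing this is the Fourier coefficient of [K] at
    frequency $-n$, the sign coming from the kernel $e^{izt}$ of [hat]. *)
Definition kappa K n : R[i] := (2 * pi)^-1%:C * hat K (ZC n).

Lemma ce_neq1_sub z n : ce z (2 * pi) != 1 -> z - ZC n != 0.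
Proof. by apply: contraNneq => /eqP; rewrite subr_eq0 => /eqP ->; rewrite ce_int_2pi. Qed.

Lemma kappa_sums_le K : exists B : R, sums_le (fun n => normc (kappa K n) ^+ 2) B.
Proof.
exists ((2 * pi)^-1 ^+ 2 * (2 * pi * sqnorm K)) => s us.
have := bessel_le (L2_square_integrable K) (s := [seq - n | n <- s]).
rewrite map_inj_uniq; last exact: oppr_inj.
move=> /(_ us); rewrite big_map => H.
rewrite (eq_bigr (fun n => (2 * pi)^-1 ^+ 2 * normc (hat K (- ZC (- n))) ^+ 2)); last first.
  move=> n _; rewrite /kappa normcM exprMn normcR ger0_norm; last first.
    by rewrite invr_ge0 ltW// twopi_gt0.
  by rewrite intrN opprK.
by rewrite -mulr_sumr ler_wpM2l// sqr_ge0.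
Qed.

(** The Fourier coefficients of $e^{izt}$ are $(e^{2\pi iz} - 1)/(2\pi i (z - n))$, and mean square
    convergence permits integrating its series against [K] term by term. *)
Lemma hat_sampling K z : ce z (2 * pi) != 1 ->
  is_csum (fun n => (ce z (2 * pi) - 1) / 'i%C * (kappa K n / (z - ZC n))) (hat K z).
Proof.
move=> z1 e e0; have sK := L2_square_integrable K.
have K0 := sqnorm_ge0 K; have K1 : 0 < sqnorm K + 1 by rewrite ltr_wpDl.
(* This weight makes the term with [sqnorm K] at most [e / 2]; the window is then taken large enough
   for the other half. Adding 1 keeps the weight positive when [K] is 0. *)
pose eta := 2 * (sqnorm K + 1) / e.
have eta0 : 0 < eta by rewrite divr_gt0// mulr_gt0.
have [M0 HM] := fsum_ce_sqnorm z (divr_gt0 e0 (mulr_gt0 (ltr0Sn _ 1) eta0)).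
exists M0 => M /HM H.
have sf := square_integrable_fsum (ce z) (win M).
have sB : square_integrable (fun t => ce z t - fsum (ce z) (win M) t).
  by apply: square_integrableB => //; exact: square_integrable_ce.
have -> : \sum_(n <- win M) (ce z (2 * pi) - 1) / 'i%C * (kappa K n / (z - ZC n)) =
    cintegral per_itv (fun t => fsum (ce z) (win M) t * K t).
  have -> : (fun t => fsum (ce z) (win M) t * K t) =
      (fun t => \sum_(n <- win M) fcoef (ce z) n * (ce (ZC n) t * K t)).
    by apply/funext => t; rewrite /fsum mulr_suml; apply: eq_bigr => n _; rewrite mulrA.
  rewrite cintegral_sum; [|exact: measurable_per_itv|].
    apply: eq_bigr => n _; rewrite cintegralZ; [|exact: measurable_per_itv|exact: cintegrableM_ce].
    rewrite -[cintegral _ _]/(hat K (ZC n)) /fcoef hat_ce; last exact: ce_neq1_sub.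
    have -> : ce (z - ZC n) (2 * pi) = ce z (2 * pi) by rewrite -intrN ce_shift_2pi.
    by rewrite /kappa [(_ * (z - _))^-1]invfM; move: ((2 * pi)^-1%:C : R[i]) => p; ring.
  by move=> n; apply: cintegrableZ; [exact: measurable_per_itv|exact: cintegrableM_ce].
rewrite normc_distC.
have -> : hat K z - cintegral per_itv (fun t => fsum (ce z) (win M) t * K t) =
    cintegral per_itv (fun t => (ce z t - fsum (ce z) (win M) t) * K t).
  rewrite /hat -cintegralB; [|exact: measurable_per_itv|exact: cintegrableM_ce|].
    by apply: eq_cintegral => t _; rewrite mulrBl.
  exact: square_integrableM_cintegrable.
apply: le_trans (normc_cintegralM_le eta0 sB sK) _.
rewrite (splitr e) lerD//.
  by rewrite mulrC -ler_pdivlMr// (le_trans H)// invfM mulrA.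
rewrite /eta invf_div mulrC mulrA ler_pdivrMr ?mulr_gt0//.
have : 0 <= e by exact: ltW.
move: K0; nra.
Qed.

Lemma Delta_partial_fractions K z : ce z (2 * pi) != 1 ->
  exists2 l, is_csum (fun n => kappa K n / (z - ZC n)) l &
    Delta K z = (1 - ce z (2 * pi)) * (1 - l).
Proof.
move=> z1; have i0 : 'i%C != 0 :> R[i] by rewrite -normc_eq0 normc_i oner_eq0.
have z10 : ce z (2 * pi) - 1 != 0 by rewrite subr_eq0.
pose a := (ce z (2 * pi) - 1) / 'i%C; have a0 : a != 0 by rewrite mulf_neq0// invr_neq0.
exists (a^-1 * hat K z).
  have := is_csumZ a^-1 (hat_sampling K z1).
  by under eq_fun do rewrite mulrA mulVf// mul1r.
have hz : hat K z = a * (a^-1 * hat K z) by rewrite mulrA mulfV// mul1r.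
rewrite /Delta [X in _ + 'i%C * X = _]hz; move: (a^-1 * _) => l.
have -> : 'i%C * (a * l) = (ce z (2 * pi) - 1) * l by rewrite /a; field.
by ring.
Qed.

End partial_fractions.

(** * Factorization of $F$ by a contraction *)

Section factorization.
Context {R : realType}.
Local Open Scope complex_scope.
Local Notation ZC n := (n%:~R : R[i]).
Implicit Types (z l : R[i]) (n m : int) (x y : int -> R[i]).
Variables (kap : int -> R[i]) (s : seq int) (Om : R[i] -> Prop).
Hypothesis us : uniq s.
Hypothesis sOm : forall n, n \in s -> Om (ZC n).
Hypothesis small_out : forall z, Om z ->
  sums_le (fun m => if m \in s then 0 else normc (kap m) / normc (z - ZC m)) (8^-1).
Hypothesis small_in : forall m, m \notin s ->
  \sum_(n <- s) normc (kap n) / normc (ZC m - ZC n) <= 8^-1.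

Let qtr : R := 4^-1.

Lemma normc_ge_1sub w : normc w <= qtr -> 3 / 4 <= normc (1 + w) /\ 3 / 4 <= normc (1 - w).
Proof.
move=> wq; have := lerB_normc (1 : R[i]) w; have := lerB_normc (1 : R[i]) (- w).
rewrite normcN normc1; move: wq; rewrite /qtr; lra.
Qed.

Lemma div_1add_le w k : normc w <= qtr ->
  normc (k / (1 + w)) <= 4 / 3 * normc k /\ normc (k / (1 - w)) <= 4 / 3 * normc k.
Proof.
move=> /normc_ge_1sub[h1 h2]; rewrite !normcM !normcV.
have a1 : 0 < normc (1 + w) by lra.
have a2 : 0 < normc (1 - w) by lra.
have k0 := normc_ge0 k.
by split; rewrite ler_pdivrMr//; nra.
Qed.

(** The common denominator [(1 - w) * (1 - w')] has modulus at least $(3/4)^2 = 9/16$. *)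
Lemma div_1sub_lipschitz k w w' : normc w <= qtr -> normc w' <= qtr ->
  normc (k / (1 - w) - k / (1 - w')) <= 16 / 9 * (normc k * normc (w - w')).
Proof.
move=> /normc_ge_1sub[_ h1] /normc_ge_1sub[_ h2].
have a1 : 0 < normc (1 - w) by lra.
have a2 : 0 < normc (1 - w') by lra.
have n1 : 1 - w != 0 by rewrite -normc_gt0.
have n2 : 1 - w' != 0 by rewrite -normc_gt0.
have -> : k / (1 - w) - k / (1 - w') = k * (w - w') / ((1 - w) * (1 - w')).
  by field; rewrite n1 n2.
rewrite normcM normcV !normcM ler_pdivrMr ?mulr_gt0//.
have P0 : 0 <= normc k * normc (w - w') by rewrite mulr_ge0 ?normc_ge0.
have P1 : 9 / 16 <= normc (1 - w) * normc (1 - w') by nra.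
nra.
Qed.

(** The unknown [x n] is $-u(n)$ for [n] in [s]. Then $a_n = k_n/(1 - x_n)$, [rfun x] is $r$,
    [ufun x] lists the $u_m$ and [U x] is $u$, so that the system closes up as the fixed point
    condition [x n = - U x (ZC n)]. *)
Let rfun x z := \sum_(n <- s) kap n / (1 - x n) / (z - ZC n).
Let ufun x m := if m \in s then 0 else - (kap m / (1 - rfun x (ZC m))).
Let U x z := csum (fun m => ufun x m / (z - ZC m)).
Let ball x := forall n, n \in s -> normc (x n) <= qtr.

Lemma rfun_le x m : ball x -> m \notin s -> normc (rfun x (ZC m)) <= qtr.
Proof.
move=> bx ms; apply: (@le_trans _ _ (4 / 3 * 8^-1)); last by rewrite /qtr; lra.
apply: (@le_trans _ _ (4 / 3 * \sum_(n <- s) normc (kap n) / normc (ZC m - ZC n))); last first.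
  by rewrite ler_wpM2l ?small_in// divr_ge0.
rewrite /rfun big_seq (le_trans (ler_normc_sum _ _ _))// mulr_sumr [leRHS]big_seq.
apply: ler_sum => n ns; rewrite normcM normcV mulrA ler_wpM2r ?invr_ge0 ?normc_ge0//.
by have [_] := div_1add_le (kap n) (bx n ns).
Qed.

Lemma rfun_lipschitz x y m (d : R) : ball x -> ball y -> m \notin s ->
  (forall n, n \in s -> normc (x n - y n) <= d) -> 0 <= d ->
  normc (rfun x (ZC m) - rfun y (ZC m)) <= 2 / 9 * d.
Proof.
move=> bx bY ms xy d0; apply: (@le_trans _ _ (16 / 9 * d * 8^-1)); last by lra.
apply: (@le_trans _ _ (16 / 9 * d * \sum_(n <- s) normc (kap n) / normc (ZC m - ZC n))); last first.
  by rewrite ler_wpM2l ?small_in// mulr_ge0.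
rewrite /rfun -sumrB big_seq (le_trans (ler_normc_sum _ _ _))// mulr_sumr [leRHS]big_seq.
apply: ler_sum => n ns; rewrite -mulrBl normcM normcV mulrA ler_wpM2r ?invr_ge0 ?normc_ge0//.
apply: le_trans (div_1sub_lipschitz (kap n) (bx n ns) (bY n ns)) _.
by rewrite -[leRHS]mulrA ler_wpM2l// mulrC ler_wpM2r ?normc_ge0// xy.
Qed.

Lemma sums_le_scale (f g : int -> R) (a b : R) : 0 <= a -> (forall n, f n <= a * g n) ->
  sums_le g b -> sums_le f (a * b).
Proof.
move=> a0 fg gb t ut; apply: le_trans (ler_sum _ (fun n _ => fg n)) _.
by rewrite -mulr_sumr ler_wpM2l ?gb.
Qed.

Lemma U_sum x z : ball x -> Om z ->
  is_csum (fun m => ufun x m / (z - ZC m)) (U x z) /\ normc (U x z) <= 6^-1.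
Proof.
move=> bx Oz; have H : sums_le (fun m => normc (ufun x m / (z - ZC m))) (4 / 3 * 8^-1).
  apply: sums_le_scale (small_out Oz) => // m; rewrite /ufun.
  case: ifPn => ms; first by rewrite mul0r normc0 mulr0.
  rewrite normcM normcN normcV mulrA ler_wpM2r ?invr_ge0 ?normc_ge0//.
  by have [_] := div_1add_le (kap m) (rfun_le bx ms).
have [H1 H2] := sums_le_csum H; split => //; apply: (le_trans H2); lra.
Qed.

(** The Lipschitz bounds of [ufun] in [rfun] and of [rfun] in [x] combine to $16/9 \cdot 2/9 \cdot
    1/8 = 4/81$; the factor 1/2 is kept to match [geometric_cvg]. *)
Lemma U_lipschitz x y z (d : R) : ball x -> ball y -> Om z ->
  (forall n, n \in s -> normc (x n - y n) <= d) -> 0 <= d ->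
  normc (U x z - U y z) <= 2^-1 * d.
Proof.
move=> bx bY Oz xy d0.
have [Ux _] := U_sum bx Oz; have [Uy _] := U_sum bY Oz.
have D := is_csumD Ux (is_csumZ (-1) Uy); rewrite mulN1r in D.
have H : sums_le (fun m => normc (ufun x m / (z - ZC m) + -1 * (ufun y m / (z - ZC m))))
    (16 / 9 * (2 / 9 * d) * 8^-1).
  apply: sums_le_scale (small_out Oz) => [|m]; first by rewrite mulr_ge0// mulr_ge0.
  rewrite /ufun; case: ifPn => ms; first by rewrite mul0r mulr0 addr0 normc0 mulr0.
  rewrite mulN1r -mulrBl normcM normcV [leRHS]mulrA ler_wpM2r ?invr_ge0 ?normc_ge0//.
  rewrite -opprD normcN.
  apply: le_trans (div_1sub_lipschitz (kap m) (rfun_le bx ms) (rfun_le bY ms)) _.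
  rewrite -[leRHS]mulrA ler_wpM2l// mulrC ler_wpM2r ?normc_ge0//.
  exact: rfun_lipschitz.
have [l Dl lle] := sums_le_is_csum H.
by rewrite (complex_cvg_unique D Dl) (le_trans lle)//; lra.
Qed.

(** The value 0 outside [s] lets the iterates converge at every integer. *)
Let T x n := if n \in s then - U x (ZC n) else 0.

(** [T] maps the ball into itself because $1/6 \le 1/4$, and it at least halves distances; the
    iteration starts at 0. *)
Lemma fixed_point : exists2 x, ball x & forall n, n \in s -> x n = - U x (ZC n).
Proof.
pose u k := iter k T (fun=> 0).
have bu k : ball (u k).
  elim: k => [|k IH] n ns; first by rewrite -[u 0%N n]/(0 : R[i]) normc0 /qtr invr_ge0.
  rewrite -[u k.+1]/(T (u k)) /T ns normcN; have [_ H] := U_sum IH (sOm ns).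
  by rewrite (le_trans H)// /qtr; lra.
have ud k n : normc (u k.+1 n - u k n) <= 2^-1 ^+ k.
  elim: k n => [|k IH] n.
    rewrite -[u 0%N n]/(0 : R[i]) -[u 1%N]/(T (u 0%N)) subr0 expr0 /T.
    case: ifP => ns; last by rewrite normc0.
    by rewrite normcN; have [_ H] := U_sum (bu 0%N) (sOm ns); rewrite (le_trans H)//; lra.
  rewrite -[u k.+2 n]/(T (u k.+1) n) -[u k.+1 n]/(T (u k) n) /T.
  case: ifP => ns; last by rewrite subrr normc0 exprn_ge0// invr_ge0.
  rewrite -opprD normcN exprS; apply: U_lipschitz => //; exact: sOm.
have /boolp.choice[x xP] : forall n, exists l, forall k, normc (u k n - l) <= 2 * 2^-1 ^+ k.
  by move=> n; apply: geometric_cvg => k; exact: ud.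
have small (e : R) : 0 < e -> exists k, 2 * 2^-1 ^+ k <= e.
  move=> e0; pose k := (Num.trunc (2 / e)).+1; exists k.
  have ke : 2 / e <= k%:R by rewrite ltW// truncnS_gt.
  have k2 : k%:R <= 2 ^+ k :> R by rewrite -natrX ler_nat ltnW// ltn_expl.
  rewrite exprVn ler_pdivrMr ?exprn_gt0// mulrC -ler_pdivrMr//; exact: le_trans ke k2.
have bx : ball x.
  move=> n ns; apply/ler_addgt0Pr => e /small[k ke].
  have -> : x n = u k n - (u k n - x n) by ring.
  by rewrite (le_trans (ler_normcB _ _))// lerD ?bu// (le_trans (xP n k)).
exists x => // n ns; apply/eqP; rewrite -subr_eq0 -normc_eq0; apply/eqP/le_anti.
rewrite normc_ge0 andbT; apply/ler_addgt0Pr => e e0; rewrite add0r.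
have [k ke] := small _ (divr_gt0 e0 (ltr0Sn _ 1)).
have -> : x n - - U x (ZC n) = (U x (ZC n) - U (u k) (ZC n)) - (u k.+1 n - x n).
  by rewrite -[u k.+1 n]/(T (u k) n) /T ns; ring.
rewrite (splitr e) (le_trans (ler_normcB _ _))// lerD//.
  have h0 : 0 <= 2 * 2^-1 ^+ k :> R by rewrite mulr_ge0// exprn_ge0// invr_ge0.
  apply: le_trans (U_lipschitz bx (bu k) (sOm ns) (d := 2 * 2^-1 ^+ k) _ h0) _.
    by move=> j _; rewrite normc_distC.
  by move: h0 ke; lra.
apply: le_trans (xP n k.+1) _; rewrite exprS mulrCA.
have : 0 <= 2 * 2^-1 ^+ k :> R by rewrite mulr_ge0// exprn_ge0// invr_ge0.
move: ke; lra.
Qed.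

(** With infinitely many poles, residues are not compared directly: the identity is checked for each
    [m] with the finite sum over [s] inside, and then summed by linearity of [is_csum]. *)
Lemma partial_fraction_factor : exists (a : int -> R[i]) (V : R[i] -> R[i]),
  [/\ forall n, n \in s -> normc (a n) <= 4 / 3 * normc (kap n),
      forall z, Om z -> normc (V z) <= 6^-1 &
      forall z l, Om z -> (forall n, z - ZC n != 0) ->
        is_csum (fun n => kap n / (z - ZC n)) l ->
        1 - l = (1 - \sum_(n <- s) a n / (z - ZC n)) * (1 + V z)].
Proof.
have [x bx xE] := fixed_point.
pose a n := kap n / (1 - x n); exists a, (U x); split.
- by move=> n ns; have [] := div_1add_le (kap n) (bx n ns).
- by move=> z Oz; have [] := U_sum bx Oz.
move=> z l Oz z0 kl; have [Uz _] := U_sum bx Oz.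
(* For [m] outside [s], [G m] equals [kap m / (z - ZC m)]: the bracket is $u_m (z - n)/((z - m)(m -
   n))$, so the sum over [n] produces [rfun x (ZC m)]. For [m] in [s] it is 0. In this form the sum
   over [m] involves only [U] at [z] and at the points of [s]. *)
pose G m := - 1 * (ufun x m / (z - ZC m)) + \sum_(n <- s) a n / (z - ZC n) *
   (ufun x m / (z - ZC m) + - 1 * (if n \in s then ufun x m / (ZC n - ZC m) else 0)).
have csG : is_csum G (- 1 * U x z + \sum_(n <- s) a n / (z - ZC n) *
    (U x z + - 1 * (if n \in s then U x (ZC n) else 0))).
  apply: is_csum_linear => //; apply: is_csum_sum => n; apply: is_csumZ.
  apply: is_csumD => //; apply: is_csumZ; case: ifPn => ns; last exact: is_csum0.
  by have [] := U_sum bx (sOm ns).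
have kE m : kap m / (z - ZC m) = (if m \in s then kap m / (z - ZC m) else 0) + G m.
  rewrite /G /ufun; case: ifPn => ms.
    rewrite !mul0r mulr0 add0r big1 ?addr0// => n _.
    by rewrite mul0r if_same mulr0 addr0 mulr0.
  rewrite add0r; have [_ h1] := normc_ge_1sub (rfun_le bx ms).
  have r0 : 1 - rfun x (ZC m) != 0 by rewrite -normc_gt0; lra.
  set v := - (kap m / (1 - rfun x (ZC m))).
  have vE : kap m = - v * (1 - rfun x (ZC m)) by rewrite /v opprK divfK.
  rewrite big_seq (eq_bigr (fun n => v / (z - ZC m) * (a n / (ZC m - ZC n)))) => [|n ns].
    rewrite -big_seq -mulr_sumr -[\sum_(i <- s) _]/(rfun x (ZC m)) {1}vE; ring.
  rewrite ns; have mn : ZC m - ZC n != 0.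
    rewrite -intrB intr_eq0 subr_eq0; apply: contraNneq ms => ->; exact: ns.
  have -> : ZC n - ZC m = - (ZC m - ZC n) by rewrite opprB.
  have -> : ZC n = ZC m - (ZC m - ZC n) by ring.
  have := z0 n; have -> : z - ZC n = (z - ZC m) + (ZC m - ZC n) by ring.
  have := z0 m; move: mn; set p := ZC m - ZC n; set q := z - ZC m => p0 q0 pq0.
  have -> : z - (ZC m - p) = q + p by rewrite /q; ring.
  have -> : ZC m - (ZC m - p) = p by ring.
  by field; rewrite p0 q0 pq0.
have : is_csum (fun n => kap n / (z - ZC n)) (\sum_(n <- s) kap n / (z - ZC n) +
   (- 1 * U x z + \sum_(n <- s) a n / (z - ZC n) *
    (U x z + - 1 * (if n \in s then U x (ZC n) else 0)))).
  by under eq_fun do rewrite kE; apply: is_csumD => //; exact: is_csum_finite.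
move=> /(complex_cvg_unique kl) ->.
have -> : \sum_(n <- s) a n / (z - ZC n) * (U x z + - 1 * (if n \in s then U x (ZC n) else 0))
   = \sum_(n <- s) a n / (z - ZC n) * (1 + U x z) - \sum_(n <- s) kap n / (z - ZC n).
  rewrite -sumrB big_seq [RHS]big_seq; apply: eq_bigr => n ns; rewrite ns.
  have -> : U x (ZC n) = - x n by rewrite xE// opprK.
  have [_ h1] := normc_ge_1sub (bx n ns).
  have x1 : 1 - x n != 0 by rewrite -normc_gt0; lra.
  have -> : kap n = a n * (1 - x n) by rewrite /a divfK.
  ring.
rewrite -mulr_suml; ring.
Qed.

End factorization.

(** * Calculus of orders along a ray *)

Section order_calculus.
Context {R : realType}.
Local Open Scope complex_scope.
Local Notation ZC n := (n%:~R : R[i]).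
Implicit Types (F G : R[i] -> R[i]) (l z : R[i]) (m n : nat).

Lemma has_order_bounded F l (c M d : R) : 0 < c -> 0 < d ->
  (forall s : R, 0 < s -> s < d -> c <= normc (F (l + s%:C)) <= M) -> has_order F l 0.
Proof.
move=> c0 d0 H; exists c, M, d; split => // s s0 sd.
by rewrite expr0 !mulr1 H.
Qed.

Lemma has_order_lipschitz F l (L : R) :
  (forall s : R, 0 < s -> normc (F (l + s%:C) - F l) <= L * s) -> F l != 0 ->
  has_order F l 0.
Proof.
move=> FL Fl0; have D0 : 0 < normc (F l) by rewrite normc_gt0.
have L0 : 0 < `|L| + 1 by rewrite ltr_wpDl.
apply: (@has_order_bounded F l (normc (F l) / 2) (2 * normc (F l))
   (normc (F l) / 2 / (`|L| + 1))); rewrite ?divr_gt0// => s s0.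
rewrite ltr_pdivlMr// => sd.
have H : normc (F (l + s%:C) - F l) <= normc (F l) / 2.
  apply: le_trans (FL s s0) _; apply: le_trans _ (ltW sd); rewrite mulrC.
  by rewrite ler_wpM2l ?(ltW s0)// (le_trans (ler_norm _))// lerDl.
have h1 := ler_dist_normc (F (l + s%:C)) (F l).
move: (le_trans h1 H); rewrite ler_norml; lra.
Qed.

Lemma has_orderM F G l m n : has_order F l m -> has_order G l n ->
  has_order (fun z => F z * G z) l (m + n).
Proof.
move=> [c [M [d [c0 d0 H]]]] [c' [M' [d' [c'0 d'0 H']]]].
exists (c * c'), (M * M'), (Num.min d d'); split; rewrite ?mulr_gt0 ?lt_min ?d0// => s s0.
rewrite lt_min => /andP[sd sd'].
have /andP[a1 a2] := H s s0 sd; have /andP[b1 b2] := H' s s0 sd'.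
have p (k : nat) : 0 <= s ^+ k by rewrite exprn_ge0// ltW.
rewrite normcM exprD !(mulrACA _ _ (s ^+ m)).
by rewrite !ler_pM ?mulr_ge0 ?normc_ge0 ?(ltW c0) ?(ltW c'0).
Qed.

(** [G] may vanish at [l], so the equation is asked for only at [l + s] with small [s > 0], where
    the two-sided bounds can be divided. *)
Lemma has_order_cancel F G H l m n (d : R) : 0 < d ->
  (forall s : R, 0 < s -> s < d -> F (l + s%:C) * G (l + s%:C) = H (l + s%:C)) ->
  has_order G l n -> has_order H l (m + n) -> has_order F l m.
Proof.
move=> d0 FG [c [M [e [c0 e0 HG]]]] [c' [M' [e' [c'0 e'0 HH]]]].
have M0 : 0 < `|M| + 1 by rewrite ltr_wpDl.
exists (c' / (`|M| + 1)), (M' / c), (Num.min d (Num.min e e')); split.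
- by rewrite divr_gt0.
- by rewrite !lt_min d0 e0.
move=> s s0; rewrite !lt_min => /and3P[sd se se'].
have /andP[a1 a2] := HG s s0 se; have := HH s s0 se'.
rewrite -FG// normcM exprD => /andP[b1 b2].
have pm : 0 < s ^+ m by rewrite exprn_gt0.
have pn : 0 < s ^+ n by rewrite exprn_gt0.
move: a1 a2 b1 b2 (normc_ge0 (F (l + s%:C))) (normc_ge0 (G (l + s%:C))).
move: (s ^+ m) (s ^+ n) (normc _) (normc _) pm pn => p q f g p0 q0 a1 a2 b1 b2 f0 g0.
have a3 : g <= (`|M| + 1) * q.
  by rewrite (le_trans a2)// ler_wpM2r ?(ltW q0)// (le_trans (ler_norm _))// lerDl.
apply/andP; split.
  rewrite mulrAC ler_pdivrMr// -(ler_pM2r q0) -!mulrA (mulrA c').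
  rewrite mulrA in b1; rewrite -mulrA; apply: le_trans _ (le_trans b1 _).
    by rewrite -mulrA.
  by rewrite ler_wpM2l.
rewrite mulrAC ler_pdivlMr// -(ler_pM2r q0).
apply: le_trans _ (le_trans b2 _); last by rewrite mulrA.
by rewrite -mulrA ler_wpM2l.
Qed.

(** The boolean [l == c] serves as the exponent 0 or 1. *)
Lemma has_order_XsubC l (c : R[i]) : has_order (fun z => z - c) l (l == c).
Proof.
case: eqVneq => [->|lc] /=.
  exists 1, 1, 1; split => // s s0 _.
  by rewrite addrC addKr expr1 mul1r normcR gtr0_norm// lexx.
apply: (@has_order_lipschitz _ _ 1) => [s s0|]; last by rewrite subr_eq0.
have -> : l + s%:C - c - (l - c) = s%:C by ring.
by rewrite normcR gtr0_norm// mul1r.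
Qed.

Lemma has_order_prod l (rs : seq R[i]) :
  has_order (fun z => \prod_(c <- rs) (z - c)) l (count_mem l rs).
Proof.
elim: rs => [|c rs IH] /=.
  exists 1, 1, 1; split => // s _ _.
  by rewrite big_nil normc1 expr0 mulr1 lexx.
under eq_fun do rewrite big_cons; rewrite eq_sym.
by apply: has_orderM => //; exact: has_order_XsubC.
Qed.

Lemma nearest_int (x : R) : exists n : int, `|x - n%:~R| <= 2^-1.
Proof.
exists (Num.floor (x + 2^-1)); have := floor_itv (x + 2^-1).
rewrite intrD ler_norml => /andP[]; lra.
Qed.

Lemma cos_pi4_gt0 : 0 < cos (pi / 2 / 2) ^+ 2 :> R.
Proof.
rewrite exprn_gt0//; apply: cos_gt0_pihalf.
have p0 : 0 < pi / 2 :> R by rewrite divr_gt0// pi_gt0.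
by move: (pi / 2) p0 => p p0; lra.
Qed.

(** The angle $2\pi t$ has modulus at most $\pi$, so the chord estimate applies with $Y = \pi/2$;
    the constants 2 and 8 are crude bounds for $2\pi$. *)
Lemma normc_ce_2pi_sub1 (t : R) : `|t| <= 2^-1 ->
  cos (pi / 2 / 2) ^+ 2 * (2 * `|t|) <= normc (ce t%:C (2 * pi) - 1) <= 8 * `|t|.
Proof.
move=> t2; have p2 := pi_ge2 R; have p4 := pihalf_lt2 R.
have p0 := pi_gt0 R; have c0 := ltW cos_pi4_gt0.
have E : `|t * (2 * pi)| = 2 * pi * `|t|.
  by rewrite normrM mulrC [`|2 * pi|]ger0_norm// ltW// mulr_gt0.
apply/andP; split.
  apply: (@le_trans _ _ (cos (pi / 2 / 2) ^+ 2 * `|t * (2 * pi)|)).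
    rewrite ler_wpM2l// E ler_wpM2r//.
    by move: (pi : R) p2 => p; lra.
  apply: normc_cis_sub1_ge; last rewrite E.
    by move: (pi : R) p0 => p; lra.
  by have := normr_ge0 t; move: `|t| (pi : R) t2 p0 => a p; nra.
apply: le_trans (normc_cis_sub1_le _ _) _; rewrite E.
by have := normr_ge0 t; move: `|t| (pi : R) t2 p0 p4 => a p; nra.
Qed.

(** The modulus forces [l] to be real; once the nearest integer is subtracted, the lower chord
    estimate leaves no remainder. *)
Lemma ce_2pi_eq1 l : ce l (2 * pi) = 1 -> exists n : int, l = ZC n.
Proof.
move=> H; have [n nP] := nearest_int (complex.Re l).
have I0 : complex.Im l = 0.
  have /(congr1 (@normc R)) := H; rewrite normc1 normc_ce => E.
  have /eqP := expR_inj (etrans E (esym (@expR0 R))).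
  by rewrite mulf_eq0 (negbTE (@twopi_neq0 R)) orbF oppr_eq0 => /eqP.
exists n; have lE : l = (complex.Re l - n%:~R)%:C + ZC n.
  rewrite intr_complex -rmorphD subrK; case: l I0 {H nP} => a b /= -> //.
rewrite lE ce_shift_2pi in H.
have /andP[+ _] := normc_ce_2pi_sub1 nP.
rewrite H subrr normc0 pmulr_rle0 ?cos_pi4_gt0// pmulr_rle0// normr_le0 => /eqP h0.
by rewrite lE h0 add0r.
Qed.

Lemma has_order_1sub_ce l : has_order (fun z => 1 - ce z (2 * pi)) l (ce l (2 * pi) == 1).
Proof.
case: eqVneq => [/ce_2pi_eq1[n ->]|l1] /=.
  exists (cos (pi / 2 / 2) ^+ 2 * 2), 8, 2^-1; split; [|by rewrite invr_gt0|].
    by apply: mulr_gt0 => //; exact: cos_pi4_gt0.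
  move=> s s0 s2; rewrite [ZC n + _]addrC ce_shift_2pi normc_distC expr1 -mulrA.
  have := @normc_ce_2pi_sub1 s; rewrite (gtr0_norm s0); apply; exact: ltW.
apply: (@has_order_lipschitz _ _ (ce_bound l * (2 * pi))) => [s s0|]; last by rewrite subr_eq0 eq_sym.
have -> : 1 - ce (l + s%:C) (2 * pi) - (1 - ce l (2 * pi)) =
  - (ce (l + s%:C) (2 * pi) - ce l (2 * pi)) by ring.
rewrite normcN (le_trans (ce_shift_le _ _ _))//; first by rewrite lexx ltW// twopi_gt0.
by rewrite (gtr0_norm s0) le_eqVlt; apply/orP; left; apply/eqP; ring.
Qed.

End order_calculus.

(** * Local reduction to a polynomial *)

Section characteristic_polynomial.
Context {R : realType}.
Local Open Scope complex_scope.
Local Notation ZC n := (n%:~R : R[i]).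
Implicit Types (l z : R[i]) (n m : int).

(** On the ray close to [l], [Delta K] times [q] equals [q - w] times [1 - ce] times [1 + V], where
    [q] has simple zeros at the points of [s]. The last hypothesis makes [q] and [1 - ce] vanish at
    [l] together, so they cancel in the count of orders. The second alternative for a root is $\sum
    a_n/(z - n) = 1$ combined with $|a_n| \le 4/3 |k_n|$. *)
Lemma Delta_local_roots (K : L2 R) (s : seq int) (Om : R[i] -> Prop) :
  uniq s -> (forall n, n \in s -> Om (ZC n)) ->
  (forall z, Om z -> sums_le (fun m => if m \in s then 0
     else normc (kappa K m) / normc (z - ZC m)) 8^-1) ->
  (forall m, m \notin s ->
     \sum_(n <- s) normc (kappa K n) / normc (ZC m - ZC n) <= 8^-1) ->
  exists rs : seq R[i], [/\ size rs = size s,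
    forall z, z \in rs -> (exists2 n, n \in s & z = ZC n) \/
      1 <= \sum_(n <- s) 4 / 3 * (normc (kappa K n) / normc (z - ZC n)) &
    forall l (d : R), 0 < d -> (forall t : R, 0 < t -> t < d -> Om (l + t%:C)) ->
      (forall n, l = ZC n -> n \in s) -> has_order (Delta K) l (count_mem l rs)].
Proof.
move=> us sOm h1 h2; have [a [V [aP VP FE]]] := partial_fraction_factor us sOm h1 h2.
pose q : {poly R[i]} := \prod_(n <- s) ('X - (ZC n)%:P).
pose w : {poly R[i]} := \sum_(n <- s) a n *: \prod_(k <- s | k != n) ('X - (ZC k)%:P).
have qE z : q.[z] = \prod_(n <- s) (z - ZC n).
  by rewrite horner_prod; apply: eq_bigr => n _; rewrite !hornerE.
have pE z : (forall n, n \in s -> z - ZC n != 0) ->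
    (q - w).[z] = q.[z] * (1 - \sum_(n <- s) a n / (z - ZC n)).
  move=> z0; rewrite hornerD hornerN mulrBr mulr1; congr (_ - _).
  rewrite horner_sum mulr_sumr big_seq [RHS]big_seq; apply: eq_bigr => n ns.
  rewrite hornerZ qE (bigD1_seq n)//= horner_prod.
  under eq_bigr do rewrite !hornerE.
  by have := z0 n ns => zn; field.
have sq : size q = (size s).+1 by rewrite size_prod_XsubC.
have sw : (size w < size q)%N.
  rewrite sq ltnS /w big_seq; apply: (leq_trans (size_sum _ _ _)).
  apply/bigmax_leqP_seq => n ns _.
  rewrite (leq_trans (size_scale_leq _ _))// -big_filter size_prod_XsubC.
  by rewrite -(rem_filter n us) size_rem// prednK// -has_predT; apply/hasP; exists n.
have lp : lead_coef (q - w) = 1.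
  rewrite lead_coefDl ?size_polyN//; exact/monicP/monic_prod_XsubC.
have [rs rsE] := closed_field_poly_normal (q - w).
rewrite lp scale1r in rsE.
exists rs; split.
- have := size_prod_XsubC rs id; rewrite -rsE size_polyDl ?size_polyN// sq.
  by case=> ->.
- move=> z zrs; have [/mapP[n ns ->]|zs] := boolP (z \in [seq ZC n | n <- s]).
    by left; exists n.
  right; have z0 n : n \in s -> z - ZC n != 0.
    by move=> ns; rewrite subr_eq0; apply: contraNneq zs => ->; exact: map_f.
  have : root (q - w) z by rewrite rsE root_prod_XsubC.
  rewrite rootE pE// mulf_eq0 => /orP[|].
    rewrite qE prodf_seq_eq0 => /hasP[n ns] /=.
    by rewrite (negbTE (z0 n ns)).
  rewrite subr_eq0 => /eqP S1.
  rewrite -[leLHS](@normc1 R) [normc _](congr1 (@normc R) S1).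
  rewrite (le_trans (ler_normc_sum _ _ _))// big_seq [leRHS]big_seq.
  apply: ler_sum => n ns; rewrite normcM normcV mulrA ler_wpM2r ?invr_ge0 ?normc_ge0//.
  exact: aP.
move=> l d d0 lOm lint.
have oe := has_order_1sub_ce l.
have [c [M [e [c0 e0 He]]]] := oe.
(* At an integer [l], which [lint] places in [s], both [q] and [1 - ce] have order 1; at any other
   [l] both have order 0. *)
have oq : has_order (fun z => q.[z]) l (ce l (2 * pi) == 1).
  have := has_order_prod l [seq ZC n | n <- s].
  rewrite count_uniq_mem; last by rewrite map_inj_uniq//; exact: intr_inj.
  have -> : (l \in [seq ZC n | n <- s]) = (ce l (2 * pi) == 1).
    apply/mapP/eqP => [[n _ ->]|/ce_2pi_eq1[n ln]]; first exact: ce_int_2pi.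
    by exists n => //; exact: lint.
  by under eq_fun do rewrite big_map -qE.
have op : has_order (fun z => (q - w).[z]) l (count_mem l rs).
  have := has_order_prod l rs; congr (has_order _ _ _); apply/funext => z.
  rewrite rsE horner_prod; apply: eq_bigr => k _; by rewrite !hornerE.
have oV : has_order (fun z => 1 + V z) l 0.
  apply: (@has_order_bounded _ _ _ (5 / 6) (7 / 6) d) => // t t0 td.
  have := VP _ (lOm t t0 td); have := ler_normcD 1 (V (l + t%:C)).
  have := lerB_normc 1 (V (l + t%:C)); rewrite normc1; lra.
have oH := has_orderM (has_orderM op oe) oV.
rewrite addn0 in oH.
apply: (@has_order_cancel R _ _ _ _ _ _ (Num.min d e) _ _ oq oH).
  by rewrite lt_min d0; exact: e0.
move=> t t0; rewrite lt_min => /andP[td te].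
(* The lower bound for [1 - ce] shows that the punctured ray meets no integer, so the partial
   fractions are available there. *)
have /andP[e1 _] := He t t0 te.
have E1 : ce (l + t%:C) (2 * pi) != 1.
  by rewrite eq_sym -subr_eq0 -normc_gt0 (lt_le_trans _ e1)// mulr_gt0// exprn_gt0.
have z0 n : l + t%:C - ZC n != 0 by exact: ce_neq1_sub.
have [k kE ->] := Delta_partial_fractions K E1.
rewrite (FE _ _ (lOm t t0 td) z0 kE) pE//.
ring.
Qed.

End characteristic_polynomial.

(** * Uniform smallness of the interaction sums *)

Section smallness.
Context {R : realType}.
Local Open Scope complex_scope.
Local Notation ZC n := (n%:~R : R[i]).
Implicit Types (l z : R[i]) (n m k : int) (X : pred int).

(* Increments of this bounded function dominate [1 / (1 + |n|) ^ 2]. *)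
Definition bounded_step n : R :=
  match n with Posz p => 2 - 2 / p.+1%:R | Negz p => - (2 - 2 / p.+2%:R) end.

Lemma bounded_step_le n : -2 <= bounded_step n <= 2.
Proof.
have H (p : nat) : 0 <= (2 / p.+1%:R : R) <= 2.
  by rewrite divr_ge0//= ler_pdivrMr ?ltr0n// ler_peMr// ler1n.
case: n => p; rewrite /bounded_step; [have := H p|have := H p.+1].
  by move: (2 / _ : R) => q /andP[q0 q2]; apply/andP; split; lra.
by move: (2 / _ : R) => q /andP[q0 q2]; apply/andP; split; lra.
Qed.

Lemma bounded_step_incr n :
  (1 + `|n%:~R|) ^- 2 <= bounded_step (n + 1) - bounded_step n.
Proof.
have H (p : nat) : (p.+1%:R) ^- 2 <= 2 / p.+1%:R - 2 / p.+2%:R :> R.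
  have -> : p.+2%:R = p.+1%:R + 1 :> R by rewrite natr1.
  have : 1 <= p.+1%:R :> R by rewrite ler1n.
  move: (p.+1%:R : R) => q q1; have q0 : 0 < q by lra.
  have -> : 2 / q - 2 / (q + 1) = 2 / (q * (q + 1)).
    by field; apply/andP; split; rewrite gt_eqF//; lra.
  rewrite -[q ^- 2]mul1r ler_pdivlMr ?mulr_gt0//; last lra.
  by rewrite mulrAC ler_pdivrMr ?exprn_gt0//; nra.
case: n => p.
  rewrite -PoszD addn1 /= ger0_norm ?ler0n//.
  rewrite [1 + _]addrC natr1; apply: le_trans (H p) _.
  by rewrite le_eqVlt; apply/orP; left; apply/eqP; ring.
rewrite NegzE intrN normrN ger0_norm ?ler0n// [1 + _]addrC natr1.
have -> : - p.+1%:Z + 1 = - p%:Z by lia.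
have H2 : (p.+2%:R) ^- 2 <= 2 / p.+1%:R - 2 / p.+2%:R :> R.
  apply: le_trans (H p); rewrite lef_pV2 ?posrE ?exprn_gt0 ?ltr0n//.
  by rewrite ler_sqr ?nnegrE ?ler0n// ler_nat.
apply: le_trans H2 _; rewrite le_eqVlt; apply/orP; left; apply/eqP.
case: p => [|p]; first by rewrite /= !divr1; field.
by rewrite -[- p.+1%:Z]/(Negz p) -[- p.+2%:Z]/(Negz p.+1) /bounded_step; ring.
Qed.

(** The increments of [bounded_step] telescope over a window, and 4 is the length of $[-2, 2]$,
    which contains its values. *)
Lemma sums_le_inv_sqr k : sums_le (fun m => (1 + `|m%:~R - k%:~R : R|) ^- 2) 4.
Proof.
move=> t ut; have [M tM] := seq_sub_win t.
apply: (@le_trans _ _ (\sum_(m <- win M) (1 + `|m%:~R - k%:~R : R|) ^- 2)).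
  rewrite (big_split_sub _ ut (uniq_win M) tM) lerDl sumr_ge0//.
apply: (@le_trans _ _ (\sum_(m <- win M) (- bounded_step (m - k) - - bounded_step (m + 1 - k)))).
  apply: ler_sum => m _; rewrite opprK [- _ + _]addrC -intrB [m + 1 - k]addrAC.
  exact: bounded_step_incr.
rewrite (sum_win_telescope (fun m => - bounded_step (m - k))).
have := bounded_step_le (- M%:Z - k); have := bounded_step_le (M%:Z - k); lra.
Qed.

(** The claim is $|z - m| \ge (1 + |m - k|)/8$, squared. For [m = k] the assumed distance 1/4 gives
    it; otherwise $|z - m| \ge |m - k| - 1/2$ and $|m - k| \ge 1$ do. *)
Lemma inv_normc_sub_le z k m : `|complex.Re z - k%:~R| <= 2^-1 ->
  4^-1 <= normc (z - ZC m) ->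
  (normc (z - ZC m))^-1 ^+ 2 <= 64 * (1 + `|m%:~R - k%:~R|) ^- 2.
Proof.
move=> zk zm.
have zmr : `|complex.Re z - m%:~R| <= normc (z - ZC m).
  by have := normr_Re_le (z - ZC m); rewrite cReD cReN cRe_int.
have H : (1 + `|m%:~R - k%:~R|) / 8 <= normc (z - ZC m).
  have [mk|mk] := eqVneq m k; first by rewrite -mk subrr normr0; lra.
  have mk1 : 1 <= `|m%:~R - k%:~R| :> R.
    rewrite -intrB -intr_norm -[1]/(1%:~R) ler_int; lia.
  have : `|m%:~R - k%:~R| <= `|complex.Re z - m%:~R| + `|complex.Re z - k%:~R|.
    rewrite [`|complex.Re z - m%:~R|]distrC.
    have -> : m%:~R - k%:~R = (m%:~R - complex.Re z) + (complex.Re z - k%:~R) :> R by ring.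
    exact: ler_normD.
  lra.
have D0 : 0 < 1 + `|m%:~R - k%:~R| :> R by rewrite ltr_wpDr.
have N0 : 0 < normc (z - ZC m) by lra.
rewrite exprVn -[X in _ <= _ * X^-1]/(_ ^+ 2) ler_pdivlMr ?exprn_gt0//.
rewrite mulrC ler_pdivrMr ?exprn_gt0//.
by move: N0 H D0; move: (normc _) (1 + _) => a b; nra.
Qed.

Lemma sums_le_dist z X : (forall m, X m -> 4^-1 <= normc (z - ZC m)) ->
  sums_le (fun m => if X m then (normc (z - ZC m))^-1 ^+ 2 else 0) 256.
Proof.
move=> Xz; have [k kP] := nearest_int (complex.Re z).
have -> : 256 = 64 * 4 :> R by ring.
apply: sums_le_scale (sums_le_inv_sqr k) => // m.
case: ifP => Xm; last by rewrite mulr_ge0// invr_ge0 sqr_ge0.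
by apply: inv_normc_sub_le => //; exact: Xz.
Qed.

Variables (kap : int -> R[i]) (B : R).
Hypothesis kapB : sums_le (fun n => normc (kap n) ^+ 2) B.

(** The bound 256 of [sums_le_dist] does not depend on [z]. The weight $e/256$ therefore leaves
    [e / 2] for the distances, and [J] is taken such that the squares of [kap] outside the window
    sum to at most $e^2/256$; this makes [J] uniform in [z]. *)
Lemma tail_small (e : R) : 0 < e -> exists J : nat, forall z X,
  (forall m, X m -> m \notin win J /\ 4^-1 <= normc (z - ZC m)) ->
  sums_le (fun m => if X m then normc (kap m) / normc (z - ZC m) else 0) e.
Proof.
move=> e0; pose eta := e / 256; have eta0 : 0 < eta by rewrite divr_gt0.
have [|J JP] := sums_le_tail _ kapB (mulr_gt0 eta0 e0).
  by move=> n; exact: sqr_ge0.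
exists J => z X XP t ut.
have X1 m : X m -> 4^-1 <= normc (z - ZC m) by move=> /XP[].
have := sums_le_dist X1 ut; rewrite -!big_mkcond /= => H1.
have H2 : \sum_(m <- t | X m) normc (kap m) ^+ 2 <= eta * e.
  rewrite -big_filter; apply: JP; first by rewrite filter_uniq.
  by move=> m; rewrite mem_filter => /andP[/XP[]].
apply: (@le_trans _ _ (\sum_(m <- t | X m) (eta / 2 * (normc (z - ZC m))^-1 ^+ 2 +
    eta^-1 / 2 * normc (kap m) ^+ 2))).
  apply: ler_sum => m _; rewrite mulrC.
  apply: le_trans (mul_le_half_sqr _ _ eta0) _.
  by rewrite mulrDl mulrAC [X in _ + X <= _]mulrAC.
rewrite big_split /= -!mulr_sumr.
have h1 : eta / 2 * \sum_(m <- t | X m) (normc (z - ZC m))^-1 ^+ 2 <= e / 2.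
  apply: (@le_trans _ _ (eta / 2 * 256)); first by rewrite ler_wpM2l// divr_ge0// ltW.
  by rewrite /eta; lra.
have h2 : eta^-1 / 2 * \sum_(m <- t | X m) normc (kap m) ^+ 2 <= e / 2.
  apply: (@le_trans _ _ (eta^-1 / 2 * (eta * e))).
    by rewrite ler_wpM2l// divr_ge0// invr_ge0 ltW.
  by rewrite mulrAC mulrA mulVf ?gt_eqF// mul1r.
by rewrite (splitr e) lerD.
Qed.

(** Frequencies outside a fixed window are covered by [tail_small]. The finitely many inside have
    $|z - m| \ge D$ once $|z| \ge J + D$, and [D] is chosen with $A/D \le e/2$. *)
Lemma far_small (e : R) : 0 < e -> exists L : R, forall z X, L <= normc z ->
  (forall m, X m -> 4^-1 <= normc (z - ZC m)) ->
  sums_le (fun m => if X m then normc (kap m) / normc (z - ZC m) else 0) e.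
Proof.
move=> e0; have e2 : 0 < e / 2 by rewrite divr_gt0.
have [J JP] := tail_small e2.
pose A := \sum_(n <- win J) normc (kap n).
have A0 : 0 <= A by apply: sumr_ge0 => n _; exact: normc_ge0.
pose D := 2 * A / e + 1; have D0 : 0 < D.
  by rewrite ltr_wpDl// divr_ge0 ?(ltW e0)// mulr_ge0.
exists (J%:R + D) => z X Lz XP t ut.
have AD : A / D <= e / 2.
  rewrite ler_pdivrMr// /D; have : 2 * A / e * e = 2 * A by rewrite divfK ?gt_eqF//.
  move: (2 * A / e) => q qe; nra.
have zm m : m \in win J -> D <= normc (z - ZC m).
  rewrite mem_win => mJ; have := lerB_normc z (- ZC m).
  have : normc (ZC m) <= J%:R.
    by rewrite normc_int -intr_norm -[J%:R]/((J%:Z)%:~R) ler_int; lia.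
  rewrite normcN; lra.
have H1 : \sum_(m <- t | X m && (m \in win J)) normc (kap m) / normc (z - ZC m) <= e / 2.
  apply: le_trans AD; rewrite /A mulr_suml.
  rewrite (@le_trans _ _ (\sum_(m <- t | X m && (m \in win J)) normc (kap m) / D))//.
    apply: ler_sum => m /andP[_ mJ]; rewrite ler_wpM2l ?normc_ge0//.
    by rewrite lef_pV2 ?posrE ?zm// (lt_le_trans D0)// zm.
  rewrite -big_filter; set t' := [seq m <- t | X m && (m \in win J)].
  have t'J : {subset t' <= win J} by move=> m; rewrite mem_filter => /andP[/andP[]].
  rewrite (big_split_sub _ (filter_uniq _ ut : uniq t') (uniq_win J) t'J).
  by rewrite lerDl sumr_ge0// => m _; rewrite divr_ge0 ?normc_ge0// ltW.
have H2 : \sum_(m <- t | X m && (m \notin win J)) normc (kap m) / normc (z - ZC m) <= e / 2.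
  have := JP z [pred m | X m && (m \notin win J)]; rewrite /sums_le.
  move=> /(_ _ t ut); rewrite -big_mkcond; apply.
  by move=> m /andP[Xm mJ]; split => //; exact: XP.
rewrite -big_mkcond (bigID (fun m => m \in win J))/= (splitr e); exact: lerD.
Qed.

End smallness.

(** * Location and counting of the roots *)

Section localization.
Context {R : realType}.
Local Open Scope complex_scope.
Local Notation ZC n := (n%:~R : R[i]).
Implicit Types (l z : R[i]) (n m : int) (K : L2 R).

(** [inner] conjugates $e^{-int}$, so [hat K] is taken at $+n$; the factor compares the
    normalizations $1/\sqrt{2\pi}$ and $1/(2\pi)$. *)
Lemma inner_psi K n : inner (psi n) K = (Num.sqrt (2 * pi))%:C * kappa K n.
Proof.
have E : inner (psi n) K = (Num.sqrt (2 * pi))^-1%:C * hat K (ZC n).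
  rewrite /hat -cintegralZ; [|exact: measurable_per_itv|].
    apply: eq_cintegral => t _; rewrite mulrA; congr (_ * _).
    rewrite intr_complex ce_real /psi; apply/eqP; rewrite eq_complex /=.
    by apply/andP; split; apply/eqP; ring.
  by apply: cintegrableM_ce; exact: L2_square_integrable.
rewrite E /kappa mulrA -rmorphM; congr (_%:C * _).
have h0 : 0 <= 2 * pi :> R by exact: ltW twopi_gt0.
have s0 : Num.sqrt (2 * pi) != 0 :> R by rewrite gt_eqF// sqrtr_gt0 twopi_gt0.
rewrite -{3}(sqr_sqrtr h0) expr2 invfM mulrA divff// mul1r//.
Qed.

(** The lower bound exceeds 4/3, which puts the root inside the disk; the upper one, with $|k_n| \le
    1/32$, keeps the disk within the strip of width 1 around [n]. *)
Lemma sqrt_2pi_bounds : 2 <= Num.sqrt (2 * pi : R) <= 3.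
Proof.
have p2 := pi_ge2 R; have p4 := pihalf_lt2 R.
apply/andP; split.
  rewrite -[leLHS](ger0_norm (ler0n R 2)) -sqrtr_sqr ler_wsqrtr//.
  by move: (pi : R) p2 => p; lra.
rewrite -[leRHS](ger0_norm (ler0n R 3)) -sqrtr_sqr ler_wsqrtr//.
by move: (pi : R) p4 => p; lra.
Qed.

(** Symmetric, unlike [win], so that its size is the $2N + 1$ of the rectangle. *)
Definition centered_window (N : nat) : seq int :=
  [seq Posz k | k <- iota 0 N.+1] ++ [seq Negz k | k <- iota 0 N].

Lemma mem_centered_window N n : (n \in centered_window N) = (`|n| <= N)%N.
Proof.
rewrite mem_cat; case: n => k.
  rewrite mem_map ?mem_iota ?add0n; last by move=> ? ? [].
  have -> : (Posz k \in [seq Negz j | j <- iota 0 N]) = false.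
    by apply/negbTE/mapP => -[].
  by rewrite orbF /= ltnS.
have -> : (Negz k \in [seq Posz j | j <- iota 0 N.+1]) = false.
  by apply/negbTE/mapP => -[].
by rewrite mem_map ?mem_iota ?add0n//; move=> ? ? [].
Qed.

Lemma uniq_centered_window N : uniq (centered_window N).
Proof.
rewrite cat_uniq !map_inj_uniq ?iota_uniq ?andbT; try by move=> ? ? [].
by apply/hasPn => _ /mapP[k _ ->]; apply/mapP => -[].
Qed.

Lemma size_centered_window N : size (centered_window N) = (2 * N + 1)%N.
Proof. by rewrite size_cat !size_map !size_iota; lia. Qed.

Lemma dist_Re_le z m : `|complex.Re z - m%:~R| <= normc (z - ZC m).
Proof. by have := normr_Re_le (z - ZC m); rewrite cReD cReN cRe_int. Qed.

Lemma dist_Im_le z m : `|complex.Im z| <= normc (z - ZC m).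
Proof. by have := normr_Im_le (z - ZC m); rewrite cImD cImN cIm_int subr0. Qed.

Lemma absz_real (n : int) : `|n%:~R| = (`|n|%N)%:R :> R.
Proof. by rewrite -intr_norm -abszE. Qed.

Lemma dist_int n m : n != m -> 1 <= normc (ZC n - ZC m).
Proof. by move=> nm; rewrite -intrB normc_int absz_real ler1n; lia. Qed.

Lemma eigenvalue_has_order K l (m : nat) : has_order (Delta K) l m ->
  (is_eigenvalue (P1 K) l <-> (0 < m)%N) /\ ((0 < m)%N -> alg_mult (P1 K) l m).
Proof.
case: m => [|m] H.
  by split=> //; split=> // /(order0_not_eigenvalue H).
by have [e a] := P1_order_multiplicity (ltn0Sn m) H.
Qed.

(** Double counting: each entry of [t] is counted by exactly one element of [undup t]. *)
Lemma sum_count_mem_undup (T : eqType) (t : seq T) :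
  (\sum_(x <- undup t) count_mem x t)%N = size t.
Proof.
under eq_bigr do rewrite -sum1_count big_mkcond.
rewrite exchange_big -sum1_size /= big_seq [RHS]big_seq; apply: eq_bigr => x xt.
rewrite -big_mkcond sum1_count /=.
under eq_count do rewrite eq_sym.
by rewrite (count_uniq_mem x (undup_uniq t)) mem_undup xt.
Qed.

Section thresholds.
Variables (K : L2 R) (J : nat) (L : R).
Hypothesis JP : forall z (X : pred int),
  (forall m, X m -> m \notin win J /\ 4^-1 <= normc (z - ZC m)) ->
  sums_le (fun m => if X m then normc (kappa K m) / normc (z - ZC m) else 0) 8^-1.
Hypothesis LP : forall z (X : pred int), L <= normc z ->
  (forall m, X m -> 4^-1 <= normc (z - ZC m)) ->
  sums_le (fun m => if X m then normc (kappa K m) / normc (z - ZC m) else 0) 8^-1.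
Variable N : nat.
Hypothesis JN : (J <= N)%N.
Hypothesis LN : L <= N%:R.

(** [Om] is the strip up to $N + 3/4$: it keeps distance 1/4 from the integers outside the window,
    and it leaves room 1/4 beyond the line of real part $N + 1/2$, where orders are read to the
    right. *)
Lemma window_roots (b : R) : 1 <= b -> L <= b ->
  exists rs : seq R[i], [/\ size rs = (2 * N + 1)%N,
    forall z, z \in rs -> rectangle N b z &
    forall l, `|complex.Re l| <= N%:R + 2^-1 -> has_order (Delta K) l (count_mem l rs)].
Proof.
move=> b1 Lb; have [||||rs [szrs rsP ordP]] := @Delta_local_roots R K (centered_window N)
   (fun z => `|complex.Re z| <= N%:R + 3 / 4).
- exact: uniq_centered_window.
- move=> n; rewrite mem_centered_window cRe_int absz_real => nN.
  have : (`|n|%N)%:R <= N%:R :> R by rewrite ler_nat.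
  lra.
- move=> z zN.
  have := @JP z [pred m | m \notin centered_window N].
  rewrite (_ : (fun m => if m \in _ then 0 else _) = (fun m => if m \notin centered_window N then
    normc (kappa K m) / normc (z - ZC m) else 0)); last by apply/funext => m; rewrite if_neg.
  apply=> m /=; rewrite mem_centered_window -ltnNge => Nm; split.
    by rewrite mem_win; lia.
  apply: le_trans _ (dist_Re_le _ _).
  have : N%:R + 1 <= `|m%:~R| :> R by rewrite absz_real natr1 ler_nat.
  by have := lerB_dist m%:~R (complex.Re z); rewrite distrC; lra.
(* An integer outside the window has modulus at least [L], so it counts as far away from the whole
   window. *)
- move=> m; rewrite mem_centered_window -ltnNge => Nm.
  have := @LP (ZC m) [pred n | n \in centered_window N].
  rewrite /sums_le => /(_ _ _ (centered_window N) (uniq_centered_window N)).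
  rewrite -big_mkcond /= -big_seq; apply.
    by rewrite normc_int absz_real (le_trans LN)// ler_nat ltnW.
  move=> n; rewrite mem_centered_window => nN.
  have : m != n by apply: contraTneq Nm => ->; rewrite -leqNgt.
  by move=> /dist_int; lra.
exists rs; split; first by rewrite szrs size_centered_window.
- move=> z /rsP[[n + ->]|].
    rewrite mem_centered_window /rectangle /= cRe_int cIm_int => nN.
    have : `|n%:~R| <= N%:R :> R by rewrite absz_real ler_nat.
    by rewrite ler_norml => /andP[h1 h2]; split; apply/andP; split; lra.
  rewrite -mulr_sumr => S1.
  have [zin|zout] := boolP ((`|complex.Re z| <= N%:R + 2^-1) && (`|complex.Im z| <= b)).
    by move: zin; rewrite !ler_norml => /andP[].
  (* Outside the rectangle [z] is far away and the root criterion would read $1 \le 4/3 \cdot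
     1/8$. *)
  suff : \sum_(n <- centered_window N) normc (kappa K n) / normc (z - ZC n) <= 8^-1 by lra.
  have := @LP z [pred n | n \in centered_window N].
  rewrite /sums_le => /(_ _ _ (centered_window N) (uniq_centered_window N)).
  rewrite -big_mkcond /= -big_seq; apply.
    move: zout; rewrite negb_and -!ltNge => /orP[zo|zo].
      by have := normr_Re_le z; move: LN; lra.
    by have := normr_Im_le z; lra.
  move=> n; rewrite mem_centered_window => nN.
  move: zout; rewrite negb_and -!ltNge => /orP[zo|zo].
    apply: le_trans _ (dist_Re_le _ _).
    have : `|n%:~R| <= N%:R :> R by rewrite absz_real ler_nat.
    by have := lerB_dist (complex.Re z) n%:~R; lra.
  by have := dist_Im_le z n; lra.
move=> l lN; apply: (ordP l 4^-1) => [|t t0 t4|n ln]; first by rewrite invr_gt0.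
  rewrite cReD /= (le_trans (ler_normD _ _))// (gtr0_norm t0); lra.
move: lN; rewrite ln cRe_int mem_centered_window absz_real => H.
rewrite -ltnS -(ltr_nat R) -natr1; lra.
Qed.

(** The tail estimate for the single frequency [n] is evaluated at $n + 1/4$, where the denominator
    is 1/4. *)
Lemma kappa_le n : (N < `|n|)%N -> normc (kappa K n) <= 32^-1.
Proof.
move=> Nn; have := @JP (ZC n + (4^-1)%:C) (pred1 n).
have E : ZC n + (4^-1)%:C - ZC n = (4^-1)%:C by rewrite addrC addKr.
have E4 : normc ((4^-1)%:C : R[i]) = 4^-1 by rewrite normcR ger0_norm.
rewrite /sums_le => /(_ _ [:: n] isT); rewrite big_seq1 /= eqxx E E4.
have H : forall m, pred1 n m -> m \notin win J /\ 4^-1 <= normc (ZC n + (4^-1)%:C - ZC m).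
  by move=> m /= /eqP->; rewrite E E4; split => //; rewrite mem_win; lia.
by move=> /(_ H); rewrite ler_pdivrMr; lra.
Qed.

(** With one frequency the polynomial has degree 1, and the root criterion becomes $|z_0 - n| \le
    4/3 |k_n|$. The other frequencies are small because the strip around [n] is far from 0; at the
    other integers only $k_n$ acts, which belongs to the tail. *)
Lemma single_root n : (N < `|n|)%N -> exists z0, [/\
  normc (z0 - ZC n) <= 4 / 3 * normc (kappa K n) &
  forall l, `|complex.Re l - n%:~R| <= 2^-1 -> has_order (Delta K) l (l == z0)].
Proof.
move=> Nn; have nN : N%:R + 1 <= `|n%:~R| :> R by rewrite absz_real natr1 ler_nat.
have [||||rs [szrs rsP ordP]] := @Delta_local_roots R K [:: n]
   (fun z => `|complex.Re z - n%:~R| <= 3 / 4).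
- by [].
- by move=> m; rewrite inE => /eqP->; rewrite cRe_int subrr normr0 divr_ge0.
- move=> z zn.
  have := @LP z [pred m | m != n].
  rewrite (_ : (fun m => if m \in _ then 0 else _) = (fun m => if m != n then
    normc (kappa K m) / normc (z - ZC m) else 0)); last first.
    by apply/funext => m; rewrite inE if_neg.
  have zn' : `|n%:~R| - `|complex.Re z| <= `|complex.Re z - n%:~R|.
    by rewrite distrC lerB_dist.
  apply; first by have := normr_Re_le z; move: LN; lra.
  move=> m /= mn; apply: le_trans _ (dist_Re_le _ _).
  have : 1 <= `|m%:~R - n%:~R| :> R by rewrite -intrB absz_real ler1n; lia.
  have : `|m%:~R - n%:~R| <= `|complex.Re z - m%:~R| + `|complex.Re z - n%:~R| :> R.
    rewrite [`|complex.Re z - m%:~R|]distrC.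
    have -> : m%:~R - n%:~R = (m%:~R - complex.Re z) + (complex.Re z - n%:~R) :> R by ring.
    exact: ler_normD.
  lra.
- move=> m; rewrite inE => mn; have := @JP (ZC m) (pred1 n).
  rewrite /sums_le => /(_ _ [:: n] isT); rewrite !big_seq1 /= eqxx; apply.
  move=> k /= /eqP ->; split; first by rewrite mem_win; lia.
  by have := dist_int mn; lra.
case: rs szrs rsP ordP => [//|z0 [|//]] _ rsP ordP.
exists z0; split.
  have [|[k]|] := rsP z0; first by rewrite mem_head.
    by rewrite inE => /eqP-> ->; rewrite subrr normc0 mulr_ge0 ?divr_ge0 ?normc_ge0.
  rewrite big_seq1; have [->|zn] := eqVneq z0 (ZC n).
    by rewrite subrr normc0 mulr_ge0 ?divr_ge0 ?normc_ge0.
  by rewrite mulrA ler_pdivlMr ?normc_gt0 ?subr_eq0// mul1r.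
move=> l ln; have := ordP l 4^-1; rewrite /= addn0 eq_sym; apply.
- by rewrite invr_gt0.
- move=> t t0 t4; rewrite cReD /= addrAC (le_trans (ler_normD _ _))// (gtr0_norm t0); lra.
move=> k lk; move: ln; rewrite lk cRe_int -intrB absz_real inE => H.
have : (`|(k - n)%R| < 1)%N by rewrite -(ltr_nat R); lra.
lia.
Qed.

End thresholds.

End localization.

Theorem theorem3p14 (R : realType) (K : L2 R) :
  exists (N0 : nat) (b0 : R), 0 < b0 /\
    forall (N : nat) (b : R), (N0 <= N)%N -> b0 <= b ->
    [/\ eigenvalue_count (P1 K) (rectangle N b) (2 * N + 1)%N,
        forall n : int, (N < `|n|)%N -> inner (psi n) K != 0 ->
          exists l : R[i],
            [/\ is_eigenvalue (P1 K) l,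
                disk n%:~R `|inner (psi n) K| l,
                alg_mult (P1 K) l 1 &
                forall l' : R[i], is_eigenvalue (P1 K) l' ->
                  disk n%:~R `|inner (psi n) K| l' -> l' = l],
        forall n : int, (N < `|n|)%N -> inner (psi n) K = 0 ->
          is_eigenvalue (P1 K) n%:~R /\ alg_mult (P1 K) n%:~R 1 &
        forall l : R[i], is_eigenvalue (P1 K) l ->
          [\/ rectangle N b l,
              exists n : int, [/\ (N < `|n|)%N, inner (psi n) K != 0 &
                                  disk n%:~R `|inner (psi n) K| l] |
              exists n : int, [/\ (N < `|n|)%N, inner (psi n) K = 0 &
                                  l = n%:~R]]].
Proof.
have [B kapB] := kappa_sums_le K.
have e8 : 0 < 8^-1 :> R by rewrite invr_gt0.
have [J JP] := tail_small kapB e8; have [L LP] := far_small kapB e8.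
(* The successor of the truncation dominates [L]; a height of at least 1 keeps points above or below
   the rectangle away from the integers. *)
exists (maxn J (Num.trunc L).+1), (Num.max 1 L); split; first by rewrite lt_max ltr01.
move=> N b; rewrite geq_max ge_max => /andP[JN LN'] /andP[b1 Lb].
have LN : L <= N%:R.
  by rewrite (le_trans (ltW (truncnS_gt L)))// ler_nat.
have [rs [szrs rsin rsord]] := window_roots JP LP JN LN b1 Lb.
have /andP[s2 s3] := @sqrt_2pi_bounds R.
have s0 : 0 < Num.sqrt (2 * pi) :> R by lra.
have nk n : normc (inner (psi n) K) = Num.sqrt (2 * pi) * normc (kappa K n).
  by rewrite inner_psi normcM normcR gtr0_norm.
have k0 n : (kappa K n == 0) = (inner (psi n) K == 0).
  by rewrite -!normc_eq0 nk mulf_eq0 (gt_eqF s0).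
have diskE n l : disk n%:~R `|inner (psi n) K| l <->
    normc (l - n%:~R) < Num.sqrt (2 * pi) * normc (kappa K n).
  by rewrite /disk /= !normr_normc ltcR nk.
have root_disk n z0 : normc (z0 - n%:~R) <= 4 / 3 * normc (kappa K n) ->
    inner (psi n) K != 0 -> disk n%:~R `|inner (psi n) K| z0.
  rewrite -k0 -normc_gt0 => z0n k1; apply/diskE; apply: le_lt_trans z0n _.
  by rewrite ltr_pM2r//; lra.
have strip n l : (N < `|n|)%N -> normc (l - n%:~R) <= Num.sqrt (2 * pi) * normc (kappa K n) ->
    `|complex.Re l - n%:~R| <= 2^-1.
  move=> Nn ln; apply: le_trans (dist_Re_le _ _) _; apply: (le_trans ln).
  have := kappa_le JP JN LN Nn; have := normc_ge0 (kappa K n).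
  by move: (normc _) => k; nra.
have root_strip n z0 : (N < `|n|)%N -> normc (z0 - n%:~R) <= 4 / 3 * normc (kappa K n) ->
    `|complex.Re z0 - n%:~R| <= 2^-1.
  move=> Nn z0n; apply: strip => //; apply: (le_trans z0n).
  by rewrite ler_wpM2r ?normc_ge0//; lra.
split.
- exists (undup rs), (fun l => count_mem l rs); split.
  + exact: undup_uniq.
  + move=> l; rewrite mem_undup; split=> [lrs|[el [/andP[r1 r2] _]]].
      have rl := rsin l lrs; split => //; case: rl => /andP[r1 r2] _.
      have [|[_ +] _] := eigenvalue_has_order (rsord l _); first by rewrite ler_norml r1.
      by apply; rewrite -has_pred1 has_count in lrs.
    have [|[+ _] _] := eigenvalue_has_order (rsord l _); first by rewrite ler_norml r1.
    by move=> /(_ el); rewrite -has_count has_pred1.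
  + move=> l; rewrite mem_undup => lrs; have [/andP[r1 r2] _] := rsin l lrs.
    have [|_] := eigenvalue_has_order (rsord l _); first by rewrite ler_norml r1.
    by apply; rewrite -has_pred1 has_count in lrs.
  + rewrite -szrs sum_count_mem_undup//.
- move=> n Nn kn; have [z0 [z0n ord]] := single_root JP LP JN LN Nn.
  have [[_ ez] az] := eigenvalue_has_order (ord z0 (root_strip n z0 Nn z0n)).
  rewrite eqxx in ez az; exists z0; split; [exact: ez|exact: root_disk|exact: az|].
  (* The disk lies in the strip around [n], where [z0] is the only zero. *)
  move=> l' el' /diskE /ltW dl'.
  have [[+ _] _] := eigenvalue_has_order (ord l' (strip n l' Nn dl')).
  by move=> /(_ el'); case: eqP.
- move=> n Nn kn; have [z0 [z0n ord]] := single_root JP LP JN LN Nn.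
  (* The bound $4/3 |k_n|$ on the distance of the root from [n] collapses to 0. *)
  have z0E : z0 = n%:~R.
    have kap0 : kappa K n = 0 by apply/eqP; rewrite k0 kn.
    apply/eqP; rewrite -subr_eq0 -normc_eq0; apply/eqP/le_anti.
    by rewrite normc_ge0 (le_trans z0n)// kap0 normc0 mulr0.
  have [[_ ez] az] := eigenvalue_has_order (ord z0 (root_strip n z0 Nn z0n)).
  by rewrite eqxx z0E in ez az; split; [exact: ez|exact: az].
(* The roots in [rs] exhaust the whole vertical strip of half-width $N + 1/2$, and they lie in the
   rectangle. Any other [l] has real part within 1/2 of an integer [n] with [N < |n|]. *)
move=> l el; have [lN|Nl] := leP `|complex.Re l| (N%:R + 2^-1).
  have [[+ _] _] := eigenvalue_has_order (rsord l lN).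
  by move=> /(_ el); rewrite -has_count has_pred1 => /rsin; exact: Or31.
have [n nl] := nearest_int (complex.Re l).
have Nn : (N < `|n|)%N.
  rewrite -(ltr_nat R) -absz_real.
  by have := lerB_dist (complex.Re l) n%:~R; lra.
have [z0 [z0n ord]] := single_root JP LP JN LN Nn.
have [[+ _] _] := eigenvalue_has_order (ord l nl).
move=> /(_ el); case: eqP => // lz0 _; rewrite lz0.
have [kn|kn] := eqVneq (inner (psi n) K) 0.
  apply: Or33; exists n; split => //.
  have kap0 : kappa K n = 0 by apply/eqP; rewrite k0 kn.
  apply/eqP; rewrite -subr_eq0 -normc_eq0; apply/eqP/le_anti.
  by rewrite normc_ge0 (le_trans z0n)// kap0 normc0 mulr0.
by apply: Or32; exists n; split => //; exact: root_disk.
Qed.
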